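(* The functions $EG^{+}$ and $EG^{-}$ are locally Hölder continuous plurisubharmonic functions on $\mathbb{C}^2$. Moreover, $EG^{\pm}$ are strictly positive and pluriharmonic outside \[ \mathcal{K}^{\pm}=\overline{\bigcup_{\Lambda\in X}K_\Lambda^{\pm}} \] and vanish precisely on \[ \mathcal{K}_0^{\pm}=\bigcap_{\Lambda\in X}K_\Lambda^{\pm}. \] Each assertion containing $\pm$ is understood for both choices of sign.
   Context: Let $M\subset\mathbb{C}^k$ be compact. For each $\lambda\in M$ let \[ H_\lambda = H_\lambda^{(s)}\circ H_\lambda^{(s-1)}\circ\cdots\circ H_\lambda^{(1)}:\mathbb{C}^2\to\mathbb{C}^2,\qquad H_\lambda^{(j)}(x,y) = (y,\, p_{j,\lambda}(y) - a_j(\lambda)x), \] where the number of factors $s\ge1$ and the degrees $d_j\ge2$ do not depend on $\lambda$, $p_{j,\lambda}(y)$ is a monic polynomial of degree $d_j$ whose coefficients are continuous functions of $\lambda\in M$, and $a_j$ is a continuous function on $M$ with $a_j(\lambda)\ne0$ for all $\lambda$. Each $H_\lambda$ is a polynomial automorphism of $\mathbb{C}^2$ of degree $d=d_1d_2\cdots d_s$. Let $m$ be normalized Lebesgue measure on $M$. Let $X=M\times M\times\cdots$ (countably many copies) with the product topology, and let $\overline m=m\times m\times\cdots$ be the product probability measure on $X$. For $\Lambda=(\lambda_1,\lambda_2,\ldots)\in X$ and $n\ge1$ put \[ H_{n,\Lambda}^{\pm} = H_{\lambda_n}^{\pm1}\circ H_{\lambda_{n-1}}^{\pm1}\circ\cdots\circ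 H_{\lambda_1}^{\pm1},\qquad K_\Lambda^{\pm}=\{z\in\mathbb{C}^2: (H_{n,\Lambda}^{\pm}(z))_{n\ge0}\text{ is bounded in }\mathbb{C}^2\}, \] where $H_{0,\Lambda}^{\pm}$ is the identity. The Green functions are \[ G_\Lambda^{\pm}(z)=\lim_{n\to\infty}\frac1{d^n}\log^+\Vert H_{n,\Lambda}^{\pm}(z)\Vert \] (the limit exists locally uniformly on $\mathbb{C}^2$ and depends continuously on $\Lambda$), where $\log^+t=\max\{\log t,0\}$, and the average Green functions are \[ EG^{\pm}(z)=\int_X G_\Lambda^{\pm}(z)\,d\overline m(\Lambda). \]
   Formalization: M is assumed to have positive Lebesgue measure, so that m is defined, and the inclusion of the zero set of EG^± in K_0^± is proved only when m charges every nonempty relatively open subset of M; without this it fails, e.g. for a small disc plus an isolated point. *)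

(* Defs.v *)
From HB Require Import structures.
From mathcomp Require Import all_boot all_order all_algebra.
From mathcomp Require Import complex.
From mathcomp Require Import all_classical all_reals all_analysis.

Set Implicit Arguments.
Unset Strict Implicit.
Unset Printing Implicit Defensive.
Import Order.TTheory GRing.Theory Num.Theory.
Import numFieldNormedType.Exports.

Local Open Scope classical_set_scope.
Local Open Scope ring_scope.
Local Open Scope complex_scope.

HB.instance Definition _ (R : realType) :=
  NormedModule.copy R[i] (R[i] : numClosedFieldType)^o.

Section Maps.
Context {R : realType}.
Local Notation C := R[i].

(* The library's norm on products and matrices is the maximum norm, with
   values in [C]; [norm2] is the real-valued Euclidean norm on [C^2]. *)
Definition norm2 (z : C * C) : R :=
  Num.sqrt (Normc.normc z.1 ^+ 2 + Normc.normc z.2 ^+ 2).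

Definition log_plus (t : R) : R := Num.max (ln t) 0.

Definition henon1 (p : {poly C}) (a : C) (z : C * C) : C * C :=
  (z.2, p.[z.2] - a * z.1).

Definition henon1_inv (p : {poly C}) (a : C) (z : C * C) : C * C :=
  ((p.[z.1] - z.2) / a, z.1).

Lemma henon1K p a : a != 0 -> cancel (henon1 p a) (henon1_inv p a).
Proof.
by move=> a0 [x y]; rewrite /henon1_inv /henon1/= subKr mulrAC mulfV ?mul1r.
Qed.

Lemma henon1_invK p a : a != 0 -> cancel (henon1_inv p a) (henon1 p a).
Proof.
move=> a0 [x y]; rewrite /henon1_inv /henon1/=.
by rewrite mulrCA mulfV// mulr1 subKr.
Qed.

Section Family.
Context {T : Type} {s : nat}.
Variables (p : 'I_s -> T -> {poly C}) (a : 'I_s -> T -> C).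

(* The factor of index [0] is applied first. *)
Definition henon (l : T) (z : C * C) : C * C :=
  foldl (fun w j => henon1 (p j l) (a j l) w) z (enum 'I_s).

Definition henon_inv (l : T) (z : C * C) : C * C :=
  foldr (fun j w => henon1_inv (p j l) (a j l) w) z (enum 'I_s).

Lemma henonK l : (forall j, a j l != 0) -> cancel (henon l) (henon_inv l).
Proof.
rewrite /henon /henon_inv => a0 z.
elim: (enum 'I_s) z => [//|j r IH] z /=.
by rewrite IH henon1K.
Qed.

Lemma henon_invK l : (forall j, a j l != 0) -> cancel (henon_inv l) (henon l).
Proof.
rewrite /henon /henon_inv => a0 z.
elim: (enum 'I_s) => [//|j r IH] /=.
by rewrite henon1_invK.
Qed.

(* [H_l] for [fwd = true] and its inverse for [fwd = false]. *)
Definition henon_pm (fwd : bool) : T -> C * C -> C * C :=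
  if fwd then henon else henon_inv.

End Family.

Section Orbit.
Context {T : Type}.
Variable F : T -> C * C -> C * C.

(* Parameter sequences are indexed from [0]: [L n] is the (n+1)-st entry. *)
Fixpoint orbit_seq (L : nat -> T) (n : nat) (z : C * C) : C * C :=
  if n is n'.+1 then F (L n') (orbit_seq L n' z) else z.

Definition filled_julia (L : nat -> T) : set (C * C) :=
  [set z | exists B : R, forall n, norm2 (orbit_seq L n z) <= B].

Definition green (d : nat) (L : nat -> T) (z : C * C) : R :=
  lim ((fun n => log_plus (norm2 (orbit_seq L n z)) / d%:R ^+ n) @ \oo).

Definition param_seqs (M : set T) : set (nat -> T) :=
  [set L | forall n, M (L n)].

Definition julia_union (M : set T) : set (C * C) :=
  closure (\bigcup_(L in param_seqs M) filled_julia L).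

Definition julia_inter (M : set T) : set (C * C) :=
  \bigcap_(L in param_seqs M) filled_julia L.

End Orbit.

End Maps.

Section Measure.
Context {R : realType}.
Local Notation C := R[i].

(* Lebesgue measure on [C^k = R^(2k)] as an iterated integral (Tonelli). *)
Fixpoint lebesgue_Cn (k : nat) : set 'rV[C]_k -> \bar R :=
  match k with
  | 0%N => fun A => (\1_A (0 : 'rV[C]_0))%:E
  | k'.+1 => fun A =>
      (\int[@lebesgue_measure R]_x \int[@lebesgue_measure R]_y
         @lebesgue_Cn k'
           [set v | A (row_mx (const_mx (x +i* y) : 'rV_1) v : 'rV_(1 + k'))])%E
  end.

Definition normalized_lebesgue (k : nat) (M A : set 'rV[C]_k) : \bar R :=
  (lebesgue_Cn (A `&` M) * ((fine (lebesgue_Cn M))^-1)%:E)%E.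

(* Not automatic for a compact [M] of positive measure: the union of a closed
   ball and a point outside it is a counterexample. *)
Definition full_lebesgue_support (k : nat) (M : set 'rV[C]_k) : Prop :=
  forall U : set 'rV[C]_k, open U -> U `&` M !=set0 ->
    (0 < lebesgue_Cn (U `&` M))%E.

(* The sigma-algebra on sequences in [C^k] is the countable power of the Borel
   sigma-algebra, generated by the preimages of Borel sets under the
   coordinates. *)
Definition coordinate_sets (k : nat) : set (set (nat -> 'rV[C]_k)) :=
  [set B | exists n, exists2 A : set 'rV[C]_k,
     <<s open >> A & B = [set L | A (L n)]].

Definition seq_space (k : nat) : Type :=
  g_sigma_algebraType (@coordinate_sets k).

HB.instance Definition _ k := Measurable.on (seq_space k).

(* The values on cylinders determine a probability measure. *)
Definition is_product_measure (k : nat) (m : set 'rV[C]_k -> \bar R)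
    (P : probability (seq_space k) R) : Prop :=
  forall (n : nat) (A : nat -> set 'rV[C]_k),
    (forall i, <<s open >> (A i)) ->
    P [set L : seq_space k | forall i, (i < n)%N -> A i (L i)] =
    (\prod_(i < n) m (A i))%E.

Definition average_green (k : nat) (P : probability (seq_space k) R)
    (F : 'rV[C]_k -> C * C -> C * C) (d : nat) (M : set 'rV[C]_k)
    (z : C * C) : R :=
  \int[P]_(L in (param_seqs M : set (seq_space k))) green F d L z.

End Measure.

Section Regularity.
Context {R : realType}.
Local Notation C := R[i].

Definition locally_holder (u : C * C -> R) : Prop :=
  forall K : set (C * C), compact K ->
    exists L alpha : R, [/\ 0 < alpha, alpha <= 1 &
      forall z w, K z -> K w -> `|u z - u w| <= L * norm2 (z - w) `^ alpha].

Definition upper_semicontinuous {T : topologicalType} (u : T -> \bar R) :=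
  lower_semicontinuous (fun x => - u x)%E.

Definition circle (c : C) (r theta : R) : C :=
  c + r%:C * (cos theta +i* sin theta).

Definition subharmonic (v : C -> \bar R) : Prop :=
  [/\ forall t, (v t < +oo)%E,
      upper_semicontinuous v &
      forall (c : C) (r : R), 0 < r ->
        (v c <= ((2 * pi)^-1)%:E *
          \int[@lebesgue_measure R]_(theta in `[0%R, (2 * pi)%R : R])
             v (circle c r theta))%E].

Definition plurisubharmonic (u : C * C -> \bar R) : Prop :=
  [/\ forall z, (u z < +oo)%E,
      upper_semicontinuous u &
      forall z b : C * C, subharmonic (fun t : C => u (z + t *: b))].

(* Derivative in the real direction [b] of [C^2 = R^4]. *)
Definition real_deriv (b : C * C) (u : C * C -> R) (z : C * C) : R :=
  derive1 (fun t : R => u (z + t%:C *: b)) 0.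

Definition C1_on (U : set (C * C)) (u : C * C -> R) : Prop :=
  forall b z, U z ->
    derivable (fun t : R => u (z + t%:C *: b)) 0 1 /\
    {for z, continuous (real_deriv b u)}.

Definition C2_on (U : set (C * C)) (u : C * C -> R) : Prop :=
  C1_on U u /\ forall b, C1_on U (real_deriv b u).

(* With [t = x + i y], the sum below is the Laplacian in [(x, y)] of
   [u (z + t b)] at [t = 0]: [u] is harmonic along each complex line. *)
Definition pluriharmonic_on (U : set (C * C)) (u : C * C -> R) : Prop :=
  C2_on U u /\ forall z b, U z ->
    real_deriv b (real_deriv b u) z +
    real_deriv ('i *: b) (real_deriv ('i *: b) u) z = 0.

End Regularity.

(* Main.v *)
(** For a Henon factor or the inverse of one, let [big] be the coordinate fed into
the polynomial and [small] the one that enters linearly. Uniformly in the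
parameter, the region [escaping] where [big] dominates is mapped into itself with [log |H z| = d log |z| + O(1)], and an orbit that never enters it is
bounded. Hence [log+ |H_n z| / d^n] converges with an error [O(d^-n)], uniformly
in the parameter sequence, and distances relative to [max(1, |z|)] grow at most
geometrically along orbits; the two facts together make the Green functions
Hoelder continuous with constants independent of the sequence.

On a complex line [H_n] is a pair of polynomials. If [P] is a polynomial and [w]
a primitive [N]-th root of unity, the product of the [P (r w^j)] is explicit and
shows that the means of [log |P|] over [r, r w, .., r w^(N-1)] are at least
[log |P 0|] in the limit. Dominated convergence transfers this to the averages,
where Riemann sums turn it into the mean value inequality.

Off the closed union of the filled Julia sets, [G] is locally the limit of
[d^-n log |P_n|], where on each line [P_n] has degree at most [d^n] and no root
in a disc of fixed radius. So [d^-n log |P_n|] is, up to a constant, a sum of at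
most [d^n] terms [d^-n log |t - alpha|] with [alpha] far away, and its second
order Taylor expansion has a remainder bounded independently of [n] and of the
sequence. Stated through finite differences, this bound passes to limits and to
averages, and it yields both the C^2 regularity and the Laplace equation.

Finally, having escaped at time [n] is an open condition on the first [n]
parameters, so it holds on a set of positive measure as soon as it holds once. *)

Require Import Defs.
From HB Require Import structures.
From mathcomp Require Import all_boot all_order all_algebra.
From mathcomp Require Import complex.
From mathcomp Require Import all_classical all_reals all_analysis.
From mathcomp Require Import measurable_realfun.
From mathcomp Require Import ring lra.

Set Implicit Arguments.
Unset Strict Implicit.
Unset Printing Implicit Defensive.
Import Order.TTheory GRing.Theory Num.Theory.
Import numFieldNormedType.Exports.

Local Open Scope classical_set_scope.
Local Open Scope ring_scope.
Local Open Scope complex_scope.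

Local Notation normc := Normc.normc.
Local Notation Re := complex.Re.
Local Notation Im := complex.Im.

(** * Modulus and maximum norm *)

(** The obstacle is the integral over parameter sequences: each property has to be put in a form
    that survives averaging. The Hoelder bound does because its constants are the same for all
    sequences; the mean value inequality because it is a one-sided bound on a finite weighted sum;
    pluriharmonicity only after derivatives are eliminated, since differentiating under the integral
    would need the smoothness that is to be proved. No bound on the escape time that is uniform in
    the sequence is used. For each sequence a common escape time on a small disc comes from
    compactness, and the resulting estimates depend on the radius of the disc but not on that time:
    the number of roots grows at most like [d ^ n], which the normalization cancels. Roots of unity
    give only one half of Jensen's formula, which is the half required; roots on the circle of
    integration are avoided by changing the radius slightly. *)

Section ComplexModulus.
Context {R : realType}.
Local Notation C := R[i].
Implicit Types (x y t : C) (z w b : C * C).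

Lemma normc_ge0 x : 0 <= normc x.
Proof. by case: x => a b; rewrite /normc sqrtr_ge0. Qed.

Lemma normc_eq0 x : (normc x == 0) = (x == 0).
Proof.
by apply/eqP/eqP => [/Normc.eq0_normc //|->]; rewrite Normc.normc0.
Qed.

Lemma normc_gt0 x : (0 < normc x) = (x != 0).
Proof. by rewrite lt_def normc_eq0 normc_ge0 andbT. Qed.

Lemma normcX x n : normc (x ^+ n) = normc x ^+ n.
Proof.
elim: n => [|n IH]; first by rewrite !expr0 Normc.normc1.
by rewrite !exprS Normc.normcM IH.
Qed.

Lemma ler_normcD x y : normc (x + y) <= normc x + normc y.
Proof. exact: le_normcD. Qed.

Lemma normc_opp x : normc (- x) = normc x.
Proof. exact: normcN. Qed.

Lemma ler_normcB x y : normc (x - y) <= normc x + normc y.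
Proof. by rewrite -(normc_opp y) ler_normcD. Qed.

Lemma ler_normcDr x y : normc x - normc y <= normc (x - y).
Proof. by rewrite lerBlDr -{1}(subrK y x) ler_normcD. Qed.

Lemma normc_distC x y : normc (x - y) = normc (y - x).
Proof. by rewrite -opprB normc_opp. Qed.

Lemma ler_dist_normc x y : `|normc x - normc y| <= normc (x - y).
Proof.
by rewrite ler_norml ler_normcDr andbT lerNl opprB normc_distC ler_normcDr.
Qed.

Lemma normc_real (r : R) : normc r%:C = `|r|.
Proof. by rewrite /normc /= expr0n/= addr0 sqrtr_sqr. Qed.

Lemma normc_Re x : `|Re x| <= normc x.
Proof.
case: x => a b /=; rewrite -sqrtr_sqr ler_sqrt ?lerDl ?sqr_ge0//.
by rewrite addr_ge0 ?sqr_ge0.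
Qed.

Lemma normc_Im x : `|Im x| <= normc x.
Proof.
case: x => a b /=; rewrite -sqrtr_sqr ler_sqrt ?lerDr ?sqr_ge0//.
by rewrite addr_ge0 ?sqr_ge0.
Qed.

Lemma sqr_normcE x : normc x ^+ 2 = Re x ^+ 2 + Im x ^+ 2.
Proof. by case: x => a b /=; rewrite sqr_sqrtr// addr_ge0 ?sqr_ge0. Qed.

Lemma normc_le_ReIm x : normc x <= `|Re x| + `|Im x|.
Proof.
rewrite -(@ler_pXn2r _ 2) ?nnegrE ?normc_ge0 ?addr_ge0//.
rewrite sqr_normcE sqrrD !real_normK ?num_real// lerD2r lerDl.
by rewrite mulrn_wge0 ?mulr_ge0.
Qed.

Lemma normc_sum (I : Type) (r : seq I) (F : I -> C) :
  normc (\sum_(i <- r) F i) <= \sum_(i <- r) normc (F i).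
Proof.
elim: r => [|i r IH]; first by rewrite !big_nil Normc.normc0.
by rewrite !big_cons (le_trans (ler_normcD _ _))// lerD2l.
Qed.

Lemma normc_prod (I : Type) (r : seq I) (F : I -> C) :
  normc (\prod_(i <- r) F i) = \prod_(i <- r) normc (F i).
Proof.
by apply: (big_morph _ (@Normc.normcM R)); rewrite Normc.normc1.
Qed.

(** Radii of balls in the normed module [C] are themselves complex numbers; positivity forces such a
    radius to be real, which allows real radii from here on. *)
Lemma nbhs_normcP x (A : set C) :
  nbhs x A <-> exists2 e : R, 0 < e & forall y, normc (y - x) < e -> A y.
Proof.
split=> [/nbhs_normP[e /= e0 eA]|[e e0 eA]].
  have eR : e = (Re e)%:C.
    move: e0; rewrite ltcE => /andP[/eqP /= Ie _].
    by case: e Ie {eA} => er ei /= ->.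
  exists (Re e); first by move: e0; rewrite ltcE => /andP[].
  move=> y yx; apply: eA; rewrite /ball_/= eR distrC.
  by rewrite -[`|_|]/((normc _)%:C) ltcR.
apply/nbhs_normP; exists e%:C => /=; first by rewrite ltcR.
move=> y; rewrite /ball_/= distrC.
by rewrite -[`|_|]/((normc _)%:C) ltcR => /eA.
Qed.

(** The maximum norm is preferred to [norm2] because on the escape region it is the modulus of a
    single coordinate, hence of a polynomial along complex lines. *)
Definition nrm z : R := Num.max (normc z.1) (normc z.2).

Lemma nrm_ge0 z : 0 <= nrm z.
Proof. by rewrite le_max normc_ge0. Qed.

Lemma nrm_le z (r : R) : (nrm z <= r) = (normc z.1 <= r) && (normc z.2 <= r).
Proof. exact: ge_max. Qed.

Lemma nrm_lt z (r : R) : (nrm z < r) = (normc z.1 < r) && (normc z.2 < r).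
Proof. exact: gt_max. Qed.

Lemma normc_fst z : normc z.1 <= nrm z. Proof. by rewrite le_max lexx. Qed.
Lemma normc_snd z : normc z.2 <= nrm z.
Proof. by rewrite le_max lexx orbT. Qed.

Lemma nrmD z w : nrm (z + w) <= nrm z + nrm w.
Proof.
rewrite nrm_le /=.
by rewrite !(le_trans (ler_normcD _ _)) ?lerD ?normc_fst ?normc_snd.
Qed.

Lemma nrmN z : nrm (- z) = nrm z.
Proof. by rewrite /nrm /= !normc_opp. Qed.

Lemma nrmB z w : nrm (z - w) <= nrm z + nrm w.
Proof. by rewrite -(nrmN w) nrmD. Qed.

Lemma nrm_distC z w : nrm (z - w) = nrm (w - z).
Proof. by rewrite -opprB nrmN. Qed.

Lemma ler_nrmDr z w : nrm z - nrm w <= nrm (z - w).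
Proof. by rewrite lerBlDr -{1}(subrK w z) nrmD. Qed.

Lemma nrmZ t z : nrm (t *: z) = normc t * nrm z.
Proof.
rewrite /nrm maxr_pMr ?normc_ge0//=.
by rewrite -!Normc.normcM.
Qed.

Lemma nrm0 : nrm 0 = 0.
Proof. by rewrite -(scale0r (0 : C * C)) nrmZ Normc.normc0 mul0r. Qed.

Lemma nrm_le_norm2 z : nrm z <= norm2 z.
Proof.
rewrite nrm_le; apply/andP; split.
  rewrite -(ger0_norm (normc_ge0 z.1)) -sqrtr_sqr ler_sqrt ?lerDl ?sqr_ge0//.
  by rewrite addr_ge0 ?sqr_ge0.
rewrite -(ger0_norm (normc_ge0 z.2)) -sqrtr_sqr ler_sqrt ?lerDr ?sqr_ge0//.
by rewrite addr_ge0 ?sqr_ge0.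
Qed.

Lemma norm2_le_nrm z : norm2 z <= 2 * nrm z.
Proof.
have n0 := nrm_ge0 z.
rewrite -(ger0_norm (mulr_ge0 (ler0n _ 2) n0)) -sqrtr_sqr ler_sqrt ?sqr_ge0//.
have h1 : normc z.1 ^+ 2 <= nrm z ^+ 2.
  by rewrite ler_pXn2r ?nnegrE ?normc_ge0 ?normc_fst.
have h2 : normc z.2 ^+ 2 <= nrm z ^+ 2.
  by rewrite ler_pXn2r ?nnegrE ?normc_ge0 ?normc_snd.
rewrite exprMn; nra.
Qed.

Lemma nbhs_nrmP z (A : set (C * C)) :
  nbhs z A <-> exists2 e : R, 0 < e & forall w, nrm (w - z) < e -> A w.
Proof.
split=> [[[P Q]/= [/nbhs_normcP[e e0 eP] /nbhs_normcP[f f0 fQ]] PQA]|[e e0 eA]].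
  exists (Num.min e f); first by rewrite lt_min e0 f0.
  move=> w; rewrite nrm_lt !lt_min => /andP[/andP[w1 _] /andP[_ w2]].
  by apply: PQA; split; [exact: eP|exact: fQ].
exists ([set x | normc (x - z.1) < e], [set x | normc (x - z.2) < e]) => /=.
  by split; apply/nbhs_normcP; exists e.
by move=> w /= [w1 w2]; apply: eA; rewrite nrm_lt w1 w2.
Qed.

End ComplexModulus.

(** * Escape region of generalized Henon maps *)

Section Escape.
Context {R : realType}.
Local Notation C := R[i].
Implicit Types (x y t : C) (z w : C * C) (m : R).

Section Orientation.
Variable fwd : bool.

(* The inverse of a Henon map is again a map of the form [henon_factor], with
   the roles of the coordinates exchanged. *)
Definition big z : C := if fwd then z.2 else z.1.
Definition small z : C := if fwd then z.1 else z.2.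

Definition henon_factor (q : {poly C}) (b : C) z : C * C :=
  if fwd then (z.2, q.[z.2] - b * z.1) else (q.[z.1] - b * z.2, z.1).

Lemma big_factor q b z : big (henon_factor q b z) = q.[big z] - b * small z.
Proof. by rewrite /big /small /henon_factor; case: fwd. Qed.

Lemma small_factor q b z : small (henon_factor q b z) = big z.
Proof. by rewrite /big /small /henon_factor; case: fwd. Qed.

Lemma bigB z w : big (z - w) = big z - big w.
Proof. by rewrite /big; case: fwd. Qed.

Lemma smallB z w : small (z - w) = small z - small w.
Proof. by rewrite /small; case: fwd. Qed.

Lemma nrm_bigE z : nrm z = Num.max (normc (big z)) (normc (small z)).
Proof. by rewrite /nrm /big /small; case: fwd; rewrite // maxC. Qed.

Lemma normc_big z : normc (big z) <= nrm z.
Proof. by rewrite nrm_bigE le_max lexx. Qed.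

Lemma normc_small z : normc (small z) <= nrm z.
Proof. by rewrite nrm_bigE le_max lexx orbT. Qed.

(** Both inequalities are strict so that the region is open. *)
Definition escaping (r : R) z : bool :=
  (normc (small z) < normc (big z)) && (r < normc (big z)).

Lemma nrm_escaping r z : escaping r z -> nrm z = normc (big z).
Proof. by move=> /andP[sb _]; rewrite nrm_bigE; apply/max_idPl/ltW. Qed.

Lemma escaping_gt r z : escaping r z -> r < nrm z.
Proof. by move=> ez; rewrite (nrm_escaping ez); case/andP: ez. Qed.

(** Cutting off at 1 makes the degree [d] upper bound valid near the origin too, and keeps
    logarithms nonnegative. *)
Definition max1 z : R := Num.max 1 (nrm z).

Lemma max1_ge1 z : 1 <= max1 z. Proof. by rewrite le_max lexx. Qed.
Lemma max1_gt0 z : 0 < max1 z. Proof. exact: lt_le_trans (max1_ge1 z). Qed.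
Lemma nrm_max1 z : nrm z <= max1 z. Proof. by rewrite le_max lexx orbT. Qed.

(** All that the dynamics needs from one map, chosen to be stable under composition with the same
    [r]: growth of degree [d] from above everywhere and from below on the escape region, trapping
    outside it, a Lipschitz bound of degree [d - 1], and the effect on degrees along polynomial
    curves. *)
Record henon_like (r c K : R) (d : nat) (F : C * C -> C * C) : Prop := HenonLike {
  henon_like_upper : forall z, max1 (F z) <= K * max1 z ^+ d;
  henon_like_escaping : forall z, escaping r z ->
    escaping r (F z) /\ c * nrm z ^+ d <= nrm (F z);
  henon_like_trapped : forall z, ~~ escaping r (F z) ->
    nrm (F z) <= Num.max (nrm z) r;
  henon_like_lipschitz : forall z w,
    nrm (F z - F w) <=
    K * Num.max (max1 z) (max1 w) ^+ d.-1 * nrm (z - w);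
  henon_like_poly : forall (X Y : {poly C}) (m : nat),
    (size X <= m.+1)%N -> (size Y <= m.+1)%N ->
    exists X' Y' : {poly C}, [/\ (size X' <= (d * m).+1)%N,
      (size Y' <= (d * m).+1)%N &
      forall t, F (X.[t], Y.[t]) = (X'.[t], Y'.[t])]
}.

Lemma henon_like_id r : henon_like r 1 1 1 id.
Proof.
split.
- by move=> z; rewrite mul1r expr1.
- by move=> z ->; rewrite mul1r expr1.
- by move=> z _; rewrite le_max lexx.
- by move=> z w; rewrite expr0 !mul1r.
- by move=> X Y m sX sY; exists X, Y; rewrite mul1n.
Qed.

Lemma henon_like_comp r c1 K1 d1 F c2 K2 d2 G :
  0 <= c1 -> 0 <= c2 -> 1 <= K1 -> 1 <= K2 -> 0 <= r ->
  (0 < d1)%N -> (0 < d2)%N ->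
  henon_like r c1 K1 d1 F -> henon_like r c2 K2 d2 G ->
  henon_like r (c2 * c1 ^+ d2) (K2 * K1 ^+ d2) (d1 * d2) (G \o F).
Proof.
move=> c10 c20 K11 K21 r0 d10 d20 [uF eF tF lF pF] [uG eG tG lG pG].
have K10 : 0 <= K1 by exact: le_trans K11.
have K20 : 0 <= K2 by exact: le_trans K21.
split => /=.
- move=> z; apply: (le_trans (uG _)); rewrite -mulrA ler_wpM2l// exprM -exprMn.
  rewrite lerXn2r// nnegrE ?(ltW (max1_gt0 _))//.
  by rewrite mulr_ge0// exprn_ge0// ltW// max1_gt0.
- move=> z ez; have [eFz cF] := eF _ ez; have [eGz cG] := eG _ eFz.
  split=> //; apply: le_trans cG; rewrite -mulrA ler_wpM2l// exprM -exprMn.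
  by rewrite lerXn2r// nnegrE ?nrm_ge0// mulr_ge0// exprn_ge0// nrm_ge0.
(* If [G (F z)] has not escaped then neither has [F z], since [G] preserves the escape region; so
   both trapping bounds apply. *)
- move=> z nG; have := tG _ nG.
  rewrite le_max => /orP[h|h]; last by rewrite le_max h orbT.
  case/boolP: (escaping r (F z)) => [/eG[eG' _]|/tF h'].
    by rewrite eG' in nG.
  exact: le_trans h'.
- move=> z w; set m := Num.max (max1 z) (max1 w).
  have m0 : 0 <= m by rewrite le_max ltW// max1_gt0.
  have mF : Num.max (max1 (F z)) (max1 (F w)) <= K1 * m ^+ d1.
    rewrite ge_max; apply/andP; split.
      apply: le_trans (uF _) _; rewrite ler_wpM2l// lerXn2r// ?nnegrE//.
        by rewrite ltW// max1_gt0.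
      by rewrite le_max lexx.
    apply: le_trans (uF _) _; rewrite ler_wpM2l// lerXn2r// ?nnegrE//.
      by rewrite ltW// max1_gt0.
    by rewrite le_max lexx orbT.
  apply: le_trans (lG _ _) _.
  apply: (@le_trans _ _ (K2 * (K1 * m ^+ d1) ^+ d2.-1 * (K1 * m ^+ d1.-1 * nrm (z - w)))).
    apply: ler_pM; rewrite ?nrm_ge0// ?lF//.
      by rewrite mulr_ge0// exprn_ge0// le_max ltW// max1_gt0.
    rewrite ler_wpM2l// lerXn2r// nnegrE ?mulr_ge0 ?exprn_ge0//.
    by rewrite le_max ltW// max1_gt0.
  rewrite le_eqVlt; apply/orP; left; apply/eqP.
  have -> : (d1 * d2).-1 = (d1 * d2.-1 + d1.-1)%N.
    by rewrite -[d2 in LHS]prednK// mulnS -subn1 addnC -addnBA// subn1.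
  rewrite -{2}(prednK d20) exprMn exprS exprD exprM.
  by ring.
- move=> X Y m sX sY; have [X1 [Y1 [sX1 sY1 FE]]] := pF X Y m sX sY.
  have [X2 [Y2 [sX2 sY2 GE]]] := pG X1 Y1 _ sX1 sY1.
  have dE : (d2 * (d1 * m) = d1 * d2 * m)%N by rewrite mulnCA mulnA.
  by exists X2, Y2; rewrite -dE; split=> // t; rewrite FE GE.
Qed.

Section FactorEstimates.
Variables (q : {poly C}) (b : C) (e : nat) (B c : R).
Hypotheses (B1 : 1 <= B) (c0 : 0 < c) (size_q : size q = e.+3)
  (qB : forall i, normc q`_i <= B) (cq : c <= normc q`_e.+2)
  (bB : normc b <= B).

Let B0 : 0 <= B. Proof. exact: le_trans B1. Qed.

Lemma horner_upper y m : 1 <= m -> normc y <= m ->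
  normc q.[y] <= e.+3%:R * B * m ^+ e.+2.
Proof.
move=> m1 ym; rewrite horner_coef size_q.
apply: (le_trans (normc_sum _ _)).
apply: (@le_trans _ _ (\sum_(i < e.+3) B * m ^+ e.+2)).
  apply: ler_sum => i _; rewrite Normc.normcM normcX.
  rewrite ler_pM ?normc_ge0 ?exprn_ge0 ?normc_ge0//.
  apply: (@le_trans _ _ (m ^+ i)).
    by rewrite lerXn2r ?nnegrE ?normc_ge0// (le_trans _ m1).
  by rewrite ler_weXn2l// -ltnS ltn_ord.
by rewrite sumr_const card_ord -[leLHS]mulr_natl !mulrA.
Qed.

Lemma normc_subX y x m (i : nat) : 0 <= m -> normc y <= m -> normc x <= m ->
  normc (y ^+ i.+1 - x ^+ i.+1) <= i.+1%:R * m ^+ i * normc (y - x).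
Proof.
move=> m0 ym vm; elim: i => [|i IH]; first by rewrite !expr1 expr0 mulr1 mul1r.
have -> : y ^+ i.+2 - x ^+ i.+2 =
    y * (y ^+ i.+1 - x ^+ i.+1) + x ^+ i.+1 * (y - x).
  by rewrite !(exprS _ i.+1); ring.
apply: (le_trans (ler_normcD _ _)); rewrite !Normc.normcM normcX.
rewrite -natr1 mulrDl mul1r mulrDl; apply: lerD.
  rewrite [leRHS](_ : _ = m * (i.+1%:R * m ^+ i * normc (y - x))).
    by rewrite ler_pM ?normc_ge0.
  by rewrite exprS; ring.
by rewrite ler_wpM2r ?normc_ge0// lerXn2r ?nnegrE ?normc_ge0.
Qed.

Lemma horner_lipschitz y x m : 1 <= m -> normc y <= m -> normc x <= m ->
  normc (q.[y] - q.[x]) <= e.+3%:R ^+ 2 * B * m ^+ e.+1 * normc (y - x).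
Proof.
move=> m1 ym vm; have m0 : 0 <= m by exact: le_trans m1.
rewrite !horner_coef size_q -sumrB.
apply: (le_trans (normc_sum _ _)).
apply: (@le_trans _ _ (\sum_(i < e.+3) e.+3%:R * B * m ^+ e.+1 * normc (y - x))).
  apply: ler_sum => -[[|i] /= ilt] _.
    rewrite !expr0 subrr Normc.normc0.
    by rewrite !mulr_ge0 ?exprn_ge0 ?normc_ge0.
  rewrite -mulrBr Normc.normcM (mulrC e.+3%:R) -!mulrA.
  apply: ler_pM; rewrite ?normc_ge0//.
  apply: (le_trans (normc_subX _ m0 ym vm)); rewrite -mulrA.
  rewrite ler_pM ?ler0n ?ler_nat//.
  - by rewrite mulr_ge0 ?exprn_ge0 ?normc_ge0.
  - exact: ltnW.
  - by rewrite ler_wpM2r ?normc_ge0// ler_weXn2l.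
rewrite sumr_const card_ord -[leLHS]mulr_natl expr2.
by rewrite !mulrA.
Qed.

(** The leading term against [e.+2] lower terms, each at most [B * m ^+ e.+1]. *)
Lemma horner_lower y m : 1 <= m -> normc y = m ->
  c * m ^+ e.+2 - e.+2%:R * B * m ^+ e.+1 <= normc q.[y].
Proof.
move=> m1 ym; have m0 : 0 <= m by exact: le_trans m1.
rewrite horner_coef size_q big_ord_recr /= addrC.
set s := \sum_(_ < _) _; rewrite -[s]opprK.
apply: le_trans (ler_normcDr _ _); rewrite normc_opp.
apply: lerB; first by rewrite Normc.normcM normcX ym ler_wpM2r ?exprn_ge0.
apply: (le_trans (normc_sum _ _)).
apply: (@le_trans _ _ (\sum_(i < e.+2) B * m ^+ e.+1)).
  apply: ler_sum => i _; rewrite Normc.normcM normcX ym.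
  rewrite ler_pM ?normc_ge0 ?exprn_ge0//.
  by rewrite ler_weXn2l// -ltnS ltn_ord.
by rewrite sumr_const card_ord -[leLHS]mulr_natl !mulrA.
Qed.

(** The degree is written [e.+2], which builds in that it is at least 2. The threshold on [r] is
    what lets the leading term dominate; the constant [c / 2] records that half of it is given
    away. *)
Lemma henon_like_factor r : 1 <= r -> 2 * e.+3%:R * B / c <= r ->
  henon_like r (c / 2) ((e.+3%:R ^+ 2 + 1) * B) e.+2 (henon_factor q b).
Proof.
(* [K] serves two estimates: the upper bound needs [e.+3%:R * B + B], and the Lipschitz bound needs
   [e.+3%:R ^+ 2 * B + B], which is [K] itself. *)
move=> r1 rB; set K := (_ + 1) * B.
have e3 : 1 <= e.+3%:R :> R by rewrite ler1n.
have KB : e.+3%:R * B + B <= K.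
  rewrite -subr_ge0 (_ : _ - _ = e.+3%:R * (e.+3%:R - 1) * B).
    by rewrite !mulr_ge0// subr_ge0.
  by rewrite /K; ring.
have K1 : 1 <= K by apply: le_trans KB; rewrite (le_trans B1)// lerDr mulr_ge0.
have K0 : 0 <= K by exact: le_trans K1.
have upper z : normc (q.[big z] - b * small z) <= K * max1 z ^+ e.+2.
  have m1 := max1_ge1 z.
  apply: (le_trans (ler_normcB _ _)).
  apply: (@le_trans _ _ ((e.+3%:R * B + B) * max1 z ^+ e.+2)); last first.
    by rewrite ler_wpM2r// exprn_ge0// ltW// max1_gt0.
  rewrite mulrDl lerD//.
    by rewrite horner_upper// (le_trans (normc_big _)) ?nrm_max1.
  rewrite Normc.normcM ler_pM ?normc_ge0//.
  apply: (@le_trans _ _ (max1 z)); last exact: ler_eXnr.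
  by rewrite (le_trans (normc_small _)) ?nrm_max1.
split.
- move=> z; have m1 := max1_ge1 z.
  rewrite {1}/max1 nrm_bigE big_factor small_factor !ge_max upper /=.
  have Km : max1 z <= K * max1 z ^+ e.+2.
    apply: (@le_trans _ _ (max1 z ^+ e.+2)); first exact: ler_eXnr.
    by rewrite ler_peMl// exprn_ge0// ltW// max1_gt0.
  rewrite (le_trans m1 Km) /= (le_trans _ Km)//.
  by rewrite (le_trans (normc_big _)) ?nrm_max1.
- move=> z ez; have nz := nrm_escaping ez; case/andP: (ez) => sb rb.
  set m := normc (big z) in nz sb rb.
  have m1 : 1 <= m by rewrite ltW// (le_lt_trans r1).
  have m0 : 0 <= m by exact: le_trans m1.
  (* Hence the lower terms and [b * small z], together at most [e.+3%:R * B * m ^+ e.+1], are at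
     most half of [c * m ^+ e.+2]. *)
  have mr : 2 * e.+3%:R * B <= c * m.
    by rewrite (mulrC c) -ler_pdivrMr// (le_trans rB)// ltW.
  have low : c * m ^+ e.+2 - e.+3%:R * B * m ^+ e.+1 <=
             normc (q.[big z] - b * small z).
    apply: le_trans (ler_normcDr _ _).
    have := @horner_lower (big z) m m1 erefl.
    have : normc (b * small z) <= B * m ^+ e.+1.
      rewrite Normc.normcM ler_pM ?normc_ge0//.
      by rewrite (le_trans (ltW sb))// ler_eXnr.
    by rewrite -[e.+3%:R]natr1; lra.
  have low2 : c / 2 * m ^+ e.+2 <= normc (q.[big z] - b * small z).
    apply: le_trans low.
    have me : 0 <= m ^+ e.+1 by rewrite exprn_ge0.
    rewrite exprS; nra.
  (* By [mr], [c / 2 * m] is at least [e.+3%:R * B], hence at least 2, so the big coordinate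
     strictly grows; the old one becomes the small coordinate. *)
  have nF : m < normc (q.[big z] - b * small z).
    apply: lt_le_trans low2.
    have me : m <= m ^+ e.+1 by rewrite ler_eXnr.
    rewrite exprS mulrA; apply: (@lt_le_trans _ _ (c / 2 * m * m)).
      rewrite -{1}(mul1r m) ltr_pM2r ?(lt_le_trans ltr01)//.
      have : 2 * 1 <= e.+3%:R * B by rewrite ler_pM// ler_nat.
      by move: mr; rewrite -mulrA; lra.
    by rewrite ler_wpM2l// mulr_ge0// divr_ge0// ltW.
  have eF : escaping r (henon_factor q b z).
    by rewrite /escaping big_factor small_factor nF (lt_trans rb).
  by split=> //; rewrite (nrm_escaping eF) big_factor nz.
- move=> z; rewrite /escaping big_factor small_factor nrm_bigE.
  rewrite big_factor small_factor negb_and -!leNgt => h.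
  have bz : normc (big z) <= Num.max (nrm z) r by rewrite le_max normc_big.
  rewrite ge_max bz andbT; case/orP: h => h; first exact: le_trans h bz.
  by rewrite le_max h orbT.
- move=> z w; rewrite [e.+2.-1]/=; set m := Num.max (max1 z) (max1 w).
  have m1 : 1 <= m by rewrite le_max max1_ge1.
  have m0 : 0 <= m by exact: le_trans m1.
  have zm : nrm z <= m by rewrite le_max nrm_max1.
  have wm : nrm w <= m by rewrite le_max orbC nrm_max1.
  have me1 : 1 <= m ^+ e.+1 by rewrite exprn_ege1.
  have D0 := nrm_ge0 (z - w).
  rewrite nrm_bigE bigB smallB !big_factor !small_factor ge_max; apply/andP; split.
    have -> : q.[big z] - b * small z - (q.[big w] - b * small w) =
              (q.[big z] - q.[big w]) - b * small (z - w) by rewrite smallB; ring.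
    apply: (le_trans (ler_normcB _ _)).
    rewrite /K [leRHS](_ : _ = e.+3%:R ^+ 2 * B * m ^+ e.+1 * nrm (z - w) +
       B * (m ^+ e.+1 * nrm (z - w))); last by ring.
    apply: lerD.
      apply: (le_trans (@horner_lipschitz _ _ m _ _ _)) => //.
      - by rewrite (le_trans (normc_big _)).
      - by rewrite (le_trans (normc_big _)).
      rewrite ler_wpM2l -?bigB ?normc_big//.
      by rewrite !mulr_ge0 ?sqr_ge0 ?exprn_ge0.
    rewrite Normc.normcM ler_pM ?normc_ge0//.
    by rewrite (le_trans (normc_small _))// ler_peMl.
  rewrite -bigB (le_trans (normc_big _))// ler_peMl//.
  by rewrite mulr_ege1.
- move=> X Y m sX sY.
  pose U := if fwd then Y else X; pose V := if fwd then X else Y.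
  have sU : (size U <= m.+1)%N by rewrite /U; case: fwd.
  have sV : (size V <= m.+1)%N by rewrite /V; case: fwd.
  pose W := (q \Po U) - b *: V.
  have sW : (size W <= (e.+2 * m).+1)%N.
    rewrite (leq_trans (size_polyD _ _))// geq_max size_polyN.
    apply/andP; split; last first.
      by rewrite (leq_trans (size_scale_leq _ _))// (leq_trans sV)// ltnS leq_pmull.
    rewrite (leq_trans (size_comp_poly_leq _ _))// size_q /=.
    rewrite ltnS leq_mul2l /=; move: sU; case: (size U) => //= u; rewrite ltnS => ->.
  have sU' : (size U <= (e.+2 * m).+1)%N.
    by rewrite (leq_trans sU)// ltnS leq_pmull.
  exists (if fwd then U else W), (if fwd then W else U).
  split=> [||t]; rewrite ?if_same; try by case: fwd.
  rewrite /henon_factor /W /U /V; case: fwd => /=;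
    by rewrite hornerD hornerN hornerZ horner_comp.
Qed.

End FactorEstimates.

(** Each factor has its own threshold but composition needs a common one; therefore the estimates
    are required for all larger [r], with [c] and [K] independent of [r]. *)
Lemma henon_like_foldl (T : Type) (I : eqType) (M : set T) (d : I -> nat)
    (f : I -> T -> C * C -> C * C) (r : seq I) :
  (forall j, (0 < d j)%N) ->
  (forall j, exists c K r0, [/\ 0 < c, c <= 1, 1 <= K, 1 <= r0 &
     forall r, r0 <= r -> forall l, M l -> henon_like r c K (d j) (f j l)]) ->
  exists c K r0, [/\ 0 < c, c <= 1, 1 <= K, 1 <= r0 &
     forall s, r0 <= s -> forall l, M l ->
       henon_like s c K (\prod_(j <- r) d j)
         (fun z => foldl (fun w j => f j l w) z r)].
Proof.
move=> d0 hf; elim: r => [|j r [c2 [K2 [r2 [c20 c21 K21 r21 h2]]]]].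
  by exists 1, 1, 1; split=> // s _ l _; rewrite big_nil; exact: henon_like_id.
have [c1 [K1 [r1 [c10 c11 K11 r11 h1]]]] := hf j.
pose D := (\prod_(j <- r) d j)%N.
exists (c2 * c1 ^+ D), (K2 * K1 ^+ D), (Num.max r1 r2); split.
- by rewrite mulr_gt0// exprn_gt0.
- by rewrite mulr_ile1 ?exprn_ge0 ?exprn_ile1// ltW.
- by rewrite mulr_ege1// exprn_ege1.
- by rewrite le_max r11.
move=> s; rewrite ge_max => /andP[s1 s2] l Ml; rewrite big_cons.
have D0 : (0 < D)%N by rewrite prodn_gt0.
apply: henon_like_comp (h1 s s1 l Ml) (h2 s s2 l Ml) => //; try exact: ltW.
by rewrite (le_trans ler01)// (le_trans r11).
Qed.

End Orientation.
End Escape.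

(** * Green functions *)

Section Green.
Context {R : realType} {T : Type}.
Local Notation C := R[i].
Implicit Types (z w : C * C) (L : nat -> T).

Definition log_max1 z : R := ln (max1 z).

Lemma log_max1_ge0 z : 0 <= log_max1 z.
Proof. by rewrite ln_ge0// max1_ge1. Qed.

Lemma log_max1_le z (rho : R) : 1 <= rho -> nrm z <= rho -> log_max1 z <= ln rho.
Proof.
move=> rho1 zr; rewrite ler_ln ?posrE ?max1_gt0 ?(lt_le_trans ltr01)//.
by rewrite ge_max rho1.
Qed.

(** At [t = 0] the default value of [ln] is 0, so both sides still agree. *)
Lemma log_plusE (t : R) : 0 <= t -> log_plus t = ln (Num.max 1 t).
Proof.
rewrite /log_plus => t0; have [t1|t1] := leP t 1.
  rewrite ln1; apply/max_idPr; exact: ln_le0.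
by apply/max_idPl/ln_ge0/ltW.
Qed.

(** The error [ln 2] disappears after division by [d%:R ^+ n], so the Green function may be computed
    with the maximum norm. *)
Lemma log_plus_norm2 z : log_max1 z <= log_plus (norm2 z) <= log_max1 z + ln 2.
Proof.
have n0 : 0 <= norm2 z by rewrite sqrtr_ge0.
have m0 : 0 < Num.max 1 (norm2 z) by rewrite lt_max ltr01.
rewrite log_plusE// -lnM ?posrE ?max1_gt0// !ler_ln ?posrE ?max1_gt0//; last first.
  by rewrite mulr_gt0// max1_gt0.
apply/andP; split; rewrite ge_max; apply/andP; split.
- by rewrite le_max lexx.
- by rewrite le_max nrm_le_norm2 orbT.
- by have := max1_ge1 z; lra.
- by rewrite (le_trans (norm2_le_nrm z))// mulrC ler_pM2r// nrm_max1.
Qed.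

Record henon_system (fwd : bool) (r c K : R) (d : nat)
    (F : T -> C * C -> C * C) (M : set T) : Prop := HenonSystem {
  henon_system_degree : (2 <= d)%N;
  henon_system_c0 : 0 < c;
  henon_system_c1 : c <= 1;
  henon_system_K1 : 1 <= K;
  henon_system_r1 : 1 <= r;
  henon_system_rc : 1 < r * c;
  henon_system_like : forall l, M l -> henon_like fwd r c K d (F l)
}.

Variables (F : T -> C * C -> C * C) (M : set T).

Definition shift_seq (n : nat) L : nat -> T := fun i => L (i + n)%N.

Lemma orbit_seq_shift L m n z :
  orbit_seq F L (m + n) z = orbit_seq F (shift_seq n L) m (orbit_seq F L n z).
Proof. by elim: m => //= m ->. Qed.

Lemma param_seqs_shift L n : param_seqs M L -> param_seqs M (shift_seq n L).
Proof. by move=> ML i; exact: ML. Qed.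

Variables (fwd : bool) (r c K : R) (d : nat).
Hypothesis sys : henon_system fwd r c K d F M.

Let d2 : (2 <= d)%N. Proof. by case: sys. Qed.
Let c0 : 0 < c. Proof. by case: sys. Qed.
Let c1 : c <= 1. Proof. by case: sys. Qed.
Let K1 : 1 <= K. Proof. by case: sys. Qed.
Let r1 : 1 <= r. Proof. by case: sys. Qed.
Let rc : 1 < r * c. Proof. by case: sys. Qed.
Let HF l : M l -> henon_like fwd r c K d (F l).
Proof. by case: sys => _ _ _ _ _ _; apply. Qed.

Let d0 : 0 < d%:R :> R. Proof. by rewrite ltr0n; case: d d2. Qed.
Let d2R : 2 <= d%:R :> R. Proof. by rewrite ler_nat. Qed.
Let dn0 n : 0 < d%:R ^+ n :> R. Proof. by rewrite exprn_gt0. Qed.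
Let K0 : 0 < K. Proof. exact: lt_le_trans K1. Qed.
Let r0 : 0 < r. Proof. exact: lt_le_trans r1. Qed.

(** The sum of the one-step errors of [log_max1] from above, [ln K], and from below, [- ln c], both
    nonnegative. *)
Definition green_const : R := ln K - ln c.
Local Notation kappa := green_const.

Lemma ln_c_le0 : ln c <= 0. Proof. exact: ln_le0. Qed.
Lemma ln_K_ge0 : 0 <= ln K. Proof. exact: ln_ge0. Qed.

Lemma green_const_ge0 : 0 <= kappa.
Proof. by rewrite subr_ge0 (le_trans ln_c_le0)// ln_K_ge0. Qed.

Lemma log_max1_upper l z : M l -> log_max1 (F l z) <= d%:R * log_max1 z + ln K.
Proof.
move=> Ml; rewrite mulr_natl /log_max1 -lnXn ?max1_gt0//.
rewrite addrC -lnM ?posrE ?exprn_gt0 ?max1_gt0//.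
rewrite ler_ln ?posrE ?mulr_gt0 ?exprn_gt0 ?max1_gt0//.
exact: henon_like_upper (HF Ml) z.
Qed.

Lemma max1_escaping z : escaping fwd r z -> max1 z = nrm z.
Proof. by move=> /escaping_gt rz; apply/max_idPr/ltW/(le_lt_trans r1). Qed.

Lemma log_max1_lower l z : M l -> escaping fwd r z ->
  d%:R * log_max1 z + ln c <= log_max1 (F l z).
Proof.
move=> Ml ez; have [eF cF] := henon_like_escaping (HF Ml) ez.
rewrite mulr_natl /log_max1 -lnXn ?max1_gt0// addrC -lnM ?posrE ?exprn_gt0 ?max1_gt0//.
rewrite ler_ln ?posrE ?mulr_gt0 ?exprn_gt0 ?max1_gt0//.
by rewrite (max1_escaping eF) (max1_escaping ez).
Qed.

Lemma orbit_escaping L n m z : param_seqs M L -> (n <= m)%N ->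
  escaping fwd r (orbit_seq F L n z) -> escaping fwd r (orbit_seq F L m z).
Proof.
move=> ML; elim: m => [|m IH]; first by rewrite leqn0 => /eqP ->.
rewrite leq_eqVlt => /orP[/eqP -> //|nm] en /=.
by have [] := henon_like_escaping (HF (ML m)) (IH nm en).
Qed.

(** An orbit outside the escape region at time [n] was outside it at all earlier times, so the
    trapping bound can be iterated without accumulating. *)
Lemma orbit_not_escaping L n z : param_seqs M L ->
  ~~ escaping fwd r (orbit_seq F L n z) ->
  nrm (orbit_seq F L n z) <= Num.max (nrm z) r.
Proof.
move=> ML; elim: n => [|n IH] ne; first by rewrite /= le_max lexx.
have := henon_like_trapped (HF (ML n)) ne; rewrite le_max => /orP[h|h] /=.
  apply: (le_trans h); apply: IH; apply: contra ne => en.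
  exact: (@orbit_escaping L n n.+1).
by rewrite le_max h orbT.
Qed.

(** Since [d >= 2], [d * kappa] is at least [kappa + ln K]: adding [kappa] absorbs the one-step
    error and makes the normalized sequence nonincreasing. *)
Lemma orbit_upper L n z : param_seqs M L ->
  log_max1 (orbit_seq F L n.+1 z) + kappa <=
  d%:R * (log_max1 (orbit_seq F L n z) + kappa).
Proof.
move=> ML; have := log_max1_upper (orbit_seq F L n z) (ML n).
move=> h; have k0 := green_const_ge0.
have : ln K <= kappa by rewrite lerDl oppr_ge0 ln_c_le0.
by have := ler_wpM2r k0 d2R; rewrite [orbit_seq F L n.+1 z]/=; lra.
Qed.

Lemma orbit_upper0 L n z : param_seqs M L ->
  log_max1 (orbit_seq F L n z) / d%:R ^+ n <= log_max1 z + kappa.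
Proof.
move=> ML; rewrite ler_pdivrMr//.
suff : log_max1 (orbit_seq F L n z) + kappa <= (log_max1 z + kappa) * d%:R ^+ n.
  by have := green_const_ge0; lra.
elim: n => [|n IH]; first by rewrite expr0 mulr1.
apply: (le_trans (orbit_upper n z ML)).
by rewrite exprS mulrCA ler_pM2l.
Qed.

(** Adding the nonpositive [ln c] absorbs the one-step loss, because [d * ln c <= 2 * ln c]. *)
Lemma orbit_lower0 L n z : param_seqs M L -> escaping fwd r z ->
  log_max1 z + ln c <= log_max1 (orbit_seq F L n z) / d%:R ^+ n.
Proof.
move=> ML ez; rewrite ler_pdivlMr//.
suff : (log_max1 z + ln c) * d%:R ^+ n <= log_max1 (orbit_seq F L n z) + ln c.
  by have := ln_c_le0; lra.
elim: n => [|n IH]; first by rewrite expr0 mulr1.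
have en := orbit_escaping ML (leq0n n) ez.
have h := log_max1_lower (ML n) en.
rewrite exprS mulrCA; apply: (@le_trans _ _ (d%:R * (log_max1 (orbit_seq F L n z) + ln c))).
  by rewrite ler_pM2l.
have := ler_wnM2r ln_c_le0 d2R; rewrite [orbit_seq F L n.+1 z]/=; lra.
Qed.

Lemma log_max1_cvg L z : param_seqs M L ->
  (fun n => log_max1 (orbit_seq F L n z) / d%:R ^+ n) @ \oo --> green F d L z.
Proof.
move=> ML; pose a n := log_max1 (orbit_seq F L n z) / d%:R ^+ n.
(* This sequence is nonincreasing and nonnegative, hence convergent, and differs from [a] by
   [kappa / d%:R ^+ n]. *)
pose b n := (log_max1 (orbit_seq F L n z) + kappa) / d%:R ^+ n.
have inv0 : (fun n => (d%:R^-1 : R) ^+ n) @ \oo --> (0 : R).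
  apply: cvg_expr; rewrite ger0_norm ?invr_ge0 ?ltW// invf_lt1//.
  by apply: lt_le_trans d2R; rewrite ltr1n.
have binc : {homo b : n m / (n <= m)%N >-> m <= n}.
  apply/nonincreasing_seqP => n; rewrite /b ler_pdivrMr//.
  rewrite exprS mulrA (mulrAC _ _ d%:R) mulfVK ?gt_eqF// mulrC.
  exact: orbit_upper.
have bcv : cvgn b.
  apply: nonincreasing_is_cvgn => //; exists 0 => _ [n _ <-].
  rewrite /b divr_ge0// ?(ltW (dn0 n))//.
  by rewrite addr_ge0 ?log_max1_ge0 ?green_const_ge0.
have acv : a @ \oo --> limn b.
  rewrite -[limn b]subr0 -(mulr0 kappa).
  have -> : a = (fun n => b n - kappa * (d%:R^-1) ^+ n).
    by apply/funext => n; rewrite /a /b mulrDl exprVn addrK.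
  by apply: cvgB => //; apply: cvgM => //; exact: cvg_cst.
have gcv : (fun n => log_plus (norm2 (orbit_seq F L n z)) / d%:R ^+ n) @ \oo --> limn b.
  apply: (@squeeze_cvgr _ _ _ _ a (fun n => a n + ln 2 * (d%:R^-1) ^+ n)).
  - apply: nearW => n; have /andP[h1 h2] := log_plus_norm2 (orbit_seq F L n z).
    rewrite /a exprVn -mulrDl !ler_pM2r ?invr_gt0//.
    by rewrite h1.
  - exact: acv.
  - rewrite -[limn b]addr0 -(mulr0 (ln 2)).
    by apply: cvgD => //; apply: cvgM => //; exact: cvg_cst.
by rewrite /green (cvg_lim _ gcv).
Qed.

(** The functional equation of the Green functions. It converts an estimate at time 0, uniform in
    the sequence, into one at time [n] that is better by the factor [d%:R ^+ n]. *)
Lemma green_shift L n z : param_seqs M L ->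
  green F d L z = green F d (shift_seq n L) (orbit_seq F L n z) / d%:R ^+ n.
Proof.
move=> ML.
have h1 := @log_max1_cvg _ (orbit_seq F L n z) (param_seqs_shift n ML).
have h2 : (fun m => log_max1 (orbit_seq F L (m + n) z) / d%:R ^+ (m + n)) @ \oo
  --> green F d L z.
  by rewrite (cvg_shiftn n (fun m => log_max1 (orbit_seq F L m z) / d%:R ^+ m));
    exact: log_max1_cvg.
apply: (cvg_unique _ h2) => //.
have -> : (fun m => log_max1 (orbit_seq F L (m + n) z) / d%:R ^+ (m + n)) =
  (fun m => log_max1 (orbit_seq F (shift_seq n L) m (orbit_seq F L n z)) / d%:R ^+ m
    * (d%:R ^+ n)^-1).
  by apply/funext => m; rewrite orbit_seq_shift exprD invfM mulrA.
by apply: cvgM; [exact: h1|exact: cvg_cst].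
Qed.

Lemma green_ge0 L z : param_seqs M L -> 0 <= green F d L z.
Proof.
move=> ML; apply: (cvgr_to_ge (@log_max1_cvg L z ML)).
by apply: nearW => n; rewrite divr_ge0 ?log_max1_ge0// ltW.
Qed.

Lemma green_upper L z : param_seqs M L -> green F d L z <= log_max1 z + kappa.
Proof.
move=> ML; apply: (cvgr_to_le (@log_max1_cvg L z ML)).
by apply: nearW => n; exact: orbit_upper0.
Qed.

Lemma green_lower L z : param_seqs M L -> escaping fwd r z ->
  log_max1 z + ln c <= green F d L z.
Proof.
move=> ML ez; apply: (cvgr_to_ge (@log_max1_cvg L z ML)).
by apply: nearW => n; exact: orbit_lower0.
Qed.

(** A ball need not be invariant, but its union with the escape region is as soon as [rho >= r], and
    on this union [green] and [log_max1] stay at bounded distance. *)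
Definition near_or_escaping (rho : R) z := escaping fwd r z || (nrm z <= rho).

Lemma orbit_near_or_escaping L n z rho : param_seqs M L -> r <= rho ->
  near_or_escaping rho z -> near_or_escaping rho (orbit_seq F L n z).
Proof.
move=> ML rr zr; elim: n => // n IH /=; rewrite /near_or_escaping.
case/boolP: (escaping fwd r (F _ _)) => //= ne.
apply: (le_trans (henon_like_trapped (HF (ML n)) ne)).
rewrite ge_max rr andbT; case/orP: IH => // en.
by have [eF _] := henon_like_escaping (HF (ML n)) en; rewrite eF in ne.
Qed.

Lemma green_dist0 L z rho : param_seqs M L -> r <= rho ->
  near_or_escaping rho z -> `|green F d L z - log_max1 z| <= kappa + ln rho.
Proof.
move=> ML rr zr; have r1' := le_trans r1 rr.
have lr : 0 <= ln rho by exact: ln_ge0.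
have lK := ln_K_ge0; have lc := ln_c_le0.
have u := green_upper z ML.
rewrite ler_norml; apply/andP; split; last by lra.
case/orP: zr => [ez|zr].
  by have := green_lower ML ez; rewrite /kappa; lra.
by have := log_max1_le r1' zr; have := green_ge0 z ML; rewrite /kappa; lra.
Qed.

Lemma green_dist L n z rho : param_seqs M L -> r <= rho ->
  near_or_escaping rho z ->
  `|green F d L z - log_max1 (orbit_seq F L n z) / d%:R ^+ n| <=
  (kappa + ln rho) / d%:R ^+ n.
Proof.
move=> ML rr zr; rewrite (green_shift n z ML) -mulrBl normrM.
rewrite (ger0_norm (_ : 0 <= (d%:R ^+ n)^-1)) ?invr_ge0 ?(ltW (dn0 n))//.
rewrite ler_pM2r ?invr_gt0//; apply: green_dist0 => //.
  exact: param_seqs_shift.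
exact: orbit_near_or_escaping.
Qed.

Lemma green_gt0 L n z : param_seqs M L ->
  escaping fwd r (orbit_seq F L n z) -> 0 < green F d L z.
Proof.
move=> ML en; rewrite (green_shift n z ML) divr_gt0//.
apply: lt_le_trans (green_lower (param_seqs_shift n ML) en).
(* Here [1 < r * c] makes the lower bound [log_max1 + ln c] strictly positive on the escape
   region. *)
rewrite /log_max1 -lnM ?posrE ?max1_gt0// ln_gt0// (max1_escaping en).
by rewrite (lt_trans rc)// ltr_pM2r// (escaping_gt en).
Qed.

Lemma filled_julia_not_escaping L z : param_seqs M L ->
  (forall n, ~~ escaping fwd r (orbit_seq F L n z)) -> filled_julia F L z.
Proof.
move=> ML ne; exists (2 * Num.max (nrm z) r) => n.
by rewrite (le_trans (norm2_le_nrm _))// ler_pM2l// orbit_not_escaping.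
Qed.

Lemma green_filled_julia L z : param_seqs M L -> filled_julia F L z ->
  green F d L z = 0.
Proof.
move=> ML [B Bz]; apply/eqP; rewrite eq_le green_ge0// andbT.
have inv0 : (fun n => (d%:R^-1 : R) ^+ n) @ \oo --> (0 : R).
  apply: cvg_expr; rewrite ger0_norm ?invr_ge0 ?ltW// invf_lt1//.
  by apply: lt_le_trans d2R; rewrite ltr1n.
have : (fun n => ln (Num.max 1 B) * (d%:R^-1 : R) ^+ n) @ \oo --> ln (Num.max 1 B) * 0.
  by apply: cvgM => //; exact: cvg_cst.
rewrite mulr0 => h; apply: (ler_cvg_to (@log_max1_cvg L z ML) h).
apply: nearW => n; rewrite exprVn ler_pM2r ?invr_gt0//.
apply: log_max1_le; first by rewrite le_max lexx.
by rewrite (le_trans (nrm_le_norm2 _))// (le_trans (Bz n))// le_max lexx orbT.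
Qed.

Lemma not_filled_julia_escaping L z : param_seqs M L -> ~ filled_julia F L z ->
  exists n, escaping fwd r (orbit_seq F L n z).
Proof.
move=> ML nf; apply: contrapT => /forallNP h; apply: nf.
by apply: filled_julia_not_escaping => // n; apply/negP/h.
Qed.

(** * Hoelder estimate uniform in the parameter sequence *)

Section Hoelder.
Variable rho : R.
Hypothesis rr : r <= rho.

Let rho1 : 1 <= rho. Proof. exact: le_trans rr. Qed.

(** The power of 2 pays for replacing [max1 w] by [2 * max1 z], and [rho ^+ d / c] for comparing
    [max1 z ^+ d] with [max1] of the image. *)
Definition expansion_const : R := K * 2 ^+ d.-1 * rho ^+ d / c.
Local Notation B := expansion_const.

(** This is what makes [ln B] positive and the Hoelder exponent at most 1. *)
Lemma expansion_const_ge : d%:R <= B.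
Proof.
have h2 : d%:R <= 2 ^+ d.-1 :> R.
  rewrite -natrX ler_nat; have := ltn_expl d.-1 (ltnSn 1).
  by rewrite prednK// (leq_trans _ d2).
apply: (le_trans h2).
rewrite [leRHS](_ : _ = 2 ^+ d.-1 * (K * rho ^+ d / c)); last by rewrite /B; ring.
by rewrite ler_peMr ?exprn_ge0// !mulr_ege1 ?exprn_ege1// invf_ge1.
Qed.

Let B1 : 1 <= B.
Proof.
by apply: le_trans expansion_const_ge; apply: le_trans d2R; rewrite ler1n.
Qed.
Let B0 : 0 < B. Proof. exact: lt_le_trans B1. Qed.

(** The Lipschitz constant is unbounded, of degree [d - 1] in the size of [z], but the image has
    size of degree [d]. Measured relative to the size of the point, distances therefore grow by a
    bounded factor. *)
Lemma relative_expansion l z w e : M l -> near_or_escaping rho z ->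
  0 <= e -> e <= 1 -> nrm (z - w) <= e * max1 z ->
  nrm (F l z - F l w) <= B * e * max1 (F l z).
Proof.
move=> Ml zr e0 e1 zw; have m0 := max1_gt0 z.
have wz : max1 w <= 2 * max1 z.
  rewrite ge_max; apply/andP; split; first by have := max1_ge1 z; lra.
  have : nrm w <= nrm z + nrm (z - w).
    by rewrite -[X in nrm X <= _](subKr z) nrmB.
  by have := nrm_max1 z; nra.
have mzw : Num.max (max1 z) (max1 w) <= 2 * max1 z by rewrite ge_max wz andbT; lra.
apply: (le_trans (henon_like_lipschitz (HF Ml) z w)).
apply: (@le_trans _ _ (K * (2 * max1 z) ^+ d.-1 * (e * max1 z))).
  apply: ler_pM; rewrite ?nrm_ge0//.
    by rewrite mulr_ge0 ?(ltW K0) ?exprn_ge0// le_max ltW.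
  rewrite ler_wpM2l ?(ltW K0)// lerXn2r// nnegrE; last by rewrite mulr_ge0// ltW.
  by rewrite le_max ltW.
have md : max1 z ^+ d <= rho ^+ d / c * max1 (F l z).
  case/orP: zr => [ez|zr].
    have [eF cF] := henon_like_escaping (HF Ml) ez.
    rewrite mulrAC ler_pdivlMr// mulrC (max1_escaping eF) (max1_escaping ez).
    by rewrite (le_trans cF)// ler_peMl ?nrm_ge0// exprn_ege1.
  apply: (@le_trans _ _ (rho ^+ d)).
    rewrite lerXn2r ?nnegrE ?(ltW m0) ?(le_trans ler01 rho1)//.
    by rewrite ge_max rho1.
  rewrite -mulrA ler_peMr ?exprn_ge0 ?(le_trans ler01 rho1)//.
  by rewrite mulr_ege1 ?max1_ge1// invf_ge1.
have -> : K * (2 * max1 z) ^+ d.-1 * (e * max1 z) =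
          K * 2 ^+ d.-1 * e * max1 z ^+ d.
  by rewrite -[in RHS](prednK (ltnW d2)) exprMn exprS; ring.
have -> : B * e * max1 (F l z) =
          K * 2 ^+ d.-1 * e * (rho ^+ d / c * max1 (F l z)) by rewrite /B; ring.
by rewrite ler_wpM2l// !mulr_ge0 ?exprn_ge0 ?(ltW K0).
Qed.

Lemma orbit_relative_expansion L n z w e : param_seqs M L ->
  near_or_escaping rho z -> 0 <= e -> B ^+ n * e <= 1 -> nrm (z - w) <= e ->
  nrm (orbit_seq F L n z - orbit_seq F L n w) <=
  B ^+ n * e * max1 (orbit_seq F L n z).
Proof.
move=> ML zr e0; elim: n => [_ zw|n IH Be zw].
  by rewrite expr0 mul1r (le_trans zw)// ler_peMr// max1_ge1.
have Bn0 : 0 <= B ^+ n * e by rewrite mulr_ge0// exprn_ge0// ltW.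
have Bn : B ^+ n * e <= 1.
  by rewrite (le_trans _ Be)// exprS -mulrA ler_peMl.
rewrite (_ : B ^+ n.+1 * e = B * (B ^+ n * e)); last by rewrite exprS mulrA.
apply: relative_expansion => //.
  exact: orbit_near_or_escaping.
exact: IH.
Qed.

(** The inequality [ln (1 + x) <= x] turns a relative distance into a difference of logarithms. *)
Lemma log_max1_orbit_expansion L n z w e : param_seqs M L ->
  near_or_escaping rho z -> near_or_escaping rho w -> 0 <= e ->
  B ^+ n * e <= 1 -> nrm (z - w) <= e ->
  `|log_max1 (orbit_seq F L n z) - log_max1 (orbit_seq F L n w)| <= B ^+ n * e.
Proof.
move=> ML; wlog suff H : z w / near_or_escaping rho z -> near_or_escaping rho w ->
    0 <= e -> B ^+ n * e <= 1 -> nrm (z - w) <= e ->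
    log_max1 (orbit_seq F L n w) - log_max1 (orbit_seq F L n z) <= B ^+ n * e.
  move=> zr wr e0 Be zw; rewrite ler_norml lerNl opprB H//=.
  by rewrite H// nrm_distC.
move=> zr wr e0 Be zw.
have h := orbit_relative_expansion ML zr e0 Be zw.
set z' := orbit_seq F L n z in h *; set w' := orbit_seq F L n w in h *.
have Bn0 : 0 <= B ^+ n * e by rewrite mulr_ge0// exprn_ge0// ltW.
have m1 := max1_ge1 z'.
have wz : max1 w' <= max1 z' * (1 + B ^+ n * e).
  rewrite ge_max; apply/andP; split; first by nra.
  have : nrm w' <= nrm z' + nrm (z' - w').
    by rewrite -[X in nrm X <= _](subKr z') nrmB.
  by have := nrm_max1 z'; lra.
have p1 : 0 < 1 + B ^+ n * e by rewrite ltr_wpDr.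
have : log_max1 w' <= log_max1 z' + ln (1 + B ^+ n * e).
  by rewrite /log_max1 -lnM ?posrE ?max1_gt0// ler_ln ?posrE ?mulr_gt0 ?max1_gt0.
have : ln (1 + B ^+ n * e) <= B ^+ n * e.
  by apply: le_ln1Dx; rewrite (lt_le_trans _ Bn0).
by lra.
Qed.

(** Two truncation errors and one expansion error, and a factor [d] because the stopping time in
    [green_hoelder] is an integer. *)
Definition hoelder_const : R := (2 * (kappa + ln rho) + 1) * d%:R.
(** The power that sends [B] to [d]. *)
Definition hoelder_exp : R := ln d%:R / ln B.

Lemma hoelder_exp_gt0 : 0 < hoelder_exp.
Proof.
have d1 : 1 < d%:R :> R by rewrite ltr1n.
by rewrite divr_gt0// ln_gt0// (lt_le_trans d1)// expansion_const_ge.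
Qed.

Lemma hoelder_exp_le1 : hoelder_exp <= 1.
Proof.
have d1 : 1 < d%:R :> R by rewrite ltr1n.
have lB : 0 < ln B by rewrite ln_gt0// (lt_le_trans d1)// expansion_const_ge.
by rewrite ler_pdivrMr// mul1r ler_ln ?posrE ?expansion_const_ge.
Qed.

Let one_powR : 1 `^ hoelder_exp = 1 :> R.
Proof. by rewrite powR1. Qed.

(** Replacing both values by their approximants at time [n] costs a multiple of [d^-n], and the
    approximants differ by at most [B^n e / d^n], where [e] is the distance. Stopping at the last
    [n] with [B^n e <= 1] makes every error a multiple of [d^-n], which is then at most [d] times
    [e] to the power [hoelder_exp]. *)
Lemma green_hoelder L z w : param_seqs M L -> nrm z <= rho -> nrm w <= rho ->
  `|green F d L z - green F d L w| <=
  hoelder_const * nrm (z - w) `^ hoelder_exp.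
Proof.
move=> ML zr wr; set e := nrm (z - w).
have d1 : 1 < d%:R :> R by rewrite ltr1n.
have k0 := green_const_ge0; have lr : 0 <= ln rho by exact: ln_ge0.
have C0 : 0 <= hoelder_const by rewrite mulr_ge0//; lra.
have zr' : near_or_escaping rho z by rewrite /near_or_escaping zr orbT.
have wr' : near_or_escaping rho w by rewrite /near_or_escaping wr orbT.
have [e0|e0] := eqVneq e 0.
  have -> : z = w.
    have := nrm_le (z - w) 0; rewrite -/e e0 lexx => /esym/andP[z1 z2].
    apply/eqP; rewrite -subr_eq0; apply/eqP/pair_equal_spec; split.
      by apply/eqP; rewrite -normc_eq0 eq_le z1 normc_ge0.
    by apply/eqP; rewrite -normc_eq0 eq_le z2 normc_ge0.
  by rewrite subrr normr0 mulr_ge0// powR_ge0.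
have {}e0 : 0 < e by rewrite lt_def e0 nrm_ge0.
(* At distance above 1 the boundedness of the Green function on the ball suffices. *)
have [e1|e1] := ltP 1 e.
  have ea : 1 <= e `^ hoelder_exp.
    rewrite -[leLHS]one_powR ge0_ler_powR ?nnegrE ?ler01 ?(ltW e0) ?(ltW e1)//.
    exact/ltW/hoelder_exp_gt0.
  apply: (@le_trans _ _ (kappa + ln rho)).
    have bound v : nrm v <= rho -> 0 <= green F d L v <= kappa + ln rho.
      move=> vr; rewrite green_ge0//= (le_trans (green_upper v ML))// addrC lerD2l.
      exact: log_max1_le.
    have /andP[gz0 gz] := bound z zr; have /andP[gw0 gw] := bound w wr.
    by rewrite ler_norml; apply/andP; split; lra.
  apply: (@le_trans _ _ hoelder_const); last by rewrite ler_peMr.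
  apply: (@le_trans _ _ (2 * (kappa + ln rho) + 1)); first by lra.
  by rewrite ler_peMr ?ltW//; lra.
(* The least such [n] is the stopping time; minimality gives [B ^+ n * e <= 1]. *)
have exP : exists n, 1 < B ^+ n.+1 * e.
  have iv0 : 0 <= e^-1 by rewrite invr_ge0 ltW.
  exists (Num.Def.archi_bound e^-1); rewrite -ltr_pdivrMr// mul1r.
  apply: (lt_le_trans (archi_boundP iv0)).
  apply: (@le_trans _ _ (2 ^+ (Num.Def.archi_bound e^-1).+1)).
    by rewrite -natrX ler_nat ltnW// (leq_trans (ltn_expl _ (ltnSn 1)))// leq_exp2l.
  by rewrite lerXn2r ?nnegrE ?(ltW B0)// (le_trans d2R)// expansion_const_ge.
case: (ex_minnP exP) => n Bn nmin.
have Be : B ^+ n * e <= 1.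
  case: n nmin {Bn} => [_|n nmin]; first by rewrite expr0 mul1r.
  by rewrite leNgt; apply/negP => /nmin; rewrite ltnn.
have Ba : (B ^+ n.+1 * e) `^ hoelder_exp = d%:R ^+ n.+1 * e `^ hoelder_exp.
  rewrite powRM ?exprn_ge0 ?(ltW B0) ?(ltW e0)//; congr (_ * _).
  rewrite -powR_mulrn ?(ltW B0)// -powRrM mulrC powRrM.
  suff -> : B `^ hoelder_exp = d%:R by rewrite powR_mulrn ?(ltW d0).
  rewrite /powR gt_eqF// /hoelder_exp divfK ?lnK ?posrE//.
  by rewrite gt_eqF// ln_gt0// (lt_le_trans d1)// expansion_const_ge.
have de : (d%:R ^+ n)^-1 <= d%:R * e `^ hoelder_exp.
  rewrite -div1r ler_pdivrMr// mulrAC -exprS -Ba -[leLHS]one_powR.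
  rewrite ge0_ler_powR ?nnegrE ?ler01 ?(ltW Bn)//.
    exact/ltW/hoelder_exp_gt0.
  by rewrite mulr_ge0 ?exprn_ge0 ?(ltW B0) ?(ltW e0).
have hz := green_dist n ML rr zr'; have hw := green_dist n ML rr wr'.
have hzw := log_max1_orbit_expansion ML zr' wr' (ltW e0) Be (lexx _).
set C := kappa + ln rho in k0 lr C0 hz hw *.
apply: (@le_trans _ _ ((2 * C + 1) * (d%:R ^+ n)^-1)); last first.
  rewrite /hoelder_const -[leRHS]mulrA ler_wpM2l//.
  by rewrite addr_ge0// mulr_ge0// /C addr_ge0.
have hzw' : `|log_max1 (orbit_seq F L n z) / d%:R ^+ n -
              log_max1 (orbit_seq F L n w) / d%:R ^+ n| <= (d%:R ^+ n)^-1.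
  rewrite -mulrBl normrM (ger0_norm (_ : 0 <= (d%:R ^+ n)^-1)) ?invr_ge0 ?(ltW (dn0 n))//.
  by rewrite ler_piMl ?invr_ge0 ?(ltW (dn0 n))// (le_trans hzw).
rewrite mulrDl mul1r.
move: hz hw hzw'; rewrite !ler_norml => /andP[? ?] /andP[? ?] /andP[? ?].
by apply/andP; split; lra.
Qed.
End Hoelder.
End Green.

(** * Discrete circle means *)

Section RootsOfUnity.
Context {R : realType}.
Local Notation C := R[i].

Definition cis (u : R) : C := cos u +i* sin u.

Lemma cis0 : cis 0 = 1.
Proof. by rewrite /cis cos0 sin0. Qed.

Lemma cisD u v : cis (u + v) = cis u * cis v.
Proof.
by apply/eqP; rewrite eq_complex /= cosD sinD addrC (addrC (cos u * sin v)) !eqxx.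
Qed.

Lemma cisX u n : cis (n%:R * u) = cis u ^+ n.
Proof.
elim: n => [|n IH]; first by rewrite mul0r cis0 expr0.
by rewrite -natr1 mulrDl mul1r cisD IH exprSr.
Qed.

Lemma normc_cis u : normc (cis u) = 1.
Proof. by rewrite /cis /= cos2Dsin2 sqrtr1. Qed.

Definition omega (N : nat) : C := cis (2 * pi / N%:R).

Lemma normc_omegaX N j : normc (omega N ^+ j) = 1.
Proof. by rewrite normcX normc_cis expr1n. Qed.

Lemma omega_prim N : (0 < N)%N -> N.-primitive_root (omega N).
Proof.
move=> N0; have NR : 0 < N%:R :> R by rewrite ltr0n.
apply/andP; split=> //; apply/forallP => i; apply/eqP.
rewrite unity_rootE -cisX.
have [->|iN] := eqVneq i.+1 N.
  rewrite mulrC divfK; last by rewrite gt_eqF.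
  apply/eqP.
  rewrite /cis mulr_natl mulr2n (cosD pi) (sinD pi) cospi sinpi.
  by rewrite !mulr0 subr0 mulrNN mulr1 mul0r !addr0.
apply/negbTE; rewrite eq_complex /= negb_and; apply/orP; left.
(* A root of unity equal to 1 would have [cos (2 x) = 1], hence [sin x = 0], which fails strictly
   between 0 and [pi]. *)
pose x : R := pi * (i.+1%:R / N%:R).
have -> : i.+1%:R * (2 * pi / N%:R) = x *+ 2 by rewrite /x -mulr_natl; ring.
have sx : 0 < sin x.
  apply: sin_gt0_pi; rewrite /x mulr_gt0 ?pi_gt0 ?divr_gt0 ?ltr0n//=.
  rewrite gtr_pMr ?pi_gt0// ltr_pdivrMr// mul1r ltr_nat.
  by rewrite ltn_neqAle iN ltn_ord.
have := cos2Dsin2 x; have s2 : 0 < sin x ^+ 2 by rewrite exprn_gt0.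
by rewrite mulr2n (cosD x) -!expr2 => c2; apply/eqP => h; lra.
Qed.

(** The factorization of [X^N - 1] evaluated at [al / r], then rescaled. *)
Lemma prod_normc_omega N (r : R) (al : C) : (0 < N)%N -> 0 < r ->
  \prod_(j < N) normc (r%:C * omega N ^+ j - al) =
  normc (r%:C ^+ N - al ^+ N).
Proof.
move=> N0 r0; have rC : r%:C != 0 :> C by rewrite -normc_gt0 normc_real normr_gt0 gt_eqF.
have h : \prod_(i < N) ('X - (omega N ^+ i)%:P).[al / r%:C] = (al / r%:C) ^+ N - 1.
  rewrite -horner_prod -(big_mkord xpredT (fun i => 'X - (omega N ^+ i)%:P)).
  by rewrite (factor_Xn_sub_1 (omega_prim N0)) hornerD hornerN hornerXn hornerC.
transitivity (\prod_(j < N) (r * normc (al / r%:C - omega N ^+ j))).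
  apply: eq_bigr => j _; rewrite -{2}(ger0_norm (ltW r0)) -normc_real -Normc.normcM.
  by rewrite normc_distC; congr (normc _); rewrite mulrBr mulrCA mulfV// mulr1.
rewrite big_split /= prodr_const card_ord -normc_prod.
have -> : \prod_(i < N) (al / r%:C - omega N ^+ i) = (al / r%:C) ^+ N - 1.
  by rewrite -h; apply: eq_bigr => j _; rewrite hornerXsubC.
rewrite -{1}(ger0_norm (ltW r0)) -normc_real -normcX -Normc.normcM mulrBr.
by rewrite -exprMn mulrCA mulfV// !mulr1 normc_distC.
Qed.

Lemma ln_prod (I : Type) (s : seq I) (f : I -> R) :
  (forall i, 0 < f i) -> ln (\prod_(i <- s) f i) = \sum_(i <- s) ln (f i).
Proof.
move=> f0; elim: s => [|i s IH]; first by rewrite !big_nil ln1.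
by rewrite !big_cons lnM ?IH ?posrE// prodr_gt0.
Qed.

(** The discrete Jensen inequality for one root. In the modulus of [r^N - al^N] the larger term
    loses at most the factor [1 - th], with [th < 1] the ratio of the smaller to the larger radius;
    so the total loss [- ln (1 - th)] is bounded in [N] and vanishes in the mean. *)
Lemma jensen_root (r : R) (al : C) : 0 < r -> al != 0 -> normc al != r ->
  exists2 B : R, 0 <= B & forall N, (0 < N)%N ->
    N%:R * ln (normc al) - B <= \sum_(j < N) ln (normc (r%:C * omega N ^+ j - al)).
Proof.
move=> r0 al0 alr; have a0 : 0 < normc al by rewrite normc_gt0.
pose th := Num.min r (normc al) / Num.max r (normc al).
have mx0 : 0 < Num.max r (normc al) by rewrite lt_max r0.
have th0 : 0 < th by rewrite divr_gt0// lt_min r0.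
have th1 : th < 1.
  rewrite ltr_pdivrMr// mul1r; case: (ltgtP r (normc al)) => // ral.
  by rewrite ral eqxx in alr.
exists (- ln (1 - th)).
  by rewrite oppr_ge0 ln_le0// gerBl ltW.
move=> N N0; rewrite -ln_prod; last first.
  move=> j; rewrite normc_gt0 subr_eq0; apply: contraNneq alr => <-.
  by rewrite Normc.normcM normc_real normc_omegaX mulr1 ger0_norm// ltW.
rewrite prod_normc_omega// opprK mulr_natl -lnXn//.
rewrite -lnM ?posrE ?exprn_gt0 ?subr_gt0//.
suff h : normc al ^+ N * (1 - th) <= normc (r%:C ^+ N - al ^+ N).
  have p : 0 < normc al ^+ N * (1 - th) by rewrite mulr_gt0 ?exprn_gt0 ?subr_gt0.
  by rewrite ler_ln ?posrE// (lt_le_trans p).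
have thN : th ^+ N <= th by rewrite ler_iXnr// ?(ltW th0) ?ltW.
case: (ltgtP r (normc al)) => ra; last by rewrite ra eqxx in alr.
- rewrite normc_distC; apply: le_trans (ler_normcDr _ _).
  rewrite !normcX normc_real ger0_norm ?(ltW r0)// mulrBr mulr1 lerB//.
  apply: (@le_trans _ _ (normc al ^+ N * th ^+ N)).
    by rewrite -exprMn /th min_l ?(ltW ra)// max_r ?(ltW ra)// mulrC divfK// gt_eqF.
  by rewrite ler_pM2l ?exprn_gt0.
- apply: le_trans (ler_normcDr _ _).
  rewrite !normcX normc_real ger0_norm ?(ltW r0)//.
  apply: (@le_trans _ _ (r ^+ N * (1 - th))).
    by rewrite ler_pM2r ?subr_gt0// lerXn2r ?nnegrE ?normc_ge0 ?ltW.
  rewrite mulrBr mulr1 lerB//.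
  apply: (@le_trans _ _ (r ^+ N * th ^+ N)).
    by rewrite -exprMn /th min_r ?(ltW ra)// max_l ?(ltW ra)// mulrC divfK// gt_eqF.
  by rewrite ler_pM2l ?exprn_gt0.
Qed.

(** The losses of the individual roots add up, and the leading coefficient contributes equally to
    both sides. Roots on the circle are excluded: a sample point could hit one, where [ln] takes its
    default value 0. *)
Lemma jensen_poly (r : R) (P : {poly C}) : 0 < r -> P.[0] != 0 ->
  (forall t, normc t = r -> P.[t] != 0) ->
  exists B : R, forall N, (0 < N)%N ->
    N%:R * ln (normc P.[0]) - B <= \sum_(j < N) ln (normc P.[r%:C * omega N ^+ j]).
Proof.
move=> r0; have [rs ->] := closed_field_poly_normal P.
set c := lead_coef P => P0 Pr.
have c0 : c != 0 by apply: contraNneq P0 => ->; rewrite scale0r horner0.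
have {}P0 : (\prod_(z <- rs) ('X - z%:P)).[0] != 0.
  by apply: contraNneq P0 => h; rewrite hornerZ h mulr0.
have {}Pr t : normc t = r -> (\prod_(z <- rs) ('X - z%:P)).[t] != 0.
  by move=> /Pr; apply: contraNneq => h; rewrite hornerZ h mulr0.
have : exists B : R, forall N, (0 < N)%N ->
    N%:R * ln (normc (\prod_(z <- rs) ('X - z%:P)).[0]) - B <=
    \sum_(j < N) ln (normc (\prod_(z <- rs) ('X - z%:P)).[r%:C * omega N ^+ j]).
  elim: rs P0 Pr => [_ _|al rs IH].
    exists 0 => N _; rewrite big_nil !hornerE Normc.normc1 ln1 mulr0 subr0.
    by rewrite big1// => j _; rewrite !hornerE Normc.normc1 ln1.
  rewrite big_cons hornerM mulf_eq0 negb_or => /andP[al0 P0] Pr.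
  have Pr' t : normc t = r -> (\prod_(z <- rs) ('X - z%:P)).[t] != 0.
    by move=> /Pr; rewrite hornerM mulf_eq0 negb_or => /andP[].
  have [B1 h1] := IH P0 Pr'.
  have al0' : al != 0 by move: al0; rewrite !hornerE oppr_eq0.
  have alr : normc al != r.
    by apply/eqP => /Pr; rewrite hornerM !hornerE subrr mul0r eqxx.
  have [B2 _ h2] := jensen_root r0 al0' alr.
  exists (B1 + B2) => N N0.
  rewrite Normc.normcM lnM ?posrE ?normc_gt0// !hornerE normc_opp.
  have -> : \sum_(j < N)
      ln (normc (('X - al%:P) * \prod_(z <- rs) ('X - z%:P)).[r%:C * omega N ^+ j]) =
      \sum_(j < N) ln (normc (r%:C * omega N ^+ j - al)) +
      \sum_(j < N) ln (normc (\prod_(z <- rs) ('X - z%:P)).[r%:C * omega N ^+ j]).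
    rewrite -big_split /=; apply: eq_bigr => j _.
    have nt : normc (r%:C * omega N ^+ j) = r.
      by rewrite Normc.normcM normc_real normc_omegaX mulr1 ger0_norm// ltW.
    rewrite hornerM Normc.normcM lnM ?posrE ?normc_gt0 ?Pr'//.
      by rewrite !hornerE.
    by have := Pr _ nt; rewrite hornerM mulf_eq0 negb_or => /andP[].
  by have := h1 N N0; have := h2 N N0; lra.
move=> [B hB]; exists B => N N0; have := hB N N0.
rewrite hornerZ Normc.normcM lnM ?posrE ?normc_gt0//.
have -> : \sum_(j < N) ln (normc (c *: \prod_(z <- rs) ('X - z%:P)).[r%:C * omega N ^+ j])
  = N%:R * ln (normc c) +
    \sum_(j < N) ln (normc (\prod_(z <- rs) ('X - z%:P)).[r%:C * omega N ^+ j]).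
  rewrite mulr_natl -[X in _ *+ X](card_ord N) -sumr_const -big_split /=.
  apply: eq_bigr => j _; rewrite hornerZ Normc.normcM lnM ?posrE ?normc_gt0// Pr//.
  by rewrite Normc.normcM normc_real normc_omegaX mulr1 ger0_norm// ltW.
by rewrite mulrDr; lra.
Qed.

Lemma radius_avoiding_roots (a b : R) (P : {poly C}) : 0 <= a -> a < b -> P != 0 ->
  exists2 r, a < r < b & forall t, normc t = r -> P.[t] != 0.
Proof.
move=> a0 ab P0; have [rs PE] := closed_field_poly_normal P.
have c0 : lead_coef P != 0 by rewrite lead_coef_eq0.
(* Each root whose modulus falls inside the current interval becomes its new right end; finitely
   many roots leave a nonempty interval. *)
have [a' [b' [aa' a'b' b'b h]]] : exists a' b', [/\ a <= a', a' < b', b' <= b &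
    forall al, al \in rs -> ~~ (a' < normc al < b')].
  elim: (rs) => [|al s [a' [b' [aa' a'b' b'b h]]]]; first by exists a, b.
  case/boolP: (a' < normc al < b') => [/andP[l1 l2]|n].
    exists a', (normc al); split=> //; first by rewrite (le_trans (ltW l2)).
    move=> x; rewrite inE => /orP[/eqP ->|/h]; first by rewrite ltxx andbF.
    by apply: contra => /andP[-> /lt_trans]; apply.
  by exists a', b'; split=> // x; rewrite inE => /orP[/eqP ->//|/h].
exists ((a' + b') / 2); first by apply/andP; split; lra.
move=> t tr; rewrite PE hornerZ mulf_neq0// horner_prod prodf_seq_neq0.
apply/allP => al /h; apply: contraR; rewrite negbK !hornerE subr_eq0 => /eqP <-.
by rewrite tr; apply/andP; split; lra.
Qed.

(** The bound from above is required only at the centre, so [P] may be adapted to the centre.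
    Uniform continuity of [g] permits passing to a slightly smaller circle that carries no root of
    [P]. *)
Lemma circle_mean_ge (g : C -> R) (r : R) : 0 < r ->
  (forall e, 0 < e -> exists (P : {poly C}) (D : R), [/\ 0 < D,
     g 0 <= ln (Num.max 1 (normc P.[0])) / D + e &
     forall t, normc t <= r -> ln (Num.max 1 (normc P.[t])) / D - e <= g t]) ->
  (forall e, 0 < e -> exists2 dl, 0 < dl & forall t u, normc t <= r ->
     normc u <= r -> normc (t - u) <= dl -> `|g t - g u| <= e) ->
  forall e, 0 < e -> \forall N \near \oo,
    g 0 - e <= N%:R^-1 * \sum_(j < N) g (r%:C * omega N ^+ j).
Proof.
move=> r0 gP gc e e0; pose e' := e / 4.
have e'0 : 0 < e' by rewrite divr_gt0.
have nrw N j : normc (r%:C * omega N ^+ j) = r.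
  by rewrite Normc.normcM normc_real normc_omegaX mulr1 ger0_norm// ltW.
have [P [D [D0 gP0 gPt]]] := gP _ e'0; have [dl dl0 gdl] := gc _ e'0.
have lp0 x : 0 <= ln (Num.max 1 x) :> R by rewrite ln_ge0// le_max lexx.
(* If [normc P.[0] <= 1], the value at the centre is at most [e'] while all sample values are at
   least [- e']. *)
have [P1|P1] := leP (normc P.[0]) 1.
  near=> N; have N0 : 0 < N%:R :> R by rewrite ltr0n; near: N; exact: nbhs_infty_gt.
  rewrite mulrC ler_pdivlMr//.
  have g0 : g 0 <= e' by move: gP0; rewrite max_l// ln1 mul0r add0r.
  apply: (@le_trans _ _ (\sum_(j < N) - e')).
    rewrite sumr_const card_ord -(mulr_natr (- e') N) ler_pM2r//.
    by move: g0 e0; rewrite /e'; lra.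
  apply: ler_sum => j _; apply: le_trans (gPt _ _); last by rewrite nrw.
  by rewrite lerDr divr_ge0// ltW.
have P0 : P.[0] != 0 by rewrite -normc_gt0 (lt_trans ltr01).
have Pn0 : P != 0 by apply: contraNneq P0 => ->; rewrite horner0.
have [||r' /andP[rr' r'r] Pr'] := @radius_avoiding_roots (Num.max 0 (r - dl)) r P _ _ Pn0.
- by rewrite le_max lexx.
- by rewrite gt_max r0 gtrBl.
move: rr'; rewrite gt_max => /andP[r'0 rdl].
have nrw' N j : normc (r'%:C * omega N ^+ j) = r'.
  by rewrite Normc.normcM normc_real normc_omegaX mulr1 ger0_norm// ltW.
have [B hB] := jensen_poly r'0 P0 Pr'.
near=> N; have N0 : (0 < N)%N by near: N; exact: nbhs_infty_gt.
have NR : 0 < N%:R :> R by rewrite ltr0n.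
(* The bounded loss in Jensen's inequality is negligible against [N]. *)
have BN : B <= e' * D * N%:R.
  rewrite mulrC -ler_pdivrMr ?mulr_gt0//.
  near: N; exact: nbhs_infty_ger.
rewrite mulrC ler_pdivlMr//.
have gg : \sum_(j < N) (ln (normc P.[r'%:C * omega N ^+ j]) / D - 2 * e') <=
          \sum_(j < N) g (r%:C * omega N ^+ j).
  apply: ler_sum => j _.
  have h1 : ln (normc P.[r'%:C * omega N ^+ j]) / D - e' <= g (r'%:C * omega N ^+ j).
    apply: le_trans (gPt _ _); last by rewrite nrw' ltW.
    rewrite lerD2r ler_pM2r ?invr_gt0// ler_ln ?posrE ?lt_max ?ltr01//.
      by rewrite le_max lexx orbT.
    by rewrite normc_gt0 Pr'.
  have : `|g (r%:C * omega N ^+ j) - g (r'%:C * omega N ^+ j)| <= e'.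
    apply: gdl; rewrite ?nrw ?nrw' ?(ltW r'r)//.
    rewrite -mulrBl -rmorphB Normc.normcM normc_omegaX mulr1 normc_real.
    by rewrite ger0_norm ?subr_ge0 ?(ltW r'r)//; lra.
  by rewrite ler_norml => /andP[? ?]; lra.
apply: le_trans gg; rewrite sumrB sumr_const card_ord -mulr_suml -(mulr_natr (2 * e') N).
have h := hB N N0.
move: gP0; rewrite max_r ?(ltW P1)// => gP0.
apply: (@le_trans _ _ ((N%:R * ln (normc P.[0]) - B) / D - 2 * e' * N%:R)); last first.
  by rewrite lerD2r ler_pM2r ?invr_gt0.
have BD : B / D <= e' * N%:R by rewrite ler_pdivrMr// mulrAC.
have : g 0 * N%:R <= (ln (normc P.[0]) / D + e') * N%:R by rewrite ler_pM2r.
have -> : (N%:R * ln (normc P.[0]) - B) / D = N%:R * (ln (normc P.[0]) / D) - B / D.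
  by rewrite mulrBl mulrA.
have -> : e = 4 * e' by rewrite /e'; field.
lra.
Unshelve. all: by end_near.
Qed.

End RootsOfUnity.

(** * Discrete mean value inequality for each Green function on complex lines *)

Section GreenSubmean.
Context {R : realType} {T : Type}.
Local Notation C := R[i].
Implicit Types (z w : C * C) (L : nat -> T).
Variables (F : T -> C * C -> C * C) (M : set T) (fwd : bool) (r c K : R) (d : nat).
Hypothesis sys : henon_system fwd r c K d F M.

Let dn0 n : 0 < d%:R ^+ n :> R.
Proof. by rewrite exprn_gt0// ltr0n (leq_trans _ (henon_system_degree sys)). Qed.

Lemma orbit_poly L n z b : param_seqs M L ->
  exists X Y : {poly C}, [/\ (size X <= (d ^ n).+1)%N, (size Y <= (d ^ n).+1)%N &
    forall t, orbit_seq F L n (z + t *: b) = (X.[t], Y.[t])].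
Proof.
move=> ML; elim: n => [|n [X [Y [sX sY XY]]]].
  have sP (u v : C) : (size (u%:P + v *: 'X)%R <= 2)%N.
    rewrite (leq_trans (size_polyD _ _))// geq_max.
    rewrite size_polyC (leq_trans (leq_b1 _))//=.
    by rewrite (leq_trans (size_scale_leq _ _))// size_polyX.
  exists (z.1%:P + b.1 *: 'X), (z.2%:P + b.2 *: 'X); split; rewrite ?expn0 ?sP// => t.
  rewrite !hornerD !hornerC !hornerZ !hornerX.
  by rewrite ![_ * t]mulrC; case: z b => [z1 z2] [b1 b2].
have [X' [Y' [sX' sY' XY']]] :=
  henon_like_poly (henon_system_like sys (ML n)) sX sY.
by exists X', Y'; rewrite expnS; split=> // t; rewrite /= XY XY'.
Qed.

Lemma green_uniform_continuous (rho e : R) : 0 < e ->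
  exists2 dl : R, 0 < dl & forall L z w, param_seqs M L ->
    nrm z <= rho -> nrm w <= rho -> nrm (z - w) <= dl ->
    `|green F d L z - green F d L w| <= e.
Proof.
move=> e0; pose rho' := Num.max rho r.
have rr : r <= rho' by rewrite le_max lexx orbT.
have h L z w := @green_hoelder _ _ _ _ _ _ _ _ _ sys rho' rr L z w.
set A := hoelder_const c K d rho' in h; set al := hoelder_exp c K d rho' in h.
have al0 : 0 < al by exact: hoelder_exp_gt0 sys _ rr.
pose A' := Num.max 1 A.
have A0 : 0 < A' by rewrite lt_max ltr01.
exists ((e / A') `^ al^-1).
  by rewrite powR_gt0// divr_gt0.
move=> L z w ML zr wr zw.
apply: (le_trans (h L z w ML _ _)); rewrite ?le_max ?zr ?wr//.
apply: (@le_trans _ _ (A' * (e / A'))); last by rewrite mulrC divfK// gt_eqF.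
apply: (@le_trans _ _ (A' * nrm (z - w) `^ al)).
  by rewrite ler_wpM2r ?powR_ge0// le_max lexx orbT.
rewrite ler_pM2l//.
have -> : e / A' = ((e / A') `^ al^-1) `^ al.
  by rewrite -powRrM mulVf ?gt_eqF// powRr1// divr_ge0// ltW.
by rewrite ge0_ler_powR ?nnegrE ?nrm_ge0 ?powR_ge0// ltW.
Qed.

(** Up to a small error the Green function is the larger of two normalized logarithms of
    polynomials. The coordinate that realizes the maximum at the centre is a lower bound at all
    other points. *)
Lemma green_submean L z b (s e : R) : param_seqs M L -> 0 < s -> 0 < e ->
  \forall N \near \oo, green F d L z - e <=
    N%:R^-1 * \sum_(j < N) green F d L (z + (s%:C * omega N ^+ j) *: b).
Proof.
move=> ML s0 e0; pose g t := green F d L (z + t *: b).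
have gz : g 0 = green F d L z by rewrite /g scale0r addr0.
pose rho := nrm z + s * nrm b.
have zt t : normc t <= s -> nrm (z + t *: b) <= rho.
  by move=> ts; rewrite (le_trans (nrmD _ _))// lerD2l nrmZ ler_wpM2r ?nrm_ge0.
rewrite -gz; apply: (@circle_mean_ge R g s s0) => // {}e {}e0.
  pose rho' := Num.max rho r.
  have rr : r <= rho' by rewrite le_max lexx orbT.
  pose k := green_const c K + ln rho'.
  have k0 : 0 <= k.
    rewrite addr_ge0 ?(green_const_ge0 sys)// ln_ge0//.
    exact: le_trans (henon_system_r1 sys) rr.
  have [n kn] : exists n, k / d%:R ^+ n <= e.
    exists (Num.Def.archi_bound (k / e)); rewrite ler_pdivrMr// mulrC -ler_pdivrMr//.
    apply: (le_trans (ltW (archi_boundP _))); first by rewrite divr_ge0// ltW.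
    rewrite -natrX ler_nat ltnW// ltn_expl//.
    exact: henon_system_degree sys.
  have [X [Y [_ _ XY]]] := orbit_poly n z b ML.
  have dist t : normc t <= s ->
      `|g t - log_max1 (X.[t], Y.[t]) / d%:R ^+ n| <= e.
    move=> ts; rewrite -XY; apply: le_trans kn; apply: (green_dist sys) => //.
    by rewrite /near_or_escaping le_max zt// orbT.
  have lmX (t : C) : ln (Num.max 1 (normc X.[t])) <= log_max1 (X.[t], Y.[t]).
    rewrite ler_ln ?posrE ?max1_gt0 ?lt_max ?ltr01// ge_max max1_ge1/=.
    by rewrite (le_trans (normc_fst (X.[t], Y.[t]))) ?nrm_max1.
  have lmY (t : C) : ln (Num.max 1 (normc Y.[t])) <= log_max1 (X.[t], Y.[t]).
    rewrite ler_ln ?posrE ?max1_gt0 ?lt_max ?ltr01// ge_max max1_ge1/=.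
    by rewrite (le_trans (normc_snd (X.[t], Y.[t]))) ?nrm_max1.
  have lm0 : log_max1 (X.[0], Y.[0]) = ln (Num.max 1 (normc X.[0])) \/
             log_max1 (X.[0], Y.[0]) = ln (Num.max 1 (normc Y.[0])).
    by rewrite /log_max1 /max1 /nrm /=; case: (leP (normc X.[0]) (normc Y.[0])); auto.
  have s0' : normc 0 <= s by rewrite Normc.normc0 ltW.
  have := dist 0 s0'; rewrite ler_norml => /andP[_ d0].
  case: lm0 => lm0; [exists X|exists Y]; exists (d%:R ^+ n); split=> //.
  - by rewrite -lm0; lra.
  - move=> t ts; have := dist t ts; rewrite ler_norml => /andP[d1 _].
    have : ln (Num.max 1 (normc X.[t])) / d%:R ^+ n <= log_max1 (X.[t], Y.[t]) / d%:R ^+ n.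
      by rewrite ler_pM2r ?invr_gt0.
    by lra.
  - by rewrite -lm0; lra.
  - move=> t ts; have := dist t ts; rewrite ler_norml => /andP[d1 _].
    have : ln (Num.max 1 (normc Y.[t])) / d%:R ^+ n <= log_max1 (X.[t], Y.[t]) / d%:R ^+ n.
      by rewrite ler_pM2r ?invr_gt0.
    by lra.
have [dl dl0 hdl] := green_uniform_continuous rho e0.
have nb0 : 0 < nrm b + 1 by rewrite ltr_wpDl ?nrm_ge0.
exists (dl / (nrm b + 1)); first by rewrite divr_gt0.
move=> t u ts us tu; apply: hdl => //; rewrite ?zt//.
rewrite opprD addrACA subrr add0r -scalerBl nrmZ.
rewrite ler_pdivlMr// in tu; apply: le_trans tu.
by rewrite ler_wpM2l ?normc_ge0// lerDl.
Qed.

End GreenSubmean.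

(** * Averages over a probability space *)

Section Average.
Context d {T : measurableType d} {R : realType} {Z : eqType}.
Variables (P : probability T R) (D : set T) (g : T -> Z -> R).
Hypotheses (mD : measurable D) (PD : P D = 1%E).
Hypothesis mg : forall z, measurable_fun D (g^~ z).
Hypothesis gB : forall z, exists B, forall w, D w -> `|g w z| <= B.

Definition average (z : Z) : R := \int[P]_(w in D) g w z.

Lemma bounded_integrable (f : T -> R) (B : R) : measurable_fun D f ->
  (forall w, D w -> `|f w| <= B) -> P.-integrable D (EFin \o f).
Proof.
move=> mf fB; have PDoo : (P D < +oo)%E by rewrite PD ltry.
apply: measurable_bounded_integrable => //.
exists B; split; first exact: num_real.
by move=> x Bx w Dw /=; rewrite (le_trans (fB w Dw))// ltW.
Qed.

Lemma average_integrable z : P.-integrable D (EFin \o g^~ z).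
Proof. by have [B hB] := gB z; exact: bounded_integrable hB. Qed.

Lemma lincomb_measurable (s : seq (R * Z)) :
  measurable_fun D (fun w => \sum_(q <- s) q.1 * g w q.2).
Proof.
by apply: measurable_sum => q; apply: measurable_funM => //; exact: measurable_cst.
Qed.

Lemma lincomb_integrable (s : seq (R * Z)) :
  P.-integrable D (EFin \o (fun w => \sum_(q <- s) q.1 * g w q.2)).
Proof.
have [B hB] : exists B, forall w, D w -> `|\sum_(q <- s) q.1 * g w q.2| <= B.
  elim: s => [|q s [B hB]]; first by exists 0 => w _; rewrite big_nil normr0.
  have [B' hB'] := gB q.2; exists (`|q.1| * B' + B) => w Dw; rewrite big_cons.
  by rewrite (le_trans (ler_normD _ _))// lerD ?hB// normrM ler_wpM2l ?hB'.
by apply: bounded_integrable hB; exact: lincomb_measurable.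
Qed.

Lemma average_lincombE (s : seq (R * Z)) :
  \sum_(q <- s) q.1 * average q.2 =
  \int[P]_(w in D) (\sum_(q <- s) q.1 * g w q.2).
Proof.
elim: s => [|q s IH].
  rewrite big_nil; under eq_Rintegral do rewrite big_nil.
  by rewrite Rintegral_cst// mul0r.
rewrite big_cons IH; under [RHS]eq_Rintegral do rewrite big_cons.
rewrite RintegralD//; last exact: lincomb_integrable.
  by rewrite RintegralZl//; exact: average_integrable.
have := lincomb_integrable [:: q].
by congr (integrable _ _ _); apply/funext => w /=; rewrite big_seq1.
Qed.

(** The common tool for passing continuity moduli and difference quotients to the average: both are
    bounds on finite linear combinations of values at fixed points. *)
Lemma average_lincomb (s : seq (R * Z)) (B : R) :
  (forall w, D w -> `|\sum_(q <- s) q.1 * g w q.2| <= B) ->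
  `|\sum_(q <- s) q.1 * average q.2| <= B.
Proof.
move=> hB; rewrite average_lincombE.
apply: le_trans (le_normr_Rintegral mD (lincomb_integrable s)) _.
have -> : B = \int[P]_(w in D) B.
  by rewrite Rintegral_cst// [X in fine X]PD mulr1.
apply: le_Rintegral => //.
- apply: (@bounded_integrable _ B).
    by apply: measurableT_comp => //; exact: lincomb_measurable.
  by move=> w Dw; rewrite normr_id hB.
- apply: (@bounded_integrable _ `|B|); first exact: measurable_cst.
  by move=> w Dw.
Qed.

Lemma average_eq0 z : (forall w, D w -> g w z = 0) -> average z = 0.
Proof.
move=> g0; have h : average z = \int[P]_(w in D) 0.
  by apply: eq_Rintegral => w; rewrite inE => /g0.
by rewrite h Rintegral_cst// mul0r.
Qed.

(** A nonnegative function with zero integral vanishes almost everywhere, so [A] would lie in a null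
    set. *)
Lemma average_gt0 z (A : set T) : (forall w, D w -> 0 <= g w z) ->
  measurable A -> A `<=` D -> (0 < P A)%E -> (forall w, A w -> 0 < g w z) ->
  0 < average z.
Proof.
move=> g0 mA AD PA gA; rewrite lt_def Rintegral_ge0// andbT.
apply/eqP => h0.
have hi : (\int[P]_(w in D) `|(g w z)%:E|)%E = 0%E.
  have -> : (\int[P]_(w in D) `|(g w z)%:E|)%E = (\int[P]_(w in D) (g w z)%:E)%E.
    by apply: eq_integral => w; rewrite inE => Dw; rewrite gee0_abs// lee_fin g0.
  have fz : (\int[P]_(w in D) (g w z)%:E)%E \is a fin_num.
    by apply: integrable_fin_num => //; exact: average_integrable.
  by rewrite -(fineK fz) -[fine _]/(average z) h0.
have mgz : measurable_fun D (fun w => (g w z)%:E).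
  by apply/measurable_EFinP; exact: mg.
have /(ae_eq_integral_abs P mD mgz) := hi.
move=> [N [mN PN sN]].
have AN : A `<=` N.
  move=> w Aw; apply: sN => /= h; have := h (AD w Aw) => -[gw].
  by have := gA w Aw; rewrite gw ltxx.
have : (P A <= P N)%E by apply: le_measure; rewrite ?inE.
by rewrite PN leNgt PA.
Qed.

(** The combinations are not assumed to be bounded uniformly in [N], and only their lower limit is
    controlled. Truncated at [g w z] they are dominated by it and converge to it, and truncation can
    only decrease the integral. *)
Lemma average_liminf z (s : nat -> seq (R * Z)) :
  (forall w v, D w -> 0 <= g w v) ->
  (forall N q, q \in s N -> 0 <= q.1) ->
  (forall w e, D w -> 0 < e -> \forall N \near \oo,
    g w z - e <= \sum_(q <- s N) q.1 * g w q.2) ->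
  forall e, 0 < e -> \forall N \near \oo,
    average z - e <= \sum_(q <- s N) q.1 * average q.2.
Proof.
move=> g0 s0 hlim e e0.
pose h N w := \sum_(q <- s N) q.1 * g w q.2.
pose f N w := Num.min (h N w) (g w z).
have h0 N w : D w -> 0 <= h N w.
  move=> Dw; rewrite /h big_seq; apply: sumr_ge0 => q qs.
  by rewrite mulr_ge0 ?g0// (s0 N).
have f0 N w : D w -> 0 <= f N w <= g w z.
  by move=> Dw; rewrite /f le_min h0// g0// ge_min lexx orbT.
have mf N : measurable_fun D (f N).
  by apply: measurable_minr => //; exact: lincomb_measurable.
have fi N : P.-integrable D (EFin \o f N).
  have [B hB] := gB z; apply: (bounded_integrable (mf N) (B := B)) => w Dw.
  have /andP[f1 f2] := f0 N w Dw; rewrite ger0_norm//.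
  by rewrite (le_trans f2)// (le_trans (ler_norm _))// hB.
have cv : (\int[P]_(w in D) (f N w)%:E)%E @[N --> \oo] -->
          (\int[P]_(w in D) (g w z)%:E)%E.
  apply: (@dominated_cvg _ _ _ P D mD (fun N w => (f N w)%:E) (fun w => (g w z)%:E)
           (fun w => (g w z)%:E)).
  - by move=> N; apply/measurable_EFinP.
  - move=> w Dw; apply: cvg_EFin; first by apply: nearW.
    apply/cvgrPdist_le => /= x x0; near=> N.
    have hN : g w z - x <= h N w by near: N; exact: hlim.
    have /andP[f1 f2] := f0 N w Dw.
    rewrite ger0_norm ?subr_ge0// lerBlDr -lerBlDl le_min hN /=.
    by rewrite gerBl ltW.
  - by move=> w Dw.
  - exact: average_integrable.
  - move=> N w Dw; have /andP[f1 f2] := f0 N w Dw.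
    by rewrite gee0_abs ?lee_fin.
have cvR : (\int[P]_(w in D) f N w) @[N --> \oo] --> average z.
  apply: fine_cvg; rewrite fineK//.
  by apply: integrable_fin_num => //; exact: average_integrable.
have : \forall N \near \oo, `|average z - \int[P]_(w in D) f N w| <= e.
  by move/cvgrPdist_le: cvR; apply.
apply: filterS => N; rewrite ler_norml => /andP[_ hN].
have : \int[P]_(w in D) f N w <= \sum_(q <- s N) q.1 * average q.2.
  rewrite average_lincombE; apply: le_Rintegral => //.
  - exact: lincomb_integrable.
  - by move=> w Dw; rewrite /f ge_min lexx.
by lra.
Unshelve. all: by end_near.
Qed.

End Average.

(** * Finite differences and pluriharmonicity *)

Section FiniteDifferences.
Context {R : realType}.
Local Notation C := R[i].
Implicit Types (z w b : C * C) (u : C * C -> R).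

Lemma continuous_nrmP u z : {for z, continuous u} <->
  forall e, 0 < e -> exists2 dl, 0 < dl &
    forall w, nrm (w - z) < dl -> `|u w - u z| <= e.
Proof.
split=> [/cvgrPdist_le cu e e0|h].
  have /nbhs_nrmP[dl dl0 hdl] := cu e e0.
  by exists dl => // w /hdl; rewrite distrC.
apply/cvgrPdist_le => /= e e0; have [dl dl0 hdl] := h e e0.
by apply/nbhs_nrmP; exists dl => // w /hdl; rewrite distrC.
Qed.

Lemma quadratic_derivable (f : R -> R) (rho K E : R) : 0 < rho ->
  (forall s, `|s| <= rho -> `|f s - f 0 - s * E| <= K * s ^+ 2) ->
  derivable f 0 1 /\ derive1 f 0 = E.
Proof.
move=> rho0 hf.
have cv : h^-1 *: (f (h + 0) - f 0) @[h --> 0^'] --> E.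
  apply/cvgrPdist_le => /= e e0; pose K' := `|K| + 1.
  have K'0 : 0 < K' by rewrite ltr_wpDl.
  near=> h; have h0 : h != 0 by near: h; exact: nbhs_dnbhs_neq.
  have hrho : `|h| <= rho by near: h; exact: dnbhs0_le.
  have he : `|h| <= e / K' by near: h; apply: dnbhs0_le; rewrite divr_gt0.
  have hn : 0 < `|h| by rewrite normr_gt0.
  rewrite addr0 distrC.
  have -> : h^-1 *: (f h - f 0) - E = h^-1 * (f h - f 0 - h * E).
    by rewrite -[h^-1 *: _]/(h^-1 * _) [RHS]mulrBr mulrA mulVf// mul1r.
  rewrite normrM normfV mulrC ler_pdivrMr//.
  apply: (le_trans (hf h hrho)).
  rewrite -real_normK ?num_real// expr2 mulrA ler_pM2r//.
  rewrite ler_pdivlMr// in he; apply: le_trans he; rewrite mulrC ler_pM2l//.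
  by rewrite /K' (le_trans (ler_norm _))// lerDl.
split; last exact: cvg_lim cv.
apply/cvg_ex; exists E; apply: cvg_trans cv; apply: near_eq_cvg.
by apply: nearW => h; rewrite /= /shift /= -[h *: 1]/(h * 1) mulr1.
Unshelve. all: by end_near.
Qed.

Definition odd_quot u w b (s : R) : R :=
  (u (w + s%:C *: b) - u (w - s%:C *: b)) / (2 * s).

(** The normalization gives half the second derivative in the limit, that is, the Taylor coefficient
    of [s ^+ 2]. *)
Definition even_quot u w b (s : R) : R :=
  (u (w + s%:C *: b) + u (w - s%:C *: b) - 2 * u w) / (2 * s ^+ 2).

(** The first two clauses are Cauchy estimates with explicit moduli, which stand for the existence
    of the first two derivatives along [b]; the third says that half the Laplacian on the complex
    line vanishes in the limit. Each bounds a finite combination of values of [u]. *)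
Record finite_diff u w b (rho K : R) : Prop := FiniteDiff {
  finite_diff_odd : forall s s', 0 < s' -> s' <= s -> s <= rho ->
    `|odd_quot u w b s - odd_quot u w b s'| <= K * s ^+ 2;
  finite_diff_even : forall s s', 0 < s' -> s' <= s -> s <= rho ->
    `|even_quot u w b s - even_quot u w b s'| <= K * s;
  finite_diff_harmonic : forall s, 0 < s -> s <= rho ->
    `|even_quot u w b s + even_quot u w ('i *: b) s| <= K * s
}.

Lemma finite_diff_le u w b rho K rho' K' : rho' <= rho -> K <= K' ->
  finite_diff u w b rho K -> finite_diff u w b rho' K'.
Proof.
move=> rr KK [h1 h2 h3]; split.
- move=> s s' s0 ss sr; apply: (le_trans (h1 s s' s0 ss (le_trans sr rr))).
  by rewrite ler_wpM2r// sqr_ge0.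
- move=> s s' s0 ss sr; apply: (le_trans (h2 s s' s0 ss (le_trans sr rr))).
  by rewrite ler_wpM2r// (le_trans (ltW s0)).
- move=> s s0 sr; apply: (le_trans (h3 s s0 (le_trans sr rr))).
  by rewrite ler_wpM2r// ltW.
Qed.

(** The intervals of radius [err s] around [h s] meet pairwise, so the supremum of their left ends
    lies in all of them. *)
Lemma modulus_limit (h err : R -> R) (rho : R) : 0 < rho ->
  (forall s, 0 < s -> 0 <= err s) ->
  (forall s s', 0 < s' -> s' <= s -> s <= rho -> `|h s - h s'| <= err s) ->
  exists D, forall s, 0 < s -> s <= rho -> `|h s - D| <= err s.
Proof.
move=> rho0 err0 hh.
pose A := [set x | exists2 s, 0 < s <= rho & x = h s - err s].
have ubA s : 0 < s -> s <= rho -> ubound A (h s + err s).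
  move=> s0 sr _ [s' /andP[s'0 s'r] ->].
  have e1 := err0 _ s0; have e2 := err0 _ s'0.
  have [ss|/ltW ss] := leP s' s.
    by have := hh s s' s'0 ss sr; rewrite ler_norml => /andP[? ?]; lra.
  by have := hh s' s s0 ss s'r; rewrite ler_norml => /andP[? ?]; lra.
exists (sup A) => s s0 sr; rewrite ler_distlC; apply/andP; split.
  apply: ub_le_sup; last by exists s => //; rewrite s0.
  by exists (h s + err s); exact: ubA.
apply: ge_sup; last exact: ubA.
by exists (h s - err s); exists s => //; rewrite s0.
Qed.

(** A limit along a fixed sequence yields a total function of the point, whose continuity can be
    stated before any second derivative is known to exist. *)
Definition second_quot_lim u b w : R :=
  lim ((fun n => even_quot u w b (n.+1%:R^-1)) @ \oo).

Lemma even_quot_lim u w b rho K Q : 0 < rho ->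
  (forall s, 0 < s -> s <= rho -> `|even_quot u w b s - Q| <= K * s) ->
  second_quot_lim u b w = Q.
Proof.
move=> rho0 h; apply/cvg_lim => //; apply/cvgrPdist_le => /= e e0.
pose K' := `|K| + 1; have K'0 : 0 < K' by rewrite ltr_wpDl.
near=> n; rewrite distrC; have n0 : 0 < n.+1%:R :> R by rewrite ltr0n.
have nr : n.+1%:R^-1 <= rho :> R.
  near: n; exists (Num.Def.archi_bound rho^-1) => // n /= nn.
  rewrite -[leRHS]invrK lef_pV2 ?posrE ?invr_gt0//.
  apply: ltW; apply: (lt_le_trans (archi_boundP _)); first by rewrite invr_ge0 ltW.
  by rewrite ler_nat ltnW.
have ne : n.+1%:R^-1 <= e / K' :> R.
  near: n; exists (Num.Def.archi_bound (e / K')^-1) => // n /= nn.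
  have eK : 0 < e / K' by rewrite divr_gt0.
  rewrite -[leRHS]invrK lef_pV2 ?posrE ?invr_gt0//.
  apply: ltW; apply: (lt_le_trans (archi_boundP _)); first by rewrite invr_ge0 ltW.
  by rewrite ler_nat ltnW.
apply: (le_trans (h _ _ nr)); first by rewrite invr_gt0.
rewrite ler_pdivlMr// in ne; apply: le_trans ne; rewrite mulrC.
rewrite ler_pM2l ?invr_gt0//; rewrite /K'.
by rewrite (le_trans (ler_norm _))// lerDl.
Unshelve. all: by end_near.
Qed.

Definition taylor2 u w b (rho K D Q : R) : Prop :=
  forall s : R, `|s| <= rho ->
    `|u (w + s%:C *: b) - u w - s * D - s ^+ 2 * Q| <= K * `|s| ^+ 3.

Lemma taylor2_real_deriv u w b rho K D Q : 0 < rho -> 0 <= K ->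
  taylor2 u w b rho K D Q ->
  derivable (fun t : R => u (w + t%:C *: b)) 0 1 /\ real_deriv b u w = D.
Proof.
move=> rho0 K0 hT.
apply: (@quadratic_derivable _ rho (`|Q| + K * rho)) => // s sr.
rewrite scale0r addr0; have := hT s sr.
have sq : `|s| ^+ 2 = s ^+ 2 by rewrite real_normK ?num_real.
have k1 : K * `|s| ^+ 3 <= K * rho * s ^+ 2.
  by rewrite -sq (exprS _ 2) mulrA ler_wpM2r ?sqr_ge0// ler_wpM2l.
have k2 : `|s ^+ 2 * Q| <= `|Q| * s ^+ 2 by rewrite normrM normrX sq mulrC.
move: k2; rewrite mulrDl !ler_norml => /andP[? ?] /andP[? ?].
by apply/andP; split; lra.
Qed.

Lemma scaleNC (s : R) b : (- s)%:C *: b = - (s%:C *: b).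
Proof. by rewrite rmorphN scaleNr. Qed.

(** The increment [u (w + s b) - u w] is exactly [s * odd_quot + s ^+ 2 * even_quot]. For negative
    [s] the sign [sg] flips only the odd part. *)
Lemma taylor_of_quots u w b rho K D Q : 0 < rho -> 0 <= K ->
  (forall s, 0 < s -> s <= rho -> `|odd_quot u w b s - D| <= K * s ^+ 2) ->
  (forall s, 0 < s -> s <= rho -> `|even_quot u w b s - Q| <= K * s) ->
  taylor2 u w b rho (2 * K) D Q.
Proof.
move=> rho0 K0 hD hQ.
have key s sg : 0 < s -> s <= rho -> `|sg| = 1 ->
    `|s * (sg * (odd_quot u w b s - D)) + s ^+ 2 * (even_quot u w b s - Q)|
      <= 2 * K * s ^+ 3.
  move=> s0 sr sg1; apply: (le_trans (ler_normD _ _)).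
  rewrite (normrM s) (normrM sg) sg1 mul1r (gtr0_norm s0).
  rewrite (normrM (s ^+ 2)) (ger0_norm (sqr_ge0 s)).
  have h1 := hD s s0 sr; have h2 := hQ s s0 sr.
  have -> : 2 * K * s ^+ 3 = s * (K * s ^+ 2) + s ^+ 2 * (K * s) by ring.
  by rewrite lerD// ler_pM2l// exprn_gt0.
move=> s; have [s0|s0|<-] := ltgtP 0 s.
- rewrite (gtr0_norm s0) => sr.
  have := key s 1 s0 sr (normr1 _); congr (`| _ | <= _).
  rewrite /odd_quot /even_quot; field.
  by rewrite gt_eqF.
- rewrite (ltr0_norm s0) => sr.
  have s0' : 0 < - s by rewrite oppr_gt0.
  have := key (- s) (- 1) s0' sr; rewrite normrN1 => /(_ erefl).
  congr (`| _ | <= _).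
  rewrite /odd_quot /even_quot scaleNC opprK; field.
  by rewrite lt_eqF.
- move=> _; rewrite scale0r addr0 subrr !mul0r expr0n /= !subr0 mul0r subr0 normr0.
  by rewrite expr0n /= mulr0.
Qed.

Lemma finite_diff_taylor u w b rho K : 0 < rho -> 0 <= K ->
  finite_diff u w b rho K ->
  let D := real_deriv b u w in let Q := second_quot_lim u b w in
  [/\ derivable (fun t : R => u (w + t%:C *: b)) 0 1,
      forall s, 0 < s -> s <= rho -> `|odd_quot u w b s - D| <= K * s ^+ 2,
      forall s, 0 < s -> s <= rho -> `|even_quot u w b s - Q| <= K * s &
      taylor2 u w b rho (2 * K) D Q].
Proof.
move=> rho0 K0 [h1 h2 _].
have [D hD] := @modulus_limit (odd_quot u w b) (fun s => K * s ^+ 2) rho rho0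
  (fun s s0 => mulr_ge0 K0 (sqr_ge0 s)) h1.
have [Q hQ] := @modulus_limit (even_quot u w b) (fun s => K * s) rho rho0
  (fun s s0 => mulr_ge0 K0 (ltW s0)) h2.
have hT := taylor_of_quots rho0 K0 hD hQ.
have [dv DE] := taylor2_real_deriv rho0 (mulr_ge0 (ler0n _ 2) K0) hT.
have QE := even_quot_lim rho0 hQ.
by rewrite /= DE QE.
Qed.

Lemma uniform_limit_continuous (h : C * C -> R) (hs : R -> C * C -> R) z
    (dl0 rho K : R) : 0 < dl0 -> 0 < rho -> 0 <= K ->
  (forall s, 0 < s -> s <= rho -> {for z, continuous (hs s)}) ->
  (forall w s, nrm (w - z) < dl0 -> 0 < s -> s <= rho -> `|hs s w - h w| <= K * s) ->
  {for z, continuous h}.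
Proof.
move=> d0 rho0 K0 hc hh; apply/continuous_nrmP => e e0.
pose s := Num.min rho (e / (3 * (K + 1))).
have K1 : 0 < K + 1 by rewrite ltr_wpDl.
have s0 : 0 < s by rewrite lt_min rho0 divr_gt0// mulr_gt0.
have sr : s <= rho by rewrite ge_min lexx.
have Ks : K * s <= e / 3.
  have : s <= e / (3 * (K + 1)) by rewrite ge_min lexx orbT.
  rewrite ler_pdivlMr ?mulr_gt0// => h1.
  by have : K * s <= (K + 1) * s; [rewrite ler_pM2r// lerDl|lra].
have e3 : 0 < e / 3 by rewrite divr_gt0.
have [dl1 dl10 h1] := (continuous_nrmP _ _).1 (hc s s0 sr) _ e3.
exists (Num.min dl0 dl1); first by rewrite lt_min d0.
move=> w; rewrite lt_min => /andP[w0 w1].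
have z0 : nrm (z - z) < dl0 by rewrite subrr nrm0.
have := hh w s w0 s0 sr; have := hh z s z0 s0 sr; have := h1 w w1.
rewrite !ler_norml => /andP[? ?] /andP[? ?] /andP[? ?].
by apply/andP; split; lra.
Qed.

Section Pluriharmonic.
Variables (U : set (C * C)) (u : C * C -> R).
Hypothesis cu : continuous u.
Hypothesis hU : forall z b, U z -> exists dl rho K, [/\ 0 < dl, 0 < rho, rho <= 1,
  0 <= K & forall w, nrm (w - z) < dl -> finite_diff u w b rho K].

Lemma continuous_translate v z : {for z, continuous (fun w => u (w + v))}.
Proof.
apply/continuous_nrmP => e e0.
have [dl dl0 h] := (continuous_nrmP u (z + v)).1 (@cu (z + v)) e e0.
by exists dl => // w wz; apply: h; rewrite opprD addrACA subrr addr0.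
Qed.

Lemma real_deriv_derivable b z : U z ->
  derivable (fun t : R => u (z + t%:C *: b)) 0 1.
Proof.
move=> Uz; have [dl [rho [K [dl0 rho0 _ K0 h]]]] := hU b Uz.
have zz : nrm (z - z) < dl by rewrite subrr nrm0.
by have [] := finite_diff_taylor rho0 K0 (h z zz).
Qed.

Lemma real_deriv_continuous b z : U z -> {for z, continuous (real_deriv b u)}.
Proof.
move=> Uz; have [dl [rho [K [dl0 rho0 rho1 K0 h]]]] := hU b Uz.
apply: (@uniform_limit_continuous _ (fun s w => odd_quot u w b s) z dl rho K) => //.
  move=> s s0 sr; apply: cvgM; last exact: cvg_cst.
  by apply: cvgB; exact: continuous_translate.
move=> w s wz s0 sr; have [_ h1 _ _] := finite_diff_taylor rho0 K0 (h w wz).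
apply: (le_trans (h1 s s0 sr)); rewrite ler_wpM2l// expr2 ger_pMl//.
exact: le_trans sr rho1.
Qed.

Lemma second_quot_lim_continuous b z : U z ->
  {for z, continuous (second_quot_lim u b)}.
Proof.
move=> Uz; have [dl [rho [K [dl0 rho0 rho1 K0 h]]]] := hU b Uz.
apply: (@uniform_limit_continuous _ (fun s w => even_quot u w b s) z dl rho K) => //.
  move=> s s0 sr; apply: cvgM; last exact: cvg_cst.
  apply: cvgB; first by apply: cvgD; exact: continuous_translate.
  by apply: cvgM; [exact: cvg_cst|exact: cu].
by move=> w s wz s0 sr; have [_ _ h1 _] := finite_diff_taylor rho0 K0 (h w wz); exact: h1.
Qed.

(* Polarization: the odd quotient in the direction [b] at [z + s b'] is a
   difference of two values at [z], in the directions [b' + b] and [b' - b]. *)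
Lemma real_deriv2E b b' z : U z ->
  derivable (fun t : R => real_deriv b u (z + t%:C *: b')) 0 1 /\
  real_deriv b' (real_deriv b u) z =
    (second_quot_lim u (b' + b) z - second_quot_lim u (b' - b) z) / 2.
Proof.
move=> Uz.
have [d1 [r1 [K1 [d10 r10 r11 K10 h1]]]] := hU b Uz.
have [d2 [r2 [K2 [d20 r20 _ K20 h2]]]] := hU (b' + b) Uz.
have [d3 [r3 [K3 [d30 r30 _ K30 h3]]]] := hU (b' - b) Uz.
have zz dl : 0 < dl -> nrm (z - z) < dl by rewrite subrr nrm0.
have [_ _ _ T2] := finite_diff_taylor r20 K20 (h2 z (zz _ d20)).
have [_ _ _ T3] := finite_diff_taylor r30 K30 (h3 z (zz _ d30)).
set D2 := real_deriv _ u z in T2; set Q2 := second_quot_lim u _ z in T2 *.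
set D3 := real_deriv _ u z in T3; set Q3 := second_quot_lim u _ z in T3 *.
pose f (t : R) := real_deriv b u (z + t%:C *: b').
pose rho := Num.min (Num.min r1 (d1 / (2 * (nrm b' + 1)))) (Num.min r2 r3).
have nb1 : 0 < nrm b' + 1 by rewrite ltr_wpDl// nrm_ge0.
have rho0 : 0 < rho by rewrite !lt_min r10 r20 r30 divr_gt0// mulr_gt0.
(* The odd quotient is taken with step [s] at the very point [z + s b'], and the two values it
   involves are expanded at [z]. This leaves out [s = 0]. *)
have bnd (s : R) : `|s| <= rho -> s != 0 ->
    `|f s - (D2 - D3) / 2 - s * ((Q2 - Q3) / 2)| <= (K1 + K2 + K3) * s ^+ 2.
  rewrite !le_min => /andP[/andP[s1 sd] /andP[s2 s3]] sn0.
  have as0 : 0 < `|s| by rewrite normr_gt0.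
  have wz : nrm (z + s%:C *: b' - z) < d1.
    rewrite addrC addKr nrmZ normc_real.
    apply: (@le_lt_trans _ _ (`|s| * (nrm b' + 1))).
      by rewrite ler_wpM2l// lerDl.
    rewrite ler_pdivlMr ?mulr_gt0// in sd.
    by apply: (@le_lt_trans _ _ (d1 / 2)); [lra|rewrite gtr_pMr ?invf_lt1// ltr1n].
  have [_ hD _ _] := finite_diff_taylor r10 K10 (h1 _ wz).
  have {hD} := hD `|s| as0 s1; rewrite real_normK ?num_real//.
  have -> : odd_quot u (z + s%:C *: b') b `|s| =
     (u (z + s%:C *: (b' + b)) - u (z + s%:C *: (b' - b))) / (2 * s).
    have e1 : z + s%:C *: (b' + b) = z + s%:C *: b' + s%:C *: b.
      by rewrite scalerDr addrA.
    have e2 : z + s%:C *: (b' - b) = z + s%:C *: b' - s%:C *: b.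
      by rewrite scalerBr addrA.
    rewrite e1 e2 /odd_quot; have [s0|s0|s0] := ltgtP 0 s.
    - by rewrite gtr0_norm.
    - by rewrite ltr0_norm// scaleNC opprK; field; rewrite lt_eqF.
    - by rewrite s0 eqxx in sn0.
  have := T2 s s2; have := T3 s s3.
  have as2 : `|s| ^+ 3 = `|s| * s ^+ 2 by rewrite exprS real_normK ?num_real.
  rewrite as2.
  set a2 := u (z + s%:C *: (b' + b)); set a3 := u (z + s%:C *: (b' - b)).
  rewrite -/(f s) => t3 t2 t1.
  have s2p : 0 < s ^+ 2 by rewrite exprn_even_gt0.
  have -> : f s - (D2 - D3) / 2 - s * ((Q2 - Q3) / 2) =
    - ((a2 - a3) / (2 * s) - f s) +
      (2 * s)^-1 * ((a2 - u z - s * D2 - s ^+ 2 * Q2) -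
                    (a3 - u z - s * D3 - s ^+ 2 * Q3)).
    by field.
  have -> : (K1 + K2 + K3) * s ^+ 2 = K1 * s ^+ 2 + (K2 + K3) * s ^+ 2 by ring.
  apply: (le_trans (ler_normD _ _)); rewrite normrN; apply: lerD => //.
  rewrite normrM normfV normrM (gtr0_norm (_ : 0 < 2))// mulrC ler_pdivrMr ?mulr_gt0//.
  apply: (le_trans (ler_normB _ _)).
  by apply: (le_trans (lerD t2 t3)); rewrite le_eqVlt; apply/orP; left; apply/eqP; ring.
(* The missing value, which is linearity of the derivative in the direction, follows by letting [s]
   tend to 0 in [bnd], since [real_deriv b u] is continuous. *)
have f0 : f 0 = (D2 - D3) / 2.
  have cf : {for (z : C * C), continuous (real_deriv b u)} by exact: real_deriv_continuous.
  apply/eqP; rewrite -subr_eq0 -normr_le0; apply/ler_addgt0Pr => e e0; rewrite add0r.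
  have [dl dl0 hdl] := (continuous_nrmP _ _).1 cf (e / 2) (divr_gt0 e0 (ltr0n _ 2)).
  have K0 : 0 <= K1 + K2 + K3 by rewrite !addr_ge0.
  pose E := `|(Q2 - Q3) / 2| + (K1 + K2 + K3) * rho.
  have E0 : 0 <= E by rewrite addr_ge0// mulr_ge0// ltW.
  pose s := Num.min rho (Num.min (dl / (2 * (nrm b' + 1))) (e / (2 * (E + 1)))).
  have E1 : 0 < E + 1 by rewrite ltr_wpDl.
  have s0 : 0 < s by rewrite lt_min rho0 lt_min !divr_gt0// mulr_gt0.
  have sr : s <= rho by rewrite ge_min lexx.
  have sdl : s <= dl / (2 * (nrm b' + 1)).
    by rewrite ge_min [X in _ || X]ge_min lexx !orbT.
  have se : s <= e / (2 * (E + 1)) by rewrite ge_min [X in _ || X]ge_min lexx !orbT.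
  have wz : nrm (z + s%:C *: b' - z) < dl.
    rewrite addrC addKr nrmZ normc_real (gtr0_norm s0).
    apply: (@le_lt_trans _ _ (s * (nrm b' + 1))).
      by rewrite ler_wpM2l ?lerDl// ltW.
    rewrite ler_pdivlMr ?mulr_gt0// in sdl.
    by apply: (@le_lt_trans _ _ (dl / 2)); [lra|rewrite gtr_pMr ?invf_lt1// ltr1n].
  have := hdl _ wz; rewrite -[real_deriv b u (z + _)]/(f s).
  rewrite (_ : real_deriv b u z = f 0); last by rewrite /f scale0r addr0.
  have sn : `|s| <= rho by rewrite gtr0_norm.
  have := bnd s sn (lt0r_neq0 s0).
  have h4 : `|s * ((Q2 - Q3) / 2)| + (K1 + K2 + K3) * s ^+ 2 <= s * E.
    rewrite normrM (gtr0_norm s0) /E mulrDr lerD2l expr2 mulrA mulrC.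
    by rewrite ler_pM2l// ler_wpM2l.
  have h5 : s * E <= e / 2.
    rewrite ler_pdivlMr ?mulr_gt0// in se.
    by have : s * E <= s * (E + 1); [rewrite ler_pM2l// lerDl|lra].
  have h6 := ler_norm (s * ((Q2 - Q3) / 2)).
  have h7 := ler_norm (- (s * ((Q2 - Q3) / 2))); rewrite normrN in h7.
  rewrite !ler_norml => /andP[? ?] /andP[? ?].
  by apply/andP; split; lra.
apply: (@quadratic_derivable f rho (K1 + K2 + K3)) => // s sr.
have [->|sn0] := eqVneq s 0; first by rewrite subrr mul0r subr0 normr0 expr0n mulr0.
by rewrite f0; exact: bnd.
Qed.

Lemma finite_diff_pluriharmonic : open U -> pluriharmonic_on U u.
Proof.
move=> oU; split.
  split=> [b z Uz|b b' z Uz].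
    by split; [exact: real_deriv_derivable|exact: real_deriv_continuous].
  split; first by have [] := real_deriv2E b b' Uz.
  pose h w := (second_quot_lim u (b' + b) w - second_quot_lim u (b' - b) w) / 2.
  have hc : {for z, continuous h}.
    apply: cvgM; last exact: cvg_cst.
    by apply: cvgB; exact: second_quot_lim_continuous.
  have hE w : U w -> real_deriv b' (real_deriv b u) w = h w.
    by move=> Uw; have [] := real_deriv2E b b' Uw.
  rewrite /prop_for /continuous_at hE//; apply: cvg_trans hc.
  apply: near_eq_cvg.
  have nU : nbhs z U by exact: (open_nbhs_nbhs (conj oU Uz)).
  by apply: filterS nU => w /hE ->.
move=> z b Uz.
have [_ ->] := real_deriv2E b b Uz.
have [_ ->] := real_deriv2E ('i *: b) ('i *: b) Uz.
(* For equal directions the second polarization term has direction 0, so the Laplacian is half of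
   [Q1 + Q2] for the directions [b + b] and ['i *: (b + b)]; that sum vanishes by the harmonic
   clause. *)
have z0 : second_quot_lim u 0 z = 0.
  apply: (@even_quot_lim _ _ _ 1 0) => // s s0 _.
  rewrite /even_quot !scaler0 !subr0 addr0.
  by rewrite (_ : u z + u z - 2 * u z = 0); [rewrite mul0r normr0 mul0r|ring].
rewrite !subrr z0 !subr0 -mulrDl -scalerDr.
have [d1 [r1 [K1 [d10 r10 _ K10 h1]]]] := hU (b + b) Uz.
have [d2 [r2 [K2 [d20 r20 _ K20 h2]]]] := hU ('i *: (b + b)) Uz.
have zz dl : 0 < dl -> nrm (z - z) < dl by rewrite subrr nrm0.
have [_ _ e1 _] := finite_diff_taylor r10 K10 (h1 z (zz _ d10)).
have [_ _ e2 _] := finite_diff_taylor r20 K20 (h2 z (zz _ d20)).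
have e3 := finite_diff_harmonic (h1 z (zz _ d10)).
set Q1 := second_quot_lim _ _ _ in e1 *; set Q2 := second_quot_lim _ _ _ in e2 *.
suff -> : Q1 + Q2 = 0 by rewrite mul0r.
apply/eqP; rewrite -normr_le0; apply/ler_addgt0Pr => e e0; rewrite add0r.
pose K := K1 + K2 + K1 + 1; have K0 : 0 < K by rewrite ltr_wpDl// !addr_ge0.
pose s := Num.min (Num.min r1 r2) (e / K).
have s0 : 0 < s by rewrite !lt_min r10 r20 divr_gt0.
have s1 : s <= r1 by rewrite !ge_min lexx.
have s2 : s <= r2 by rewrite !ge_min lexx orbT.
have : s <= e / K by rewrite !ge_min lexx !orbT.
rewrite ler_pdivlMr// /K => sK.
have := e1 s s0 s1; have := e2 s s0 s2; have := e3 s s0 s1.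
rewrite !ler_norml => /andP[? ?] /andP[? ?] /andP[? ?].
by apply/andP; split; lra.
Qed.

End Pluriharmonic.
End FiniteDifferences.

(** * Taylor expansion of the logarithm of a polynomial *)

Section LogPolynomial.
Context {R : realType}.
Local Notation C := R[i].

(** The remainder has derivative [y ^+ 2 / (1 + y)], and [1 + y >= 1 / 4] is the origin of the
    factor 4. *)
Lemma ln_taylor (x : R) : `|x| <= 3 / 4 ->
  `|ln (1 + x) - x + x ^+ 2 / 2| <= 4 * `|x| ^+ 3.
Proof.
move=> x34; pose f (y : R) := ln (1 + y) - y + y ^+ 2 / 2.
pose df (y : R) := (1 + y)^-1 - 1 + y.
have pos (y : R) : `|y| <= 3 / 4 -> 1 / 4 <= 1 + y by rewrite ler_norml => /andP[? ?]; lra.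
have f0 : f 0 = 0 by rewrite /f addr0 ln1 expr0n/= mul0r subrr addr0.
have fd (y : R) : `|y| <= 3 / 4 -> is_derive y 1 f (df y).
  move=> /pos y14; have y0 : 0 < 1 + y by lra.
  have h1 : is_derive y (1 : R) (fun z : R => 1 + z) 1.
    by apply: is_derive_eq; rewrite add0r mulr1.
  have h2 : is_derive y (1 : R) (fun z : R => z ^+ 2 / 2) y.
    apply: is_derive_eq; rewrite !scaler0 add0r.
    by rewrite -[LHS]/(2^-1 * (y * 1 + y * 1)); field.
  have h3 := is_derive1_comp (is_derive1_ln y0) h1; rewrite mulr1 in h3.
  exact: (is_deriveD (is_deriveB h3 (is_derive_id _ _)) h2).
have bnd (y z : R) : `|y| <= 3 / 4 -> `|z| <= `|y| -> `|df z * y| <= 4 * `|y| ^+ 3.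
  move=> y34 zy; have z14 := pos z (le_trans zy y34).
  have -> : df z = z ^+ 2 / (1 + z) by rewrite /df; field; lra.
  rewrite normrM [`|y| ^+ 3]exprSr mulrA ler_wpM2r//.
  rewrite normrM normfV (ger0_norm (_ : 0 <= 1 + z)); last by lra.
  rewrite ler_pdivrMr; last by lra.
  rewrite normrX.
  have h : `|z| ^+ 2 <= `|y| ^+ 2 by rewrite lerXn2r ?nnegrE.
  have y2 : 0 <= `|y| ^+ 2 by rewrite exprn_ge0.
  by nra.
rewrite -/(f x).
have [x0|x0|<-] := ltgtP 0 x; last by rewrite f0 !normr0 expr0n mulr0.
- have [||c] := @MVT R f df 0 x x0.
  + move=> y; rewrite in_itv /= => /andP[y0 yx]; apply: fd.
    by move: x34; rewrite !gtr0_norm// => ?; lra.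
  + apply: derivable_within_continuous => y; rewrite in_itv /= => /andP[y0 yx].
    have : is_derive y 1 f (df y).
      by apply: fd; move: x34; rewrite gtr0_norm// ger0_norm//; lra.
    by case.
  rewrite in_itv /= f0 !subr0 => /andP[c0 cx] ->; apply: bnd => //.
  by rewrite !gtr0_norm// ltW.
- have [||c] := @MVT R f df x 0 x0.
  + move=> y; rewrite in_itv /= => /andP[y0 yx]; apply: fd.
    by move: x34; rewrite !ltr0_norm// => ?; lra.
  + apply: derivable_within_continuous => y; rewrite in_itv /= => /andP[y0 yx].
    have : is_derive y 1 f (df y).
      by apply: fd; move: x34; rewrite ltr0_norm// ler0_norm//; lra.
    by case.
  rewrite in_itv /= f0 !sub0r => /andP[c0 cx] /eqP; rewrite mulrN eqr_opp => /eqP ->.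
  by apply: bnd => //; rewrite !ltr0_norm// lerN2 ltW.
Qed.

(** Apply [ln_taylor] to half the logarithm of [|1 - w|^2 = 1 + x], with [x = |w|^2 - 2 Re w] and
    [|x| <= 9/4 |w|]. The constant 24 rounds up [729/32 + 1 + 1/16]: the cubic remainder and the
    terms of order three and four in [x ^+ 2]. *)
Lemma ln_normc_taylor (w : C) : normc w <= 1 / 4 ->
  `|ln (normc (1 - w)) + Re w + Re (w ^+ 2) / 2| <= 24 * normc w ^+ 3.
Proof.
move=> w14; have n0 := normc_ge0 w.
have [sq1 sq2] : normc w ^+ 2 = Re w ^+ 2 + Im w ^+ 2 /\
    Re (w ^+ 2) = Re w ^+ 2 - Im w ^+ 2.
  by split; [exact: sqr_normcE|case: w {w14 n0}].
have sq3 : normc (1 - w) ^+ 2 = (1 - Re w) ^+ 2 + Im w ^+ 2.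
  by rewrite sqr_normcE; case: w {w14 n0 sq1 sq2} => a b /=; rewrite sub0r sqrrN.
have ha := normc_Re w.
set n := normc w in n0 w14 sq1 ha *; set a := Re w in sq1 sq2 sq3 ha *.
pose x := n ^+ 2 - 2 * a.
have n2 : n ^+ 2 <= n / 4 by rewrite expr2; nra.
have xn : `|x| <= 9 / 4 * n.
  move: ha; have := sqr_ge0 n => ?; rewrite /x !ler_norml => /andP[? ?].
  by apply/andP; split; lra.
have x34 : `|x| <= 3 / 4 by rewrite (le_trans xn)//; lra.
have x1 : 1 + x = normc (1 - w) ^+ 2 by rewrite /x sq1 sq3; ring.
have x1p : 0 < 1 + x by move: x34; rewrite ler_norml => /andP[? ?]; lra.
have np : 0 < normc (1 - w).
  by rewrite lt_def normc_ge0 andbT; apply: contraTneq x1p => e; rewrite x1 e expr0n ltxx.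
have lnE : ln (1 + x) = 2 * ln (normc (1 - w)) by rewrite x1 lnXn// mulr_natl.
have := ln_taylor x34; rewrite lnE sq2.
have -> : Im w ^+ 2 = n ^+ 2 - a ^+ 2 by rewrite sq1; ring.
have x3 : 4 * `|x| ^+ 3 <= 4 * (9 / 4 * n) ^+ 3.
  by rewrite ler_pM2l// lerXn2r ?nnegrE// mulr_ge0.
have n3 : 0 <= n ^+ 3 by rewrite exprn_ge0.
have am : `|a * n ^+ 2| <= n ^+ 3.
  by rewrite normrM exprS (ger0_norm (sqr_ge0 n)) ler_wpM2r// sqr_ge0.
have n4 : 0 <= n ^+ 4 <= n ^+ 3 / 4.
  rewrite exprn_ge0//= exprS mulrC; nra.
have -> : x ^+ 2 / 2 = n ^+ 4 / 2 - 2 * (a * n ^+ 2) + 2 * a ^+ 2.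
  by rewrite /x; field.
have e1 : (9 / 4 * n) ^+ 3 = 729 / 64 * n ^+ 3 by field.
rewrite e1 in x3; move: am n4 => am /andP[n41 n42] h.
have {}h := le_trans h x3.
move: am h; rewrite /x !ler_norml => /andP[? ?] /andP[? ?].
by apply/andP; split; lra.
Qed.

(** Every root has modulus at least [rho], so [t / al] has modulus at most 1/4 and each of the at
    most [m] roots contributes one copy of the remainder. *)
Lemma log_poly_taylor (P : {poly C}) (m : nat) (rho : R) : 0 < rho ->
  (size P <= m.+1)%N -> (forall t, normc t < rho -> P.[t] != 0) ->
  exists c1 c2 : C, forall t, normc t <= rho / 4 ->
    `|ln (normc P.[t]) - ln (normc P.[0]) - Re (c1 * t) - Re (c2 * t ^+ 2)|
      <= m%:R * (24 / rho ^+ 3) * normc t ^+ 3.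
Proof.
move=> rho0 sP Prho.
have nP : P != 0.
  have : P.[0] != 0 by apply: Prho; rewrite Normc.normc0.
  by apply: contraNneq => ->; rewrite horner0.
have [rs PE] := closed_field_poly_normal P.
have c0 : lead_coef P != 0 by rewrite lead_coef_eq0.
have srs : (size rs <= m)%N.
  by move: sP; rewrite PE size_scale// size_prod_XsubC.
have rrho al : al \in rs -> rho <= normc al.
  move=> als; rewrite leNgt; apply/negP => /Prho; rewrite PE hornerZ.
  rewrite (_ : (\prod_(z <- rs) ('X - z%:P)).[al] = 0) ?mulr0 ?eqxx//.
  by apply/rootP; rewrite root_prod_XsubC.
have Qrho t : normc t < rho -> (\prod_(z <- rs) ('X - z%:P)).[t] != 0.
  by move=> /Prho; rewrite PE hornerZ; apply: contraNneq => ->; rewrite mulr0.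
have K0 : 0 <= 24 / rho ^+ 3 by rewrite divr_ge0// exprn_ge0// ltW.
suff [c1 [c2 h]] : exists c1 c2 : C, forall t, normc t <= rho / 4 ->
    `|ln (normc (\prod_(z <- rs) ('X - z%:P)).[t]) -
      ln (normc (\prod_(z <- rs) ('X - z%:P)).[0]) - Re (c1 * t) - Re (c2 * t ^+ 2)|
      <= (size rs)%:R * (24 / rho ^+ 3) * normc t ^+ 3.
  exists c1, c2 => t t4; have trho : normc t < rho.
    by apply: le_lt_trans t4 _; rewrite gtr_pMr// invf_lt1// ltr1n.
  have q0 : (\prod_(z <- rs) ('X - z%:P)).[0] != 0 by apply: Qrho; rewrite Normc.normc0.
  rewrite PE !hornerZ !Normc.normcM !lnM ?posrE ?normc_gt0 ?q0 ?Qrho//.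
  rewrite opprD addrACA subrr add0r; apply: (le_trans (h t t4)).
  rewrite -!mulrA ler_wpM2r ?ler_nat//.
  by rewrite mulrA mulr_ge0// exprn_ge0 ?normc_ge0.
elim: rs {PE srs} rrho Qrho => [_ _|al rs IH rrho Qrho].
  exists 0, 0 => t _; rewrite big_nil !hornerC subrr !mul0r.
  by rewrite [Re 0]/= !subr0 normr0 lexx.
have Qrho' t : normc t < rho -> (\prod_(z <- rs) ('X - z%:P)).[t] != 0.
  by move=> /Qrho; rewrite big_cons hornerM mulf_eq0 negb_or => /andP[].
have [|//|c1 [c2 h]] := IH.
  by move=> x xs; apply: rrho; rewrite inE xs orbT.
have alr : rho <= normc al by apply: rrho; rewrite inE eqxx.
have al0 : al != 0 by rewrite -normc_gt0 (lt_le_trans rho0).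
(* The new terms are the coefficients of [ln |t - al| - ln |al| = ln |1 - t / al|]. *)
exists (c1 - al^-1), (c2 - (al ^+ 2)^-1 / 2) => t t4.
have trho : normc t < rho.
  by apply: le_lt_trans t4 _; rewrite gtr_pMr// invf_lt1// ltr1n.
have z0 : normc (0 : C) < rho by rewrite Normc.normc0.
have tal : t - al != 0.
  by have := Qrho t trho; rewrite big_cons hornerM mulf_eq0 negb_or hornerXsubC => /andP[].
rewrite !big_cons !hornerM !Normc.normcM !hornerXsubC sub0r.
rewrite !lnM ?posrE ?normc_gt0 ?oppr_eq0 ?Qrho'//.
have wE : ln (normc (t - al)) = ln (normc (- al)) + ln (normc (1 - t / al)).
  rewrite -lnM ?posrE ?normc_gt0 ?oppr_eq0//.
    by rewrite -Normc.normcM; congr (ln (normc _)); field.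
  rewrite (_ : 1 - t / al = (al - t) / al); last by field.
  by rewrite mulf_neq0 ?invr_eq0// -opprB oppr_eq0.
have nw : normc (t / al) = normc t / normc al by rewrite Normc.normcM Normc.normcV.
have w14 : normc (t / al) <= 1 / 4.
  by rewrite nw ler_pdivrMr ?normc_gt0// (le_trans t4)//; lra.
have hw := ln_normc_taylor w14.
have n3 : 24 * normc (t / al) ^+ 3 <= 24 / rho ^+ 3 * normc t ^+ 3.
  rewrite nw expr_div_n -mulrA ler_pM2l// mulrC ler_wpM2r ?exprn_ge0 ?normc_ge0//.
  rewrite lef_pV2 ?posrE ?exprn_gt0 ?normc_gt0//.
  by rewrite lerXn2r ?nnegrE ?normc_ge0// ltW.
have r1 : Re ((c1 - al^-1) * t) = Re (c1 * t) - Re (t / al).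
  by rewrite mulrBl (mulrC al^-1) raddfB.
have r2 : Re ((c2 - (al ^+ 2)^-1 / 2) * t ^+ 2) = Re (c2 * t ^+ 2) - Re ((t / al) ^+ 2) / 2.
  rewrite mulrBl raddfB; congr (_ - _).
  have -> : (al ^+ 2)^-1 / 2 * t ^+ 2 = (2^-1 : R)%:C * (t / al) ^+ 2.
    by rewrite expr_div_n fmorphV rmorph_nat; field.
  by case: ((t / al) ^+ 2) => x y /=; rewrite mul0r subr0 mulrC.
have := h t t4; rewrite r1 r2 wE -[(size (al :: rs))%:R]/((size rs).+1%:R) -natr1.
have {}hw := le_trans hw n3.
move: hw; rewrite !ler_norml => /andP[? ?] /andP[? ?].
by apply/andP; split; lra.
Qed.

(** The quadratic part is the real part of [c2 * t ^+ 2], which changes sign when [t] is multiplied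
    by ['i]; this cancellation is the harmonic clause. *)
Lemma taylor_finite_diff (v : C * C -> R) w b (rho K : R) : 0 < rho -> 0 <= K ->
  (exists c1 c2 : C, forall t, normc t <= rho ->
    `|v (w + t *: b) - v w - Re (c1 * t) - Re (c2 * t ^+ 2)| <= K * normc t ^+ 3) ->
  finite_diff v w b rho (2 * K).
Proof.
move=> rho0 K0 [c1 [c2 h]].
have ReN (x : C) : Re (- x) = - Re x by case: x.
have hs (s : R) : 0 < s -> s <= rho ->
   `|v (w + s%:C *: b) - v w - s * Re c1 - s ^+ 2 * Re c2| <= K * s ^+ 3 /\
   `|v (w - s%:C *: b) - v w + s * Re c1 - s ^+ 2 * Re c2| <= K * s ^+ 3.
  move=> s0 sr; have n1 : normc s%:C <= rho by rewrite normc_real gtr0_norm.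
  have n2 : normc (- s%:C) <= rho by rewrite normc_opp.
  have e1 : Re (c1 * s%:C) = s * Re c1 by case: (c1) => x y /=; ring.
  have e2 : Re (c2 * s%:C ^+ 2) = s ^+ 2 * Re c2 by case: (c2) => x y /=; ring.
  have := h _ n1; have := h _ n2.
  rewrite sqrrN e2 mulrN ReN e1 opprK normc_opp normc_real (gtr0_norm s0) scaleNr.
  by move=> h2 h1; split.
have hi (s : R) : 0 < s -> s <= rho ->
   `|v (w + s%:C *: ('i *: b)) + v (w - s%:C *: ('i *: b)) - 2 * v w + 2 * s ^+ 2 * Re c2|
      <= 2 * K * s ^+ 3.
  move=> s0 sr.
  have ni : normc (s%:C * 'i) = s.
    by rewrite Normc.normcM normc_real gtr0_norm//= expr0n expr1n add0r sqrtr1 mulr1.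
  have n1 : normc (s%:C * 'i) <= rho by rewrite ni.
  have n2 : normc (- (s%:C * 'i)) <= rho by rewrite normc_opp ni.
  have e2 : Re (c2 * (s%:C * 'i) ^+ 2) = - (s ^+ 2 * Re c2) by case: (c2) => x y /=; ring.
  have := h _ n1; have := h _ n2.
  rewrite sqrrN e2 mulrN ReN normc_opp ni !opprK scaleNr !scalerA.
  rewrite !ler_norml => /andP[? ?] /andP[? ?].
  by apply/andP; split; lra.
have odd s : 0 < s -> s <= rho -> `|odd_quot v w b s - Re c1| <= K * s ^+ 2.
  move=> s0 sr; have [h1 h2] := hs s s0 sr.
  have -> : odd_quot v w b s - Re c1 = (2 * s)^-1 *
     ((v (w + s%:C *: b) - v w - s * Re c1 - s ^+ 2 * Re c2) -
      (v (w - s%:C *: b) - v w + s * Re c1 - s ^+ 2 * Re c2)).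
    by rewrite /odd_quot; field; rewrite gt_eqF.
  rewrite normrM gtr0_norm ?invr_gt0 ?mulr_gt0// mulrC ler_pdivrMr ?mulr_gt0//.
  apply: (le_trans (ler_normB _ _)); apply: (le_trans (lerD h1 h2)).
  by rewrite le_eqVlt; apply/orP; left; apply/eqP; ring.
have even s : 0 < s -> s <= rho -> `|even_quot v w b s - Re c2| <= K * s.
  move=> s0 sr; have [h1 h2] := hs s s0 sr.
  have -> : even_quot v w b s - Re c2 = (2 * s ^+ 2)^-1 *
     ((v (w + s%:C *: b) - v w - s * Re c1 - s ^+ 2 * Re c2) +
      (v (w - s%:C *: b) - v w + s * Re c1 - s ^+ 2 * Re c2)).
    by rewrite /even_quot; field; rewrite gt_eqF.
  have s2 : 0 < 2 * s ^+ 2 by rewrite mulr_gt0// exprn_gt0.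
  rewrite normrM gtr0_norm ?invr_gt0// mulrC ler_pdivrMr//.
  apply: (le_trans (ler_normD _ _)); apply: (le_trans (lerD h1 h2)).
  by rewrite le_eqVlt; apply/orP; left; apply/eqP; ring.
split.
- move=> s s' s'0 ss sr; have := odd s (lt_le_trans s'0 ss) sr.
  have := odd s' s'0 (le_trans ss sr).
  have : K * s' ^+ 2 <= K * s ^+ 2.
    by rewrite ler_wpM2l// lerXn2r ?nnegrE ?(ltW s'0)// (le_trans (ltW s'0)).
  move=> ?; rewrite !ler_norml => /andP[? ?] /andP[? ?].
  by apply/andP; split; lra.
- move=> s s' s'0 ss sr; have := even s (lt_le_trans s'0 ss) sr.
  have := even s' s'0 (le_trans ss sr).
  have : K * s' <= K * s by rewrite ler_wpM2l.
  move=> ?; rewrite !ler_norml => /andP[? ?] /andP[? ?].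
  by apply/andP; split; lra.
- move=> s s0 sr; have := even s s0 sr; have := hi s s0 sr.
  have s2 : 0 < 2 * s ^+ 2 by rewrite mulr_gt0// exprn_gt0.
  have -> : v (w + s%:C *: ('i *: b)) + v (w - s%:C *: ('i *: b)) - 2 * v w +
    2 * s ^+ 2 * Re c2 = (2 * s ^+ 2) * (even_quot v w ('i *: b) s + Re c2).
    by rewrite /even_quot; field; rewrite gt_eqF.
  rewrite normrM (gtr0_norm s2).
  have -> : 2 * K * s ^+ 3 = 2 * s ^+ 2 * (K * s) by ring.
  rewrite ler_pM2l//.
  rewrite !ler_norml => /andP[? ?] /andP[? ?].
  by apply/andP; split; lra.
Qed.

Lemma finite_diff_cvg (v : nat -> C * C -> R) (u : C * C -> R) w b (rho K : R) :
  (forall t : C, normc t <= rho -> (fun n => v n (w + t *: b)) @ \oo --> u (w + t *: b)) ->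
  (\forall n \near \oo, finite_diff (v n) w b rho K) ->
  finite_diff u w b rho K.
Proof.
move=> hv hn.
have cp s : 0 < s -> s <= rho -> (fun n => v n (w + s%:C *: b)) @ \oo --> u (w + s%:C *: b).
  by move=> s0 sr; apply: hv; rewrite normc_real gtr0_norm.
have cm s : 0 < s -> s <= rho -> (fun n => v n (w - s%:C *: b)) @ \oo --> u (w - s%:C *: b).
  by move=> s0 sr; rewrite -scaleNr; apply: hv; rewrite normc_opp normc_real gtr0_norm.
have c0 (s : R) : 0 < s -> s <= rho -> (fun n => v n w) @ \oo --> u w.
  move=> s0 sr; have := hv 0; rewrite scale0r addr0; apply.
  by rewrite Normc.normc0 (le_trans (ltW s0)).
have ni (s : R) : 0 < s -> normc (s%:C * 'i) = s.
  by move=> s0; rewrite Normc.normcM normc_real gtr0_norm//= expr0n expr1n add0r sqrtr1 mulr1.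
have ip s : 0 < s -> s <= rho ->
    (fun n => v n (w + s%:C *: ('i *: b))) @ \oo --> u (w + s%:C *: ('i *: b)).
  by move=> s0 sr; rewrite scalerA; apply: hv; rewrite ni.
have im s : 0 < s -> s <= rho ->
    (fun n => v n (w - s%:C *: ('i *: b))) @ \oo --> u (w - s%:C *: ('i *: b)).
  by move=> s0 sr; rewrite scalerA -scaleNr; apply: hv; rewrite normc_opp ni.
have co s : 0 < s -> s <= rho -> (fun n => odd_quot (v n) w b s) @ \oo --> odd_quot u w b s.
  move=> s0 sr; apply: cvgM; last exact: cvg_cst.
  by apply: cvgB; [exact: cp|exact: cm].
have ce s : 0 < s -> s <= rho -> (fun n => even_quot (v n) w b s) @ \oo --> even_quot u w b s.
  move=> s0 sr; apply: cvgM; last exact: cvg_cst.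
  apply: cvgB; first by apply: cvgD; [exact: cp|exact: cm].
  by apply: cvgM; [exact: cvg_cst|exact: (c0 s)].
have ci s : 0 < s -> s <= rho ->
    (fun n => even_quot (v n) w ('i *: b) s) @ \oo --> even_quot u w ('i *: b) s.
  move=> s0 sr; apply: cvgM; last exact: cvg_cst.
  apply: cvgB; first by apply: cvgD; [exact: ip|exact: im].
  by apply: cvgM; [exact: cvg_cst|exact: (c0 s)].
split.
- move=> s s' s'0 ss sr.
  have h : (fun n => `|odd_quot (v n) w b s - odd_quot (v n) w b s'|) @ \oo -->
    `|odd_quot u w b s - odd_quot u w b s'|.
    apply: cvg_norm; apply: cvgB; first exact: co (lt_le_trans s'0 ss) sr.
    exact: co s'0 (le_trans ss sr).
  by apply: (cvgr_to_le h); apply: filterS hn => n [h1 _ _]; exact: h1.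
- move=> s s' s'0 ss sr.
  have h : (fun n => `|even_quot (v n) w b s - even_quot (v n) w b s'|) @ \oo -->
    `|even_quot u w b s - even_quot u w b s'|.
    apply: cvg_norm; apply: cvgB; first exact: ce (lt_le_trans s'0 ss) sr.
    exact: ce s'0 (le_trans ss sr).
  by apply: (cvgr_to_le h); apply: filterS hn => n [_ h1 _]; exact: h1.
- move=> s s0 sr.
  have h : (fun n => `|even_quot (v n) w b s + even_quot (v n) w ('i *: b) s|) @ \oo -->
    `|even_quot u w b s + even_quot u w ('i *: b) s|.
    by apply: cvg_norm; apply: cvgD; [exact: ce|exact: ci].
  by apply: (cvgr_to_le h); apply: filterS hn => n [_ _ h1]; exact: h1.
Qed.

Lemma finite_diff_average d {T : measurableType d} (P : probability T R) (D : set T)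
    (g : T -> C * C -> R) w b (rho K : R) :
  measurable D -> P D = 1%E -> (forall z, measurable_fun D (g^~ z)) ->
  (forall z, exists B, forall x, D x -> `|g x z| <= B) ->
  (forall x, D x -> finite_diff (g x) w b rho K) ->
  finite_diff (average P D g) w b rho K.
Proof.
move=> mD PD mg gB hD.
have key (l : seq (R * (C * C))) (f : (C * C -> R) -> R) B :
    (forall u, \sum_(q <- l) q.1 * u q.2 = f u) ->
    (forall x, D x -> `|f (g x)| <= B) -> `|f (average P D g)| <= B.
  by move=> fE hf; rewrite -fE; apply: average_lincomb => // x Dx; rewrite fE hf.
(* The quotients as weighted lists of points, the form that [average_lincomb] accepts; [e] is the
   sign with which a quotient enters. *)
pose lo (e s : R) (b' : C * C) :=
  [:: (e / (2 * s), w + s%:C *: b'); (- (e / (2 * s)), w - s%:C *: b')].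
pose le (e s : R) (b' : C * C) := [:: (e / (2 * s ^+ 2), w + s%:C *: b');
  (e / (2 * s ^+ 2), w - s%:C *: b'); (- (e / s ^+ 2), w)].
have loE u e s : \sum_(q <- lo e s b) q.1 * u q.2 = e * odd_quot u w b s.
  by rewrite /lo !big_cons big_nil /odd_quot /= addr0; ring.
have leE u e s b' : 0 < s -> \sum_(q <- le e s b') q.1 * u q.2 = e * even_quot u w b' s.
  move=> s0; rewrite /le !big_cons big_nil /even_quot /= addr0; field.
  by rewrite gt_eqF.
split.
- move=> s s' s'0 ss sr.
  apply: (key (lo 1 s b ++ lo (-1) s' b)
    (fun u => odd_quot u w b s - odd_quot u w b s')) => [u|x Dx].
    by rewrite big_cat /= !loE mul1r mulN1r.
  exact: finite_diff_odd (hD x Dx) _ _ s'0 ss sr.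
- move=> s s' s'0 ss sr; have s0 := lt_le_trans s'0 ss.
  apply: (key (le 1 s b ++ le (-1) s' b)
    (fun u => even_quot u w b s - even_quot u w b s')) => [u|x Dx].
    by rewrite big_cat /= !leE// mul1r mulN1r.
  exact: finite_diff_even (hD x Dx) _ _ s'0 ss sr.
- move=> s s0 sr.
  apply: (key (le 1 s b ++ le 1 s ('i *: b))
    (fun u => even_quot u w b s + even_quot u w ('i *: b) s)) => [u|x Dx].
    by rewrite big_cat /= !leE// !mul1r.
  exact: finite_diff_harmonic (hD x Dx) _ s0 sr.
Qed.

End LogPolynomial.

(** * Mean value inequality on circles *)

Section CircleMean.
Context {R : realType}.
Local Notation C := R[i].

(** By the fundamental theorem and the mean value theorem, the integral over each step is [h] times
    a value of [f], which uniform continuity compares with the value at the node. *)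
Lemma riemann_sum_lower (f : R -> R) (c l : R) : 0 < l ->
  (forall e, 0 < e -> exists2 dl, 0 < dl &
     forall x y, `|x - y| <= dl -> `|f x - f y| <= e) ->
  (forall e, 0 < e -> \forall N \near \oo,
     c - e <= N%:R^-1 * \sum_(j < N) f (j%:R * (l / N%:R))) ->
  c * l <= \int[lebesgue_measure]_(x in `[0, l]) f x.
Proof.
move=> l0 uf hf.
have cf : continuous f.
  move=> x; apply/cvgrPdist_le => /= e e0; have [dl dl0 h] := uf e e0.
  near=> y; apply: h; near: y; exact: cvgr_dist_le.
have intf (a b : R) : lebesgue_measure.-integrable `[a, b] (EFin \o f).
  apply: continuous_compact_integrable; first exact: segment_compact.
  exact: continuous_subspaceT.
(* The primitive starts at -1 so that it is differentiable at the end point 0 as well. *)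
pose F (x : R) := \int[lebesgue_measure]_(t in `[-1, x]) f t.
have dF (x : R) : -1 < x -> is_derive x 1 F (f x).
  move=> x1; have xx : x < x + 1 by rewrite ltrDl.
  have [d1 d2] := continuous_FTC1_closed xx (intf (-1) (x + 1)) x1 (cf x).
  by have := derivableP d1; rewrite -derive1E d2.
have intE : \int[lebesgue_measure]_(x in `[0, l]) f x = F l - F 0.
  rewrite /F Rintegral_itvB//; first last.
  - by rewrite bnd_simp ltW.
  - by rewrite bnd_simp; lra.
  rewrite -Rintegral_itv_obnd_cbnd//.
  by apply: integrableS (intf 0 l) => //; exact: subset_itv_oc_cc.
rewrite intE; apply/ler_addgt0Pr => e e0; pose e' := e / (2 * l).
have e'0 : 0 < e' by rewrite divr_gt0// mulr_gt0.
have [dl dl0 hdl] := uf e' e'0.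
near \oo => N.
have N0 : (0 < N)%N by near: N; exact: nbhs_infty_gt.
have NR : 0 < N%:R :> R by rewrite ltr0n.
have Nl : l / N%:R <= dl.
  rewrite ler_pdivrMr// mulrC -ler_pdivrMr//.
  by near: N; exact: nbhs_infty_ger.
have hN : c - e' <= N%:R^-1 * \sum_(j < N) f (j%:R * (l / N%:R)).
  by near: N; exact: hf.
pose h := l / N%:R; pose x j : R := j%:R * h.
have h0 : 0 < h by rewrite divr_gt0.
have hdl' : h <= dl by exact: Nl.
have step j : (f (x j) - e') * h <= F (x j.+1) - F (x j).
  have xj : x j.+1 - x j = h by rewrite /x -natr1; ring.
  have x0 : 0 <= x j by rewrite mulr_ge0// ltW.
  have xjl : x j <= x j.+1 by lra.
  have [||t] := @MVT_segment R F f (x j) (x j.+1) xjl.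
  - by move=> y; rewrite in_itv /= => /andP[y0 _]; apply: dF; lra.
  - apply: derivable_within_continuous => y; rewrite in_itv /= => /andP[y0 _].
    by have [] : is_derive y 1 F (f y) by apply: dF; lra.
  rewrite in_itv /= xj => /andP[t1 t2] ->; rewrite ler_pM2r//.
  have : `|f (x j) - f t| <= e' by apply: hdl; rewrite distrC ger0_norm; lra.
  by rewrite ler_norml => /andP[_ ?]; lra.
have -> : F l - F 0 = \sum_(0 <= j < N) (F (x j.+1) - F (x j)).
  by rewrite telescope_sumr// /x mul0r /h mulrC divfK// gt_eqF.
rewrite big_mkord.
have : \sum_(j < N) (f (x j) - e') * h <= \sum_(j < N) (F (x j.+1) - F (x j)).
  by apply: ler_sum => j _; exact: step.
rewrite -mulr_suml sumrB sumr_const card_ord -(mulr_natr e' N) => h1.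
have hNh : N%:R * h = l by rewrite /h mulrC divfK// gt_eqF.
have h2 : (c - e') * l <= h * \sum_(j < N) f (x j).
  rewrite mulrC ler_pdivlMr// in hN.
  by have := ler_wpM2r (ltW h0) hN; rewrite -mulrA hNh [leRHS]mulrC.
have el : e' * l = e / 2 by rewrite /e'; field; rewrite gt_eqF.
have -> : e = 2 * (e' * l) by rewrite el; field.
have : (\sum_(j < N) f (x j) - e' * N%:R) * h = h * \sum_(j < N) f (x j) - e' * l.
  by rewrite -hNh; ring.
lra.
Unshelve. all: by end_near.
Qed.

Lemma cos_lipschitz (x y : R) : `|cos x - cos y| <= `|x - y|.
Proof.
wlog xy : x y / x <= y.
  move=> H; have [/H//|/ltW/H] := leP x y.
  by rewrite distrC (distrC y).
have [|t _] := @MVT_segment R cos (fun t => - sin t) x y xy (fun t _ => is_derive_cos t).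
  by apply: continuous_subspaceT => t; exact: continuous_cos.
rewrite (distrC (cos x)) (distrC x) => ->; rewrite normrM normrN ler_piMl//.
by rewrite ler_norml sin_geN1 sin_le1.
Qed.

Lemma sin_lipschitz (x y : R) : `|sin x - sin y| <= `|x - y|.
Proof.
wlog xy : x y / x <= y.
  move=> H; have [/H//|/ltW/H] := leP x y.
  by rewrite distrC (distrC y).
have [|t _] := @MVT_segment R sin cos x y xy (fun t _ => is_derive_sin t).
  by apply: continuous_subspaceT => t; exact: continuous_sin.
rewrite (distrC (sin x)) (distrC x) => ->; rewrite normrM ler_piMl//.
by rewrite ler_norml cos_geN1 cos_le1.
Qed.

Lemma continuous_upper_semicontinuous (T : topologicalType) (v : T -> R) :
  continuous v -> upper_semicontinuous (fun x => (v x)%:E).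
Proof.
move=> cv x a; rewrite -EFinN lte_fin => av.
exists [set y | v y < - a].
  by apply: (cvgr_lt (v x) (cv x)); rewrite ltrNr.
by move=> y /= ya; rewrite lte_fin ltrNr.
Qed.

Lemma subharmonic_of_means (v : C -> R) : continuous v ->
  (forall rho e, 0 < e -> exists2 dl, 0 < dl & forall t u, normc t <= rho ->
     normc u <= rho -> normc (t - u) <= dl -> `|v t - v u| <= e) ->
  (forall (c : C) (r e : R), 0 < r -> 0 < e -> \forall N \near \oo,
     v c - e <= N%:R^-1 * \sum_(j < N) v (c + r%:C * omega N ^+ j)) ->
  subharmonic (fun t => (v t)%:E).
Proof.
move=> cv uv hv; split.
- by move=> t; rewrite ltry.
- exact: continuous_upper_semicontinuous.
move=> c r r0; pose f th := v (circle c r th).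
have pi2 : 0 < 2 * pi :> R by rewrite mulr_gt0// pi_gt0.
have circleE th : circle c r th = c + r%:C * cis th by [].
have ncircle th : normc (circle c r th) <= normc c + r.
  rewrite circleE (le_trans (ler_normcD _ _))// lerD2l Normc.normcM normc_cis.
  by rewrite mulr1 normc_real gtr0_norm.
have uf e : 0 < e -> exists2 dl, 0 < dl &
     forall x y, `|x - y| <= dl -> `|f x - f y| <= e.
  move=> e0; have [dl dl0 h] := uv (normc c + r) e e0.
  exists (dl / (2 * r)); first by rewrite divr_gt0// mulr_gt0.
  move=> x y xy; apply: h; rewrite ?ncircle//.
  rewrite !circleE opprD addrACA subrr add0r -mulrBr Normc.normcM normc_real gtr0_norm//.
  rewrite ler_pdivlMr ?mulr_gt0// in xy.
  have : normc (cis x - cis y) <= 2 * `|x - y|.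
    apply: (le_trans (normc_le_ReIm _)) => /=.
    by have := cos_lipschitz x y; have := sin_lipschitz x y; lra.
  by move=> h1; apply: le_trans xy; nra.
have cf : continuous f.
  move=> x; apply/cvgrPdist_le => /= e e0; have [dl dl0 h] := uf e e0.
  near=> y; apply: h; near: y; exact: cvgr_dist_le.
have intf : lebesgue_measure.-integrable `[0, 2 * pi] (EFin \o f).
  apply: continuous_compact_integrable; first exact: segment_compact.
  exact: continuous_subspaceT.
have fin : (\int[lebesgue_measure]_(th in `[0%R, (2 * pi)%R : R]) (f th)%:E)%E \is a fin_num.
  exact: integrable_fin_num.
rewrite -[X in (_ <= _ * X)%E]/(
  \int[lebesgue_measure]_(th in `[0%R, (2 * pi)%R : R]) (f th)%:E)%E.
rewrite -(fineK fin) -EFinM lee_fin mulrC ler_pdivlMr//.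
apply: riemann_sum_lower => // e e0.
apply: filterS (hv c r e r0 e0) => N; rewrite /f.
(* [omega N ^+ j] is [cis] at the Riemann node [j%:R * (2 * pi / N%:R)]. *)
by under eq_bigr do rewrite -cisX.
Unshelve. all: by end_near.
Qed.

End CircleMean.

(** * Dependence on the parameters *)

Section RingOfFunctions.
Context {R : realType} {X : Type}.
Local Notation C := R[i].

(* Applied to measurable functions of the parameter sequence and to functions
   of one parameter that are continuous within [M]. *)
Record function_ring (D : set X) (Fn : (X -> C) -> Prop) : Prop := FunctionRing {
  function_ring_ext : forall f g, (forall x, D x -> f x = g x) -> Fn f -> Fn g;
  function_ring_cst : forall c, Fn (fun _ => c);
  function_ring_add : forall f g, Fn f -> Fn g -> Fn (fun x => f x + g x);
  function_ring_mul : forall f g, Fn f -> Fn g -> Fn (fun x => f x * g x)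
}.

Variables (D : set X) (Fn : (X -> C) -> Prop).
Hypothesis ring_Fn : function_ring D Fn.

Let Fn_add := function_ring_add ring_Fn.
Let Fn_mul := function_ring_mul ring_Fn.

Lemma function_ring_sub f g : Fn f -> Fn g -> Fn (fun x => f x - g x).
Proof.
move=> hf hg; apply: (function_ring_ext ring_Fn (f := fun x => f x + (-1) * g x)).
  by move=> x _; rewrite mulN1r.
apply: Fn_add => //; apply: Fn_mul => //; exact: function_ring_cst ring_Fn _.
Qed.

Lemma function_ring_exp f n : Fn f -> Fn (fun x => f x ^+ n).
Proof.
move=> hf; elim: n => [|n IH].
  apply: (function_ring_ext ring_Fn (f := fun _ => 1)) => //.
  exact: function_ring_cst ring_Fn _.
apply: (function_ring_ext ring_Fn (f := fun x => f x * f x ^+ n)).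
  by move=> x _; rewrite exprS.
exact: Fn_mul.
Qed.

Lemma function_ring_sum n (f : nat -> X -> C) : (forall i, Fn (f i)) ->
  Fn (fun x => \sum_(i < n) f i x).
Proof.
move=> hf; elim: n => [|n IH].
  apply: (function_ring_ext ring_Fn (f := fun _ => 0)).
    by move=> x _; rewrite big_ord0.
  exact: function_ring_cst ring_Fn _.
apply: (function_ring_ext ring_Fn (f := fun x => \sum_(i < n) f i x + f n x)).
  by move=> x _; rewrite big_ord_recr.
exact: Fn_add.
Qed.

Lemma function_ring_horner (q : X -> {poly C}) (y : X -> C) n :
  (forall x, D x -> (size (q x) <= n)%N) -> (forall i, Fn (fun x => (q x)`_i)) ->
  Fn y -> Fn (fun x => (q x).[y x]).
Proof.
move=> sq hq hy.
apply: (function_ring_ext ring_Fn (f := fun x => \sum_(i < n) (q x)`_i * y x ^+ i)).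
  by move=> x Dx; rewrite (horner_coef_wide _ (sq x Dx)).
apply: (@function_ring_sum n (fun i x => (q x)`_i * y x ^+ i)) => i.
by apply: Fn_mul => //; exact: function_ring_exp.
Qed.

Lemma function_ring_foldl (I : eqType) (fwd : bool) (r : seq I) (d : I -> nat)
    (q : I -> X -> {poly C}) (b : I -> X -> C) (z : X -> C * C) :
  (forall j x, D x -> (size (q j x) <= d j)%N) ->
  (forall j i, Fn (fun x => (q j x)`_i)) -> (forall j, Fn (b j)) ->
  Fn (fun x => (z x).1) -> Fn (fun x => (z x).2) ->
  Fn (fun x => (foldl (fun w j => henon_factor fwd (q j x) (b j x) w) (z x) r).1) /\
  Fn (fun x => (foldl (fun w j => henon_factor fwd (q j x) (b j x) w) (z x) r).2).
Proof.
move=> sq hq hb; elim: r z => [z z1 z2 //|j r IH z z1 z2] /=.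
apply: (IH (fun x => henon_factor fwd (q j x) (b j x) (z x))); rewrite /henon_factor.
  case: fwd IH => _ //=.
  apply: function_ring_sub; last exact: Fn_mul.
  exact: function_ring_horner (sq j) (hq j) z1.
case: fwd IH => _ //=.
apply: function_ring_sub; last exact: Fn_mul.
exact: function_ring_horner (sq j) (hq j) z2.
Qed.

End RingOfFunctions.

Section ParameterContinuity.
Context {R : realType} {k : nat}.
Local Notation C := R[i].
Local Notation param := 'rV[C]_k.
Variable M : set param.

Lemma continuous_normc : continuous (fun x : C => normc x).
Proof.
move=> x A /nbhs_ballP[e /= e0 eA]; apply/(nbhs_normcP x); exists e => // y yx.
by apply: eA; apply: le_lt_trans (ler_dist_normc _ _) _; rewrite normc_distC.
Qed.

Lemma within_continuous_normcP (f : param -> C) : {within M, continuous f} <->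
  forall l, M l -> forall e : R, 0 < e ->
    \forall l' \near l, M l' -> normc (f l' - f l) < e.
Proof.
rewrite subspace_continuousP; split=> h l Ml.
  move=> e e0; have := h l Ml [set y | normc (y - f l) < e].
  by apply; apply/nbhs_normcP; exists e.
move=> A /nbhs_normcP[e e0 eA]; have := h l Ml e e0.
by apply: filterS => l' hl' Ml'; apply: eA; exact: hl'.
Qed.

Lemma within_continuous_ring :
  function_ring M (fun f : param -> C => {within M, continuous f}).
Proof.
split.
- move=> f g fg /within_continuous_normcP h; apply/within_continuous_normcP.
  move=> l Ml e e0; have := h l Ml e e0; apply: filterS => l' hl' Ml'.
  by rewrite -!fg// hl'.
- move=> c; apply/within_continuous_normcP => l _ e e0.
  have : nbhs l setT by exact: filterT.
  by apply: filterS => l' _ _; rewrite subrr Normc.normc0.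
- move=> f g /subspace_continuousP cf /subspace_continuousP cg.
  apply/subspace_continuousP => x Mx; apply: cvgD; [exact: cf|exact: cg].
- move=> f g /subspace_continuousP cf /subspace_continuousP cg.
  apply/subspace_continuousP => x Mx; apply: cvgM; [exact: cf|exact: cg].
Qed.

Lemma within_continuous_inv (f : param -> C) : (forall l, M l -> f l != 0) ->
  {within M, continuous f} -> {within M, continuous (fun l => (f l)^-1)}.
Proof.
move=> f0 /subspace_continuousP cf; apply/subspace_continuousP => x Mx.
by apply: cvgV; [exact: f0|exact: cf].
Qed.

Hypothesis cM : compact M.

Lemma within_continuous_bounded (f : param -> C) : {within M, continuous f} ->
  exists2 B : R, 1 <= B & forall l, M l -> normc (f l) <= B.
Proof.
move=> cf; have cn : {within M, continuous (fun l => normc (f l))}.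
  apply/subspace_continuousP => l Ml; move/subspace_continuousP: cf => cf.
  by apply: cvg_comp (cf l Ml) _; exact: continuous_normc.
have [B [_ hB]] := compact_bounded (continuous_compact cn cM).
exists (Num.max 1 (B + 1)); first by rewrite le_max lexx.
move=> l Ml; have hl : B < B + 1 by rewrite ltrDl.
have := hB _ hl (normc (f l)); rewrite /= ger0_norm ?normc_ge0// => h.
by rewrite le_max h ?orbT//; exists l.
Qed.

Lemma within_continuous_bounded_seq (f : nat -> param -> C) n :
  (forall i, {within M, continuous (f i)}) ->
  exists2 B : R, 1 <= B & forall i l, (i < n)%N -> M l -> normc (f i l) <= B.
Proof.
move=> cf; elim: n => [|n [B B1 hB]]; first by exists 1.
have [B' B'1 hB'] := within_continuous_bounded (cf n).
exists (Num.max B B'); first by rewrite le_max B1.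
move=> i l; rewrite ltnS leq_eqVlt => /orP[/eqP ->|il] Ml; rewrite le_max.
  by rewrite hB' ?orbT.
by rewrite hB.
Qed.

Lemma compact_borel : <<s open >> M.
Proof.
have hM : hausdorff_space param.
  move=> p q pq; apply/matrixP => i j.
  apply: (@norm_hausdorff _ (C : numFieldType)^o) => A B nA nB.
  have hA : nbhs p [set v : param | A (v i j)].
    exact: (@coord_continuous (C : numFieldType) 1 k i j p A).
  have hB : nbhs q [set v : param | B (v i j)].
    exact: (@coord_continuous (C : numFieldType) 1 k i j q B).
  by have [v [/= vA vB]] := pq _ _ hA hB; exists (v i j).
have := compact_closed hM cM; rewrite -openC => oM.
rewrite -[M]setCK -setTD; apply: sigma_algebraCD.
exact: sub_sigma_algebra.
Qed.

End ParameterContinuity.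

(** * Uniform estimates for the given family and its inverses *)

Section HenonFamily.
Context {R : realType} {k : nat}.
Local Notation C := R[i].
Local Notation param := 'rV[C]_k.
Variables (M : set param) (s : nat) (d : 'I_s -> nat)
  (p : 'I_s -> param -> {poly C}) (a : 'I_s -> param -> C) (fwd : bool).
Hypotheses (M_compact : compact M) (s_gt0 : (0 < s)%N)
  (d_ge2 : forall j, (2 <= d j)%N)
  (p_monic : forall j l, M l -> p j l \is monic)
  (p_degree : forall j l, M l -> size (p j l) = (d j).+1)
  (p_continuous : forall j i, {within M, continuous (fun l => (p j l)`_i)})
  (a_continuous : forall j, {within M, continuous (a j)})
  (a_neq0 : forall j l, M l -> a j l != 0).

Let H := henon_pm p a fwd.
Let deg := (\prod_(j < s) d j)%N.

(** The inverse factor [((p x - y) / a, x)] is [henon_factor] for [p / a] and [1 / a]; it is no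
    longer monic, which is why only a lower bound on the leading coefficient is required above. *)
Definition factor_poly j l : {poly C} :=
  if fwd then p j l else (a j l)^-1 *: p j l.
Definition factor_coef j l : C := if fwd then a j l else (a j l)^-1.
Definition factor_order : seq 'I_s := if fwd then enum 'I_s else rev (enum 'I_s).

Lemma henon_pm_foldl l z : H l z =
  foldl (fun w j => henon_factor fwd (factor_poly j l) (factor_coef j l) w) z
    factor_order.
Proof.
rewrite /H /henon_pm /factor_order /factor_poly /factor_coef /henon_factor.
case: fwd; first by [].
rewrite foldl_rev /henon_inv; elim: (enum 'I_s) => //= j r ->.
by rewrite /henon1_inv hornerZ mulrC mulrBr.
Qed.

Lemma factor_coef_continuous j : {within M, continuous (factor_coef j)}.
Proof.
rewrite /factor_coef; case: fwd => //.
by apply: within_continuous_inv => // l; exact: a_neq0.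
Qed.

Lemma factor_poly_continuous j i : {within M, continuous (fun l => (factor_poly j l)`_i)}.
Proof.
have rM := @within_continuous_ring R k M.
rewrite /factor_poly; case: fwd => //.
apply: (function_ring_ext rM (f := fun l => (a j l)^-1 * (p j l)`_i)).
  by move=> l _; rewrite coefZ.
apply: (function_ring_mul rM) => //.
by apply: within_continuous_inv => // l; exact: a_neq0.
Qed.

Lemma size_factor_poly j l : M l -> size (factor_poly j l) = (d j).+1.
Proof.
move=> Ml; rewrite /factor_poly; case: fwd; first exact: p_degree.
by rewrite size_scale ?p_degree// invr_eq0 a_neq0.
Qed.

(** For inverses the leading coefficient is [1 / a], bounded away from 0 because [a] is bounded on
    the compact set [M]. *)
Lemma factor_lead j : exists2 A : R, 1 <= A &
  forall l, M l -> A^-1 <= normc (factor_poly j l)`_(d j).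
Proof.
have [A A1 hA] := within_continuous_bounded M_compact (@a_continuous j).
have A0 : 0 < A by exact: lt_le_trans A1.
exists A => // l Ml.
have pd : (p j l)`_(d j) = 1.
  by have /monicP := p_monic j Ml; rewrite lead_coefE p_degree.
rewrite /factor_poly; case: fwd; first by rewrite pd Normc.normc1 invf_le1.
rewrite coefZ pd mulr1 Normc.normcV lef_pV2 ?posrE ?normc_gt0 ?a_neq0//.
exact: hA.
Qed.

Lemma factor_henon_like j : exists c K r0, [/\ 0 < c, c <= 1, 1 <= K, 1 <= r0 &
  forall r, r0 <= r -> forall l, M l ->
    henon_like fwd r c K (d j) (henon_factor fwd (factor_poly j l) (factor_coef j l))].
Proof.
have [A A1 hA] := factor_lead j; have A0 : 0 < A by exact: lt_le_trans A1.
have [B1 B11 hB1] := within_continuous_bounded M_compact (@factor_coef_continuous j).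
have [B2 B21 hB2] :=
  within_continuous_bounded_seq M_compact (d j).+1 (@factor_poly_continuous j).
pose B := Num.max B1 B2; have BB : 1 <= B by rewrite le_max B11.
have [e de] : exists e, d j = e.+2.
  by exists (d j).-2; case: (d j) (d_ge2 j) => [|[|e]].
have e3 : 1 <= e.+3%:R ^+ 2 + 1 :> R by rewrite lerDr sqr_ge0.
exists (A^-1 / 2), ((e.+3%:R ^+ 2 + 1) * B), (Num.max 1 (2 * e.+3%:R * B / A^-1)); split.
- by rewrite divr_gt0// invr_gt0.
- have : A^-1 <= 1 by rewrite invf_le1.
  have : 0 < A^-1 by rewrite invr_gt0.
  by lra.
- by rewrite mulr_ege1.
- by rewrite le_max lexx.
move=> r; rewrite ge_max => /andP[r1 rB] l Ml; rewrite de.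
apply: henon_like_factor => //.
- by rewrite invr_gt0.
- by rewrite size_factor_poly// de.
- move=> i; have [il|il] := ltnP i (d j).+1.
    by rewrite le_max (hB2 _ _ il Ml) orbT.
  rewrite nth_default ?size_factor_poly// Normc.normc0.
  exact: le_trans BB.
- by rewrite -de; exact: hA.
- by rewrite le_max hB1.
Qed.

Lemma henon_system_exists : exists r c K, henon_system fwd r c K deg H M.
Proof.
have d0 j : (0 < d j)%N by exact: ltnW.
have [c [K [r0 [c0 c1 K1 r01 h]]]] := @henon_like_foldl R fwd param 'I_s M d
  (fun j l => henon_factor fwd (factor_poly j l) (factor_coef j l))
  factor_order d0 factor_henon_like.
have degE : (\prod_(j <- factor_order) d j)%N = deg.
  rewrite /deg -big_enum /factor_order /=; case: fwd => //.
  by rewrite (perm_big (enum 'I_s))// perm_rev.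
(* The bound [2 / c] ensures [1 < r * c]. *)
exists (Num.max r0 (2 / c)), c, K; split=> //.
- rewrite /deg (bigD1 (Ordinal s_gt0))//= (leq_trans (d_ge2 (Ordinal s_gt0)))//.
  by rewrite leq_pmulr// prodn_gt0.
- by rewrite le_max r01.
- rewrite maxr_pMl ?(ltW c0)// lt_max divfK ?gt_eqF// ltr1n.
  by rewrite orbT.
move=> l Ml; rewrite -degE.
have <- : (fun z => foldl (fun w j =>
    henon_factor fwd (factor_poly j l) (factor_coef j l) w) z factor_order) = H l.
  by apply/funext => z; rewrite henon_pm_foldl.
by apply: h => //; rewrite le_max lexx.
Qed.

Lemma henon_function_ring (X : Type) (D : set X) (Fn : (X -> C) -> Prop)
    (lam : X -> param) (z : X -> C * C) :
  function_ring D Fn -> (forall x, D x -> M (lam x)) ->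
  (forall f : param -> C, {within M, continuous f} -> Fn (fun x => f (lam x))) ->
  Fn (fun x => (z x).1) -> Fn (fun x => (z x).2) ->
  Fn (fun x => (H (lam x) (z x)).1) /\ Fn (fun x => (H (lam x) (z x)).2).
Proof.
move=> rF DM cF z1 z2.
have [h1 h2] := @function_ring_foldl R X D Fn rF _ fwd factor_order (fun j => (d j).+1)
  (fun j x => factor_poly j (lam x)) (fun j x => factor_coef j (lam x)) z
  (fun j x Dx => eq_leq (size_factor_poly j (DM x Dx)))
  (fun j i => cF _ (@factor_poly_continuous j i))
  (fun j => cF _ (@factor_coef_continuous j)) z1 z2.
by split; [apply: (function_ring_ext rF _ h1)|apply: (function_ring_ext rF _ h2)];
  move=> x _; rewrite henon_pm_foldl.
Qed.

Lemma henon_parameter_continuous l z e : M l -> 0 < e ->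
  \forall l' \near l, M l' -> nrm (H l' z - H l z) < e.
Proof.
move=> Ml e0.
have [h1 h2] := henon_function_ring (lam := id) (z := fun _ => z)
  (@within_continuous_ring R k M) (fun x Mx => Mx) (fun f cf => cf)
  (function_ring_cst (@within_continuous_ring R k M) _)
  (function_ring_cst (@within_continuous_ring R k M) _).
have := (within_continuous_normcP _ _).1 h1 l Ml e e0.
have := (within_continuous_normcP _ _).1 h2 l Ml e e0.
apply: filterS2 => l' n2 n1 Ml'.
by rewrite nrm_lt; apply/andP; split; [exact: n1|exact: n2].
Qed.

(** In the last step, the change of parameter is handled at the fixed point [w] and the change of
    point by the Lipschitz bound. The [U i] with [i >= n] are neighbourhoods as well, because
    [cylinder_gt0] asks this of every index. *)
Lemma orbit_parameter_continuous n z L e : param_seqs M L -> 0 < e ->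
  exists U : nat -> set param,
    (forall i, open (U i) /\ U i (L i)) /\
    forall L', param_seqs M L' -> (forall i, (i < n)%N -> U i (L' i)) ->
      nrm (orbit_seq H L' n z - orbit_seq H L n z) < e.
Proof.
move=> ML; have [r [c [K sys]]] := henon_system_exists.
elim: n e => [|n IH] e e0.
  exists (fun _ => setT); split; first by move=> i; split=> //; exact: openT.
  by move=> L' _ _; rewrite /= subrr nrm0.
set w := orbit_seq H L n z in IH *.
(* A Lipschitz constant valid within distance 1 of [w], where [dl <= 1] keeps the perturbed orbit
   point. *)
pose A := K * (max1 w + 1) ^+ deg.-1 + 1.
have A1 : 1 <= A.
  rewrite /A lerDr mulr_ge0//; first exact: le_trans (henon_system_K1 sys).
  by rewrite exprn_ge0// addr_ge0// ltW// max1_gt0.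
have A0 : 0 < A by exact: lt_le_trans A1.
pose dl := Num.min 1 (e / (2 * A)).
have dl0 : 0 < dl by rewrite lt_min ltr01 divr_gt0// mulr_gt0.
have [U [hU1 hU2]] := IH dl dl0.
have e2 : 0 < e / 2 by rewrite divr_gt0.
have /nbhs_interior := henon_parameter_continuous w (ML n) e2.
rewrite nbhsE => -[V [oV VL] VS].
exists (fun i => if i == n then V else U i); split.
  by move=> i; case: eqP => [->|_]; [split|exact: hU1].
move=> L' ML' hL'.
have wL : nrm (orbit_seq H L' n z - w) < dl.
  apply: hU2 => // i il; have := hL' i (ltnW il).
  by rewrite ltn_eqF.
have VL' : V (L' n) by have := hL' n (ltnSn n); rewrite eqxx.
rewrite /=; set w' := orbit_seq H L' n z in wL *.
have -> : H (L' n) w' - H (L n) w = (H (L' n) w' - H (L' n) w) + (H (L' n) w - H (L n) w).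
  by rewrite addrA subrK.
apply: (le_lt_trans (nrmD _ _)).
have h2 : nrm (H (L' n) w - H (L n) w) < e / 2.
  by have := VS _ VL' => /interior_subset; apply; exact: ML'.
have h1 : nrm (H (L' n) w' - H (L' n) w) <= e / 2.
  apply: (le_trans (henon_like_lipschitz (henon_system_like sys (ML' n)) w' w)).
  have dl1 : dl <= 1 by rewrite ge_min lexx.
  have dle : dl <= e / (2 * A) by rewrite ge_min lexx orbT.
  have w1 : Num.max (max1 w') (max1 w) <= max1 w + 1.
    rewrite ge_max lerDl ler01 andbT ge_max; apply/andP; split.
      by have := max1_ge1 w; lra.
    have : nrm w' <= nrm (w' - w) + nrm w by rewrite -{1}(subrK w w') nrmD.
    by have := nrm_max1 w; have := ltW wL; lra.
  apply: (@le_trans _ _ (A * (e / (2 * A)))); last first.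
    by rewrite le_eqVlt; apply/orP; left; apply/eqP; field; rewrite gt_eqF.
  apply: ler_pM; rewrite ?nrm_ge0//.
  - rewrite mulr_ge0//; first exact: le_trans (henon_system_K1 sys).
    by rewrite exprn_ge0// le_max ltW// max1_gt0.
  - apply: (@le_trans _ _ (K * (max1 w + 1) ^+ deg.-1)); last by rewrite lerDl.
    rewrite ler_wpM2l//; first exact: le_trans (henon_system_K1 sys).
    have p1 : 0 <= Num.max (max1 w') (max1 w) by rewrite le_max ltW// max1_gt0.
    by rewrite lerXn2r// nnegrE (le_trans p1).
  - exact: le_trans (ltW wL) dle.
by lra.
Qed.

End HenonFamily.

(** * Product measure on parameter sequences *)

Section ProductMeasure.
Context {R : realType} {k : nat}.
Local Notation C := R[i].
Local Notation param := 'rV[C]_k.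
Local Notation Omega := (@seq_space R k).
Variable M : set param.
Hypothesis M_compact : compact M.

Let D : set Omega := param_seqs M.

Lemma coordinate_measurable n (A : set param) : <<s open >> A ->
  measurable ([set L | A (L n)] : set Omega).
Proof. by move=> mA; apply: sub_sigma_algebra; exists n, A. Qed.

Lemma open_borel (U : set param) : open U -> <<s open >> U.
Proof. exact: sub_sigma_algebra. Qed.

Lemma setT_borel : <<s open >> ([set: param]).
Proof. by apply: open_borel; exact: openT. Qed.

Lemma cylinder_measurable n (A : nat -> set param) : (forall i, <<s open >> (A i)) ->
  measurable ([set L | forall i, (i < n)%N -> A i (L i)] : set Omega).
Proof.
move=> mA; pose B i := if (i < n)%N then A i else setT.
have -> : ([set L | forall i, (i < n)%N -> A i (L i)] : set Omega) =
          \bigcap_i [set L : Omega | B i (L i)].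
  apply/seteqP; split=> [L hL i _|L hL i il] /=; rewrite /B.
    by case: ifP => // il; exact: hL.
  by have := hL i I; rewrite /= /B il.
apply: bigcap_measurable => // i _; apply: coordinate_measurable.
by rewrite /B; case: ifP => _; [exact: mA|exact: setT_borel].
Qed.

Lemma param_seqs_measurable : measurable D.
Proof.
have -> : D = \bigcap_i [set L : Omega | M (L i)].
  by apply/seteqP; split=> [L hL i _|L hL i] /=; [exact: hL|exact: (hL i I)].
apply: bigcap_measurable => // i _; apply: coordinate_measurable.
exact: compact_borel.
Qed.

Lemma measurable_coordinate_fun (f : param -> R) n : {within M, continuous f} ->
  measurable_fun D (fun L : Omega => f (L n)).
Proof.
move=> /continuousP cf; apply: (measurability _ (RGenOpens.measurableE R)).
move=> _ [_ [x [y ->] <-]].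
have /open_subspaceP[V oV VE] := cf _ (@interval_open R (BRight x) (BLeft y) isT isT).
have -> : D `&` (fun L : Omega => f (L n)) @^-1` `]x, y[%classic =
          D `&` [set L : Omega | V (L n)].
  apply/seteqP; split=> [L [DL hL]|L [DL hL]]; split=> //.
    have : (V `&` M) (L n) by rewrite VE; split=> //; exact: DL.
    by case.
  have : (f @^-1` `]x, y[%classic `&` M) (L n) by rewrite -VE; split=> //; exact: DL.
  by case.
apply: measurableI; first exact: param_seqs_measurable.
by apply: coordinate_measurable; exact: open_borel.
Qed.

Definition measurable_complex (f : Omega -> C) : Prop :=
  measurable_fun D (fun L => Re (f L)) /\ measurable_fun D (fun L => Im (f L)).

Lemma measurable_complex_ring : function_ring D measurable_complex.
Proof.
split.
- move=> f g fg [f1 f2]; split.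
    by apply: eq_measurable_fun f1 => L; rewrite inE => DL; rewrite fg.
  by apply: eq_measurable_fun f2 => L; rewrite inE => DL; rewrite fg.
- by move=> c; split; exact: measurable_cst.
- move=> f g [f1 f2] [g1 g2]; split.
    apply: (eq_measurable_fun (fun L => Re (f L) + Re (g L))).
      by move=> L _; case: (f L) (g L) => [? ?] [? ?].
    exact: measurable_funD.
  apply: (eq_measurable_fun (fun L => Im (f L) + Im (g L))).
    by move=> L _; case: (f L) (g L) => [? ?] [? ?].
  exact: measurable_funD.
- move=> f g [f1 f2] [g1 g2]; split.
    apply: (eq_measurable_fun (fun L => Re (f L) * Re (g L) - Im (f L) * Im (g L))).
      by move=> L _; case: (f L) (g L) => [? ?] [? ?].
    by apply: measurable_funB; exact: measurable_funM.
  apply: (eq_measurable_fun (fun L => Re (f L) * Im (g L) + Im (f L) * Re (g L))).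
    by move=> L _; case: (f L) (g L) => [? ?] [? ?].
  by apply: measurable_funD; exact: measurable_funM.
Qed.

Lemma measurable_complex_coordinate (f : param -> C) n : {within M, continuous f} ->
  measurable_complex (fun L => f (L n)).
Proof.
move=> /within_continuous_normcP cf.
have ReB (x y : C) : Re x - Re y = Re (x - y) by case: x y => [? ?] [? ?].
have ImB (x y : C) : Im x - Im y = Im (x - y) by case: x y => [? ?] [? ?].
split.
  apply: (measurable_coordinate_fun (f := fun l => Re (f l))).
  apply/subspace_continuousP => l Ml; apply/cvgrPdist_lt => e e0.
  have := cf l Ml e e0; apply: filterS => l' hl' Ml'; rewrite distrC ReB.
  by apply: le_lt_trans (normc_Re _) _; exact: hl'.
apply: (measurable_coordinate_fun (f := fun l => Im (f l))).
apply/subspace_continuousP => l Ml; apply/cvgrPdist_lt => e e0.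
have := cf l Ml e e0; apply: filterS => l' hl' Ml'; rewrite distrC ImB.
by apply: le_lt_trans (normc_Im _) _; exact: hl'.
Qed.

Lemma measurable_normc (f : Omega -> C) : measurable_complex f ->
  measurable_fun D (fun L => normc (f L)).
Proof.
move=> [f1 f2].
apply: (eq_measurable_fun (Num.sqrt \o (fun L => Re (f L) ^+ 2 + Im (f L) ^+ 2))).
  by move=> L _; rewrite /=; case: (f L).
apply: measurableT_comp.
  by apply: continuous_measurable_fun; exact: sqrt_continuous.
by apply: measurable_funD; apply: measurable_funX.
Qed.

Variable mbar : probability Omega R.
Hypothesis M_pos : (0 < lebesgue_Cn M)%E.
Hypothesis mbar_product : is_product_measure (normalized_lebesgue M) mbar.

(** Read off from the total mass of [mbar], through a cylinder with one unrestricted coordinate,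
    without presupposing that [M] has finite measure. *)
Lemma normalized_lebesgue_M : normalized_lebesgue M M = 1%E.
Proof.
have h := mbar_product 1 (A := fun _ => setT) (fun _ => setT_borel).
rewrite big_ord1 in h; rewrite /normalized_lebesgue setIid.
have <- : normalized_lebesgue M setT = (lebesgue_Cn M * ((fine (lebesgue_Cn M))^-1)%:E)%E.
  by rewrite /normalized_lebesgue setTI.
rewrite -h (_ : [set L : Omega | _] = setT) ?probability_setT//.
by apply/seteqP; split.
Qed.

(** If the measure were infinite, its [fine] would be 0, as would the inverse of that, and the
    normalized mass would be 0 instead of 1. *)
Lemma lebesgue_M_fin : exists2 r : R, 0 < r & lebesgue_Cn M = r%:E.
Proof.
have := normalized_lebesgue_M; rewrite /normalized_lebesgue setIid.
case: (lebesgue_Cn M) M_pos => [r| |] //= r0; first by exists r.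
by rewrite invr0 mule0 => -[] /eqP; rewrite eq_sym oner_eq0.
Qed.

(** The product hypothesis speaks of finitely many coordinates only; continuity from above carries
    it to all of them. *)
Lemma prob_param_seqs : mbar D = 1%E.
Proof.
pose F n := [set L : Omega | forall i, (i < n)%N -> M (L i)].
have mF n : measurable (F n).
  by apply: (cylinder_measurable n (A := fun _ => M)) => _; exact: compact_borel.
have FD : D = \bigcap_n F n.
  apply/seteqP; split=> [L hL n _ i _|L hL n]; first exact: hL.
  exact: (hL n.+1 I n (ltnSn n)).
have mbarF n : mbar (F n) = 1%E.
  rewrite (mbar_product n (A := fun _ => M)); last by move=> _; exact: compact_borel.
  by rewrite big1// => i _; exact: normalized_lebesgue_M.
have F0 : (mbar (F 0%N) < +oo)%E by rewrite mbarF ltry.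
have mI : measurable (\bigcap_n F n) by rewrite -FD; exact: param_seqs_measurable.
have dF : {homo F : n m / (n <= m)%N >-> (m <= n)%O}.
  move=> n m nm; apply/subsetPset => L hL i il; apply: hL.
  exact: leq_trans il nm.
have := nonincreasing_cvg_mu F0 mF mI dF; rewrite -FD => h.
have h1 : (mbar \o F) @ \oo --> 1%E.
  have -> : mbar \o F = cst 1%E by apply/funext => n; rewrite /= mbarF.
  exact: cvg_cst.
exact: (cvg_unique _ h h1).
Qed.

Lemma cylinder_gt0 n (U : nat -> set param) : full_lebesgue_support M ->
  (forall i, open (U i)) -> (forall i, U i `&` M !=set0) ->
  (0 < mbar (D `&` [set L | forall i, (i < n)%N -> U i (L i)]))%E.
Proof.
move=> fs oU UM; set B := [set L : Omega | _].
have mB : measurable B by apply: cylinder_measurable => i; exact: open_borel.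
have mD := param_seqs_measurable.
(* The product formula applies to [B]; intersecting with the set [D] of full measure loses
   nothing. *)
have BE : mbar B = mbar (D `&` B).
  have B0 : mbar (B `\` D) = 0%E.
    apply/eqP; rewrite eq_le measure_ge0 andbT.
    have <- : mbar (~` D) = 0%E by rewrite probability_setC// prob_param_seqs subee.
    apply: le_measure; rewrite ?inE;
      by do ?[exact: measurableD|exact: measurableC|by move=> ? []].
  by have := measureDI mbar mB mD; rewrite [X in (X + _)%E]B0 add0e setIC.
rewrite -BE (mbar_product n (A := U)); last by move=> i; exact: open_borel.
have [r r0 rE] := lebesgue_M_fin.
elim: n {B mB BE} => [|n IH]; first by rewrite big_ord0.
rewrite big_ord_recr /=; apply: mule_gt0 => //.
rewrite /normalized_lebesgue mule_gt0//; first exact: fs.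
by rewrite lte_fin rE invr_gt0.
Qed.

End ProductMeasure.

(** * Measurability of the Green functions in the parameter sequence *)

Section GreenMeasurable.
Context {R : realType} {k : nat}.
Local Notation C := R[i].
Local Notation param := 'rV[C]_k.
Local Notation Omega := (@seq_space R k).
Variables (M : set param) (s : nat) (d : 'I_s -> nat)
  (p : 'I_s -> param -> {poly C}) (a : 'I_s -> param -> C) (fwd : bool).
Hypotheses (M_compact : compact M) (s_gt0 : (0 < s)%N)
  (d_ge2 : forall j, (2 <= d j)%N)
  (p_monic : forall j l, M l -> p j l \is monic)
  (p_degree : forall j l, M l -> size (p j l) = (d j).+1)
  (p_continuous : forall j i, {within M, continuous (fun l => (p j l)`_i)})
  (a_continuous : forall j, {within M, continuous (a j)})
  (a_neq0 : forall j l, M l -> a j l != 0).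

Let H := henon_pm p a fwd.
Let deg := (\prod_(j < s) d j)%N.
Let D : set Omega := param_seqs M.

Lemma orbit_measurable n z :
  measurable_complex M (fun L => (orbit_seq H L n z).1) /\
  measurable_complex M (fun L => (orbit_seq H L n z).2).
Proof.
elim: n => [|n [h1 h2]].
  by split; exact: function_ring_cst (measurable_complex_ring M) _.
apply: (henon_function_ring fwd p_degree p_continuous a_continuous a_neq0
  (measurable_complex_ring M) (lam := fun L : Omega => L n)
  (z := fun L : Omega => orbit_seq H L n z)) => //.
by move=> f cf; exact: measurable_complex_coordinate.
Qed.

Lemma green_measurable z : measurable_fun D (fun L : Omega => green H deg L z).
Proof.
have [r [c [K sys]]] := henon_system_exists fwd M_compact s_gt0 d_ge2 p_monic p_degree
  p_continuous a_continuous a_neq0.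
pose h n (L : Omega) := log_max1 (orbit_seq H L n z) / deg%:R ^+ n.
have mh n : measurable_fun D (h n).
  apply: measurable_funM; last exact: measurable_cst.
  apply: measurableT_comp; first exact: measurable_ln.
  apply: measurable_maxr; first exact: measurable_cst.
  have [h1 h2] := orbit_measurable n z.
  by apply: measurable_maxr; exact: measurable_normc.
by apply: (measurable_fun_cvg mh) => L DL; exact: (log_max1_cvg sys).
Qed.

End GreenMeasurable.

(** * Finite differences of the Green functions off the filled Julia sets *)

Section GreenFiniteDiff.
Context {R : realType} {T : Type}.
Local Notation C := R[i].
Implicit Types (z w b : C * C) (L : nat -> T).
Variables (F : T -> C * C -> C * C) (M : set T) (fwd : bool) (r c K : R) (d : nat).
Hypothesis sys : henon_system fwd r c K d F M.

Let dn0 n : 0 < d%:R ^+ n :> R.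
Proof. by rewrite exprn_gt0// ltr0n (leq_trans _ (henon_system_degree sys)). Qed.

Lemma escaping_open z : escaping fwd r z ->
  exists2 dl : R, 0 < dl & forall w, nrm (w - z) < dl -> escaping fwd r w.
Proof.
move=> /andP[sb rb].
(* Half of the gap, since both moduli may move by [nrm (w - z)]. *)
exists (Num.min ((normc (big fwd z) - normc (small fwd z)) / 2) (normc (big fwd z) - r)).
  by rewrite lt_min divr_gt0 ?subr_gt0.
move=> w; rewrite lt_min => /andP[w1 w2].
have hb : normc (big fwd z) - nrm (w - z) <= normc (big fwd w).
  rewrite lerBlDr -lerBlDl (le_trans (ler_normcDr _ _))// normc_distC -bigB.
  exact: normc_big.
have hs : normc (small fwd w) <= normc (small fwd z) + nrm (w - z).
  rewrite -lerBlDl (le_trans (ler_normcDr _ _))// -smallB.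
  exact: normc_small.
by apply/andP; split; lra.
Qed.

(** Continuity of the time [n] map at [z] is read off from the relative expansion estimate. *)
Lemma orbit_escaping_open L n z : param_seqs M L ->
  escaping fwd r (orbit_seq F L n z) ->
  exists2 dl : R, 0 < dl &
    forall w, nrm (w - z) < dl -> escaping fwd r (orbit_seq F L n w).
Proof.
move=> ML ez; have [dl0 dl00 h0] := escaping_open ez.
pose rho := Num.max (nrm z) r.
have rr : r <= rho by rewrite le_max lexx orbT.
have zr : near_or_escaping fwd r rho z by rewrite /near_or_escaping le_max lexx orbT.
pose B := expansion_const c K d rho.
have B0 : 0 < B ^+ n.
  rewrite exprn_gt0// (lt_le_trans _ (expansion_const_ge sys rr))//.
  by rewrite ltr0n (leq_trans _ (henon_system_degree sys)).
set m := max1 (orbit_seq F L n z).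
have m0 : 0 < m by exact: max1_gt0.
exists (Num.min ((B ^+ n)^-1) (dl0 / (B ^+ n * m))).
  by rewrite lt_min invr_gt0 B0 divr_gt0// mulr_gt0.
move=> w; rewrite lt_min => /andP[w1 w2]; apply: h0.
have Be : B ^+ n * nrm (z - w) <= 1.
  by rewrite nrm_distC mulrC -ler_pdivlMr// mul1r ltW.
have := orbit_relative_expansion sys rr ML zr (nrm_ge0 (z - w)) Be (lexx _).
rewrite nrm_distC => h; apply: le_lt_trans h _.
rewrite (nrm_distC z) mulrAC mulrC -ltr_pdivlMr//.
by rewrite mulr_gt0.
Qed.

(** On the escape region this equals the approximant with [log_max1], but along a complex line it is
    the logarithm of a single polynomial. *)
Definition log_big_orbit L n z : R :=
  ln (normc (big fwd (orbit_seq F L n z))) / d%:R ^+ n.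

Lemma log_big_orbit_finite_diff L n w b (rho : R) : param_seqs M L -> 0 < rho ->
  (forall t : C, normc t < rho -> escaping fwd r (orbit_seq F L n (w + t *: b))) ->
  finite_diff (log_big_orbit L n) w b (rho / 4) (2 * (24 / rho ^+ 3)).
Proof.
move=> ML rho0 ht; have K0 : 0 <= 24 / rho ^+ 3 by rewrite divr_ge0// exprn_ge0// ltW.
apply: taylor_finite_diff => //; first by rewrite divr_gt0.
have [X [Y [sX sY XY]]] := orbit_poly sys n w b ML.
pose P := if fwd then Y else X.
have PE t : big fwd (orbit_seq F L n (w + t *: b)) = P.[t].
  by rewrite XY /big /P; case: fwd.
have sP : (size P <= (d ^ n).+1)%N by rewrite /P; case: fwd.
have P0 t : normc t < rho -> P.[t] != 0.
  move=> /ht /andP[h _]; rewrite -PE -normc_gt0.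
  exact: le_lt_trans (normc_ge0 _) h.
have [c1 [c2 h]] := log_poly_taylor rho0 sP P0.
pose D : C := ((d%:R ^+ n)^-1 : R)%:C.
have ReD (x : C) : Re (D * x) = (d%:R ^+ n)^-1 * Re x.
  by case: x => x y /=; rewrite mul0r subr0.
exists (D * c1), (D * c2) => t tr; rewrite -!mulrA !ReD /log_big_orbit PE.
have -> : big fwd (orbit_seq F L n w) = P.[0] by rewrite -PE scale0r addr0.
have := h t tr; rewrite natrX => ht'.
have -> : ln (normc P.[t]) / d%:R ^+ n - ln (normc P.[0]) / d%:R ^+ n -
   (d%:R ^+ n)^-1 * Re (c1 * t) - (d%:R ^+ n)^-1 * Re (c2 * t ^+ 2) =
   (d%:R ^+ n)^-1 * (ln (normc P.[t]) - ln (normc P.[0]) - Re (c1 * t) - Re (c2 * t ^+ 2)).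
  by ring.
rewrite normrM gtr0_norm ?invr_gt0// mulrC ler_pdivrMr//.
by apply: (le_trans ht'); rewrite le_eqVlt; apply/orP; left; apply/eqP; ring.
Qed.

(** Each point of the disc escapes at some time, so do its neighbours, and escape persists; by
    compactness one time serves the whole disc. That time depends on [L] and [w], but the bound for
    [log_big_orbit] does not depend on it. *)
Lemma green_finite_diff L w b (rho : R) : param_seqs M L -> 0 < rho ->
  (forall t : C, normc t <= 2 * rho -> ~ filled_julia F L (w + t *: b)) ->
  finite_diff (green F d L) w b (rho / 4) (2 * (24 / rho ^+ 3)).
Proof.
move=> ML rho0 hK.
pose tq (q : R * R) : C := q.1 +i* q.2.
(* A square in real coordinates, compact as a product of segments, lying between the discs of radius
   [rho] and [2 * rho]. *)
pose S : set (R * R) := `[- rho, rho]%classic `*` `[- rho, rho]%classic.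
have cS : compact S by apply: compact_setX; exact: segment_compact.
have tS q : S q -> normc (tq q) <= 2 * rho.
  move=> [/= q1 q2]; apply: (le_trans (normc_le_ReIm (tq q))).
  rewrite /= mulr_natl mulr2n; apply: lerD; rewrite ler_norml.
    by move: q1; rewrite in_itv.
  by move: q2; rewrite in_itv.
pose Pn (n : nat) (q : R * R) := is_true (escaping fwd r (orbit_seq F L n (w + tq q *: b))).
have ev : \forall n \near \oo, S `<=` Pn n.
  have := (compact_near_coveringP S).1 cS nat \oo Pn _; apply => q Sq.
  have [n en] := not_filled_julia_escaping sys ML (hK _ (tS q Sq)).
  have [dl dl0 hdl] := orbit_escaping_open ML en.
  pose eta := dl / (2 * (nrm b + 1)).
  have nb : 0 < nrm b + 1 by rewrite ltr_wpDl// nrm_ge0.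
  have eta0 : 0 < eta by rewrite divr_gt0// mulr_gt0.
  exists ([set q' | ball q eta q'], [set m | (n <= m)%N]).
    by split => /=; [exact: nbhsx_ballx|exists n].
  move=> [q' m] /= [[b1 b2] nm]; rewrite /Pn.
  apply: (orbit_escaping sys ML nm); apply: hdl.
  rewrite opprD addrACA subrr add0r -scalerBl nrmZ.
  have tb : normc (tq q' - tq q) <= 2 * eta.
    apply: (le_trans (normc_le_ReIm (tq q' - tq q))); rewrite /= mulr_natl mulr2n.
    by apply: lerD; rewrite distrC; apply: ltW; [exact: b1|exact: b2].
  apply: (@le_lt_trans _ _ (2 * eta * nrm b)); first by rewrite ler_wpM2r// nrm_ge0.
  apply: (@lt_le_trans _ _ (2 * eta * (nrm b + 1))).
    by rewrite ltr_pM2l ?ltrDl// mulr_gt0.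
  by rewrite le_eqVlt; apply/orP; left; apply/eqP; rewrite /eta; field; rewrite gt_eqF.
have ev' : \forall n \near \oo, forall t : C, normc t < rho ->
    escaping fwd r (orbit_seq F L n (w + t *: b)).
  apply: filterS ev => n hn t tr.
  have := hn (Re t, Im t); rewrite /Pn /tq /=.
  have -> : (Re t +i* Im t) = t by case: (t).
  apply; split => /=; rewrite in_itv /= -ler_norml.
    exact: le_trans (normc_Re t) (ltW tr).
  exact: le_trans (normc_Im t) (ltW tr).
apply: (@finite_diff_cvg _ (log_big_orbit L)); last first.
  by apply: filterS ev' => n hn; exact: log_big_orbit_finite_diff.
move=> t tr; have tr' : normc t < rho.
  by apply: le_lt_trans tr _; rewrite gtr_pMr// invf_lt1// ltr1n.
apply: cvg_trans (@log_max1_cvg _ _ _ _ _ _ _ _ _ sys L (w + t *: b) ML).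
apply: near_eq_cvg; apply: filterS ev' => n /(_ t tr') en.
by rewrite /log_big_orbit /log_max1 (max1_escaping sys en) (nrm_escaping en).
Qed.

End GreenFiniteDiff.

(** * Average Green function *)

Section CompactSets.
Context {R : realType}.
Local Notation C := R[i].

Lemma continuous_nrm : continuous (@nrm R).
Proof.
move=> z; apply/continuous_nrmP => e e0; exists e => // w wz.
rewrite ler_norml; apply/andP; split.
  by rewrite lerNl opprB (le_trans (ler_nrmDr _ _))// nrm_distC ltW.
by rewrite (le_trans (ler_nrmDr _ _))// ltW.
Qed.

Lemma compact_nrm_bounded (A : set (C * C)) : compact A ->
  exists B : R, forall z, A z -> nrm z <= B.
Proof.
move=> cA; have cn : {within A, continuous (@nrm R)}.
  exact: continuous_subspaceT continuous_nrm.
have [B [_ hB]] := compact_bounded (continuous_compact cn cA).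
exists (B + 1) => z Az; have hl : B < B + 1 by rewrite ltrDl.
have := hB _ hl (nrm z); rewrite /= ger0_norm ?nrm_ge0//; apply.
by exists z.
Qed.

End CompactSets.

Section AverageGreen.
Context {R : realType} {T : Type} d {Omega : measurableType d}.
Local Notation C := R[i].
Implicit Types (z w b : C * C).
Variables (F : T -> C * C -> C * C) (M : set T) (fwd : bool) (r c K : R) (deg : nat).
Hypothesis sys : henon_system fwd r c K deg F M.
Variables (P : probability Omega R) (D : set Omega) (seq_of : Omega -> nat -> T).
Hypotheses (mD : measurable D) (PD : P D = 1%E)
  (DM : forall x, D x -> param_seqs M (seq_of x)).

Let g x z := green F deg (seq_of x) z.
Hypothesis mg : forall z, measurable_fun D (g^~ z).

Local Notation EG := (average P D g).

Lemma green_ge0_average x z : D x -> 0 <= g x z.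
Proof. by move=> Dx; apply: (green_ge0 sys); exact: DM. Qed.

Lemma green_bounded z : exists B, forall x, D x -> `|g x z| <= B.
Proof.
exists (log_max1 z + green_const c K) => x Dx.
by rewrite ger0_norm ?green_ge0_average// (green_upper sys)//; exact: DM.
Qed.

Lemma average_green_dist z w B : (forall x, D x -> `|g x z - g x w| <= B) ->
  `|EG z - EG w| <= B.
Proof.
move=> hB; have E (u : C * C -> R) :
    \sum_(q <- [:: (1, z); (-1, w)]) q.1 * u q.2 = u z - u w.
  by rewrite !big_cons big_nil /= mul1r mulN1r addr0.
rewrite -(E EG); apply: (average_lincomb mD PD mg green_bounded) => x Dx.
by rewrite E; exact: hB.
Qed.

Lemma average_green_uniform_continuous (rho e : R) : 0 < e ->
  exists2 dl : R, 0 < dl & forall z w, nrm z <= rho -> nrm w <= rho ->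
    nrm (z - w) <= dl -> `|EG z - EG w| <= e.
Proof.
move=> e0; have [dl dl0 h] := green_uniform_continuous sys rho e0.
exists dl => // z w zr wr zw; apply: average_green_dist => x Dx.
by apply: h => //; exact: DM.
Qed.

Lemma average_green_continuous : continuous EG.
Proof.
move=> z; apply/continuous_nrmP => e e0.
have [dl dl0 h] := average_green_uniform_continuous (nrm z + 1) e0.
exists (Num.min dl 1); first by rewrite lt_min dl0 ltr01.
move=> w; rewrite lt_min => /andP[w1 w2]; apply: h; rewrite ?lerDl ?(ltW w1)//.
have : nrm w <= nrm (w - z) + nrm z by rewrite -{1}(subrK z w) nrmD.
by lra.
Qed.

Lemma average_green_locally_holder : locally_holder EG.
Proof.
move=> A /compact_nrm_bounded[B hB].
pose rho := Num.max B r; have rr : r <= rho by rewrite le_max lexx orbT.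
have rho1 : 1 <= rho by exact: le_trans (henon_system_r1 sys) rr.
exists (hoelder_const c K deg rho), (hoelder_exp c K deg rho); split.
- exact: hoelder_exp_gt0 sys _ rr.
- exact: hoelder_exp_le1 sys _ rr.
move=> z w Az Aw; apply: average_green_dist => x Dx.
have zr : nrm z <= rho by rewrite le_max hB.
have wr : nrm w <= rho by rewrite le_max hB.
apply: (le_trans (green_hoelder sys rr (DM Dx) zr wr)).
have k0 := green_const_ge0 sys; have l0 : 0 <= ln rho by exact: ln_ge0.
rewrite ler_wpM2l//.
  by rewrite mulr_ge0// addr_ge0// mulr_ge0// addr_ge0.
rewrite ge0_ler_powR ?nnegrE ?nrm_ge0 ?nrm_le_norm2//.
  exact/ltW/(hoelder_exp_gt0 sys rr).
by rewrite (le_trans (nrm_ge0 _) (nrm_le_norm2 _)).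
Qed.

Lemma average_green_submean z b (s e : R) : 0 < s -> 0 < e ->
  \forall N \near \oo, EG z - e <=
    N%:R^-1 * \sum_(j < N) EG (z + (s%:C * omega N ^+ j) *: b).
Proof.
move=> s0 e0.
pose l N : seq (R * (C * C)) :=
  [seq (N%:R^-1, z + (s%:C * omega N ^+ j) *: b) | j : 'I_N <- index_enum 'I_N].
have lE N (u : C * C -> R) : \sum_(q <- l N) q.1 * u q.2 =
    N%:R^-1 * \sum_(j < N) u (z + (s%:C * omega N ^+ j) *: b).
  by rewrite big_map mulr_sumr.
apply: (@filterS _ _ _ (fun N => EG z - e <= \sum_(q <- l N) q.1 * EG q.2)).
  by move=> N; rewrite lE.
apply: (average_liminf mD PD mg green_bounded) => //.
- by move=> x v Dx; exact: green_ge0_average.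
- by move=> N q /mapP[j _ ->] /=; rewrite invr_ge0.
move=> x e' Dx e'0; have := green_submean sys z b (DM Dx) s0 e'0.
by apply: filterS => N; rewrite lE.
Qed.

Lemma average_green_plurisubharmonic : plurisubharmonic (fun z => (EG z)%:E).
Proof.
split; first by move=> z; rewrite ltry.
  exact: continuous_upper_semicontinuous average_green_continuous.
move=> z b; apply: subharmonic_of_means.
- move=> t A /nbhs_ballP[e /= e0 eA].
  have e2 : 0 < e / 2 by rewrite divr_gt0.
  have [dl dl0 h] := (continuous_nrmP EG (z + t *: b)).1
    (@average_green_continuous (z + t *: b)) _ e2.
  have nb : 0 < nrm b + 1 by rewrite ltr_wpDl// nrm_ge0.
  apply/(nbhs_normcP t); exists (dl / (nrm b + 1)); first by rewrite divr_gt0.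
  move=> u ut; apply: eA; rewrite /ball /= distrC.
  apply: (@le_lt_trans _ _ (e / 2)); last by rewrite gtr_pMr// invf_lt1// ltr1n.
  apply: h; rewrite opprD addrACA subrr add0r -scalerBl nrmZ.
  rewrite ltr_pdivlMr// in ut; apply: le_lt_trans ut.
  by rewrite ler_wpM2l ?normc_ge0// lerDl.
- move=> rho e e0.
  have [dl dl0 h] := average_green_uniform_continuous (nrm z + rho * nrm b) e0.
  have nb : 0 < nrm b + 1 by rewrite ltr_wpDl// nrm_ge0.
  have zt (t : C) : normc t <= rho -> nrm (z + t *: b) <= nrm z + rho * nrm b.
    by move=> tr; rewrite (le_trans (nrmD _ _))// lerD2l nrmZ ler_wpM2r// nrm_ge0.
  exists (dl / (nrm b + 1)); first by rewrite divr_gt0.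
  move=> t u tr ur tu; apply: h; rewrite ?zt//.
  rewrite opprD addrACA subrr add0r -scalerBl nrmZ.
  rewrite ler_pdivlMr// in tu; apply: le_trans tu.
  by rewrite ler_wpM2l ?normc_ge0// lerDl.
- move=> t s e s0 e0.
  have translate (f : C * C -> R) N : f (z + t *: b) - e <=
        N%:R^-1 * \sum_(j < N) f (z + t *: b + (s%:C * omega N ^+ j) *: b) ->
      f (z + t *: b) - e <=
        N%:R^-1 * \sum_(j < N) f (z + (t + s%:C * omega N ^+ j) *: b).
    by under [in X in _ -> X]eq_bigr do rewrite scalerDl addrA.
  have := average_green_submean (z + t *: b) b s0 e0; apply: filterS => N.
  exact: (translate EG).
Qed.

Lemma average_green_gt0 z : (forall x, D x -> ~ filled_julia F (seq_of x) z) ->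
  0 < EG z.
Proof.
move=> hz; apply: (average_gt0 mD PD mg green_bounded (A := D)) => //.
- by move=> x Dx; exact: green_ge0_average.
- by rewrite PD.
move=> x Dx.
have [n en] := not_filled_julia_escaping sys (DM Dx) (hz x Dx).
exact: (green_gt0 sys (DM Dx) en).
Qed.

Lemma average_green_pluriharmonic (U : set (C * C)) : open U ->
  (forall x z, D x -> U z -> ~ filled_julia F (seq_of x) z) ->
  pluriharmonic_on U EG.
Proof.
move=> oU hU; apply: finite_diff_pluriharmonic => //.
  exact: average_green_continuous.
move=> z b Uz; have nU : nbhs z U by exact: (open_nbhs_nbhs (conj oU Uz)).
have /nbhs_nrmP[e e0 eU] := nU.
have nb : 0 < nrm b + 1 by rewrite ltr_wpDl// nrm_ge0.
(* A displacement [t *: b] with [normc t <= 2 * rho] then has length at most [e / 2], which together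
   with [nrm (w - z) < e / 2] stays in [U]. The [+ 1] covers [b = 0]. *)
pose rho := e / (4 * (nrm b + 1)).
have rho0 : 0 < rho by rewrite divr_gt0// mulr_gt0.
exists (e / 2), (Num.min 1 (rho / 4)), (2 * (24 / rho ^+ 3)); split.
- by rewrite divr_gt0.
- by rewrite lt_min ltr01 divr_gt0.
- by rewrite ge_min lexx.
- by rewrite mulr_ge0// divr_ge0// exprn_ge0// ltW.
move=> w wz; apply: (@finite_diff_le _ _ _ _ (rho / 4) (2 * (24 / rho ^+ 3))) => //.
  by rewrite ge_min lexx orbT.
apply: finite_diff_average => //; first exact: green_bounded.
move=> x Dx; apply: (green_finite_diff sys (DM Dx) rho0) => t tr.
apply: hU => //; apply: eU; rewrite addrAC.
apply: (le_lt_trans (nrmD _ _)); rewrite nrmZ.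
have : normc t * nrm b <= 2 * rho * (nrm b + 1).
  by apply: ler_pM; rewrite ?normc_ge0 ?nrm_ge0// lerDl.
have -> : 2 * rho * (nrm b + 1) = e / 2 by rewrite /rho; field; rewrite gt_eqF.
by lra.
Qed.

Lemma average_green_eq0 z : (forall x, D x -> filled_julia F (seq_of x) z) ->
  EG z = 0.
Proof.
move=> hz; apply: average_eq0 => // x Dx.
by apply: (green_filled_julia sys (DM Dx)); exact: hz.
Qed.

End AverageGreen.

Theorem proposition1p2 (R : realType) (k : nat) (M : set 'rV[R[i]]_k)
    (M_compact : compact M)
    (M_pos : (0 < lebesgue_Cn M)%E)
    (s : nat) (s_gt0 : (0 < s)%N)
    (d : 'I_s -> nat) (d_ge2 : forall j, (2 <= d j)%N)
    (p : 'I_s -> 'rV[R[i]]_k -> {poly R[i]})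
    (p_monic : forall j l, M l -> p j l \is monic)
    (p_degree : forall j l, M l -> size (p j l) = (d j).+1)
    (p_continuous : forall j i, {within M, continuous (fun l => (p j l)`_i)})
    (a : 'I_s -> 'rV[R[i]]_k -> R[i])
    (a_continuous : forall j, {within M, continuous (a j)})
    (a_neq0 : forall j l, M l -> a j l != 0)
    (mbar : probability (@seq_space R k) R)
    (mbar_product : is_product_measure (normalized_lebesgue M) mbar)
    (fwd : bool) :
  let H := henon_pm p a fwd in
  let EG := average_green mbar H (\prod_(j < s) d j)%N M in
  [/\ locally_holder EG,
      plurisubharmonic (fun z => (EG z)%:E),
      (forall z, ~ julia_union H M z -> 0 < EG z) /\
        pluriharmonic_on (~` julia_union H M) EG &
      julia_inter H M `<=` [set z | EG z = 0] /\
        (full_lebesgue_support M ->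
         [set z | EG z = 0] `<=` julia_inter H M)].
Proof.
move=> H EG; pose D : set (@seq_space R k) := param_seqs M.
have [r [c [K sys]]] := henon_system_exists fwd M_compact s_gt0 d_ge2 p_monic p_degree
  p_continuous a_continuous a_neq0.
have mD : measurable D by exact: param_seqs_measurable.
have PD : mbar D = 1%E by exact: prob_param_seqs.
have mg := green_measurable fwd M_compact s_gt0 d_ge2 p_monic p_degree
  p_continuous a_continuous a_neq0.
have DM (L : @seq_space R k) : D L -> param_seqs M L by [].
have sub L z : param_seqs M L -> filled_julia H L z -> julia_union H M z.
  by move=> ML fz; apply: subset_closure; exists L.
split.
- exact: (average_green_locally_holder sys mD PD DM mg).
- exact: (average_green_plurisubharmonic sys mD PD DM mg).
- split.
    move=> z nz; apply: (average_green_gt0 sys mD PD DM mg) => L DL fz.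
    exact/nz/(sub L).
  apply: (average_green_pluriharmonic sys mD PD DM mg).
    by rewrite openC; exact: closed_closure.
  by move=> L z DL nz fz; exact/nz/(sub L).
split.
  by move=> z hz; exact: (average_green_eq0 sys mbar mD DM hz).
(* If one sequence [L0] lets [z] escape at time [n], so do all sequences in a cylinder around [L0];
   full support gives the cylinder positive probability, so the average would be positive. *)
move=> fs z EGz L0 ML0; apply: contrapT => nf.
have [n en] := not_filled_julia_escaping sys ML0 nf.
have [dl dl0 hdl] := escaping_open en.
have [U [hU1 hU2]] := orbit_parameter_continuous fwd M_compact s_gt0 d_ge2 p_monic
  p_degree p_continuous a_continuous a_neq0 n z ML0 dl0.
pose B : set (@seq_space R k) := [set L | forall i, (i < n)%N -> U i (L i)].
have PA : (0 < mbar (D `&` B))%E.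
  apply: (cylinder_gt0 M_compact M_pos mbar_product n fs).
    by move=> i; have [] := hU1 i.
  by move=> i; exists (L0 i); split; [have [] := hU1 i|exact: ML0].
have mB : measurable B.
  by apply: cylinder_measurable => i; apply: open_borel; have [] := hU1 i.
have : 0 < EG z; last by rewrite EGz ltxx.
have g0 (L : @seq_space R k) : D L -> 0 <= green H (\prod_(j < s) d j)%N L z.
  by move=> DL; exact: (green_ge0 sys).
apply: (average_gt0 mD PD mg (green_bounded sys DM) g0 (measurableI _ _ mD mB) _ PA).
  by move=> L [].
move=> L [DL BL]; apply: (green_gt0 sys DL (n := n)).
by apply: hdl; exact: hU2.
Qed.
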